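(* Let $F_1,F_2,F_3,\ldots$ be a sequence of field extensions of $\mathbb{Q}$ with $[F_i:\mathbb{Q}]\leq 3$ such that for each integer $i>1$ there is a prime $p_i$ with $p_i\mid \Delta_{F_i}$ and $p_i\nmid \Delta_{F_j}$ for $1\leq j<i$. Furthermore suppose that for each $i>1$ at least one of the following conditions holds: (a) $F_i/\mathbb{Q}$ is Galois. (b) $F_i=\mathbb{Q}(\alpha)$ for an $\alpha$ with $\alpha^3 \in \mathbb{Q}$. (c) $F_i=\mathbb{Q}(\alpha)$ for an algebraic integer $\alpha$ with $2\nmid \mathrm{ord}_{p_i}\mathrm{Disc}(D_{\alpha})$, where $D_{\alpha}\in \mathbb{Z}[x]$ is the monic minimal polynomial of $\alpha$. (d) $F_i=\mathbb{Q}(\alpha)$ for a root $\alpha$ of a polynomial of the form $x^3+a_0c^3x^l+b_0^lc^3$ with $l\in \{1,2\}$ and rational integers $a_0,b_0,c$ satisfying $\gcd(2a_0c,3b_0)=1$. Then the compositum of $F_1^{(g)},F_2^{(g)},F_3^{(g)},\ldots$ has the Northcott property.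
   Context: All fields lie in a fixed algebraic closure $\overline{\mathbb{Q}}$ of $\mathbb{Q}$. $H(\cdot)$ denotes the non-logarithmic absolute Weil height on $\overline{\mathbb{Q}}$: for $\alpha$ in a number field $F$, $H(\alpha)=\prod_v \max\{1,|\alpha|_v\}^{[F_v:\mathbb{Q}_v]/[F:\mathbb{Q}]}$, the product over all places $v$ of $F$, with $|\cdot|_v$ extending the usual absolute values of $\mathbb{Q}$. A subset $\mathcal{A}\subseteq\overline{\mathbb{Q}}$ has the Northcott property (property $(N)$) if for each positive real $X$ there are only finitely many $\alpha\in\mathcal{A}$ with $H(\alpha)\le X$. $\Delta_F$ denotes the absolute discriminant of a number field $F$; primes $p_i$ are prime numbers in $\mathbb{Z}$. $F_i^{(g)}$ denotes the Galois closure of $F_i$ over $\mathbb{Q}$. $\mathrm{Disc}(D)$ is the discriminant of the polynomial $D$, and $\mathrm{ord}_p$ is the $p$-adic valuation on $\mathbb{Q}$. *)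

(* Defs.v *)
(* algC serves as the fixed algebraic closure of the rationals. *)
From HB Require Import structures.
From mathcomp Require Import all_boot all_order all_algebra all_field.
From mathcomp Require Import all_classical all_reals all_analysis.

Set Implicit Arguments.
Unset Strict Implicit.
Unset Printing Implicit Defensive.

Import Order.TTheory GRing.Theory Num.Theory.
Local Open Scope classical_set_scope.
Local Open Scope ring_scope.

Definition subfield (E : set algC) : Prop :=
  [/\ E 1, (forall x y, E x -> E y -> E (x - y))
    & (forall x y, E x -> E y -> E (x / y))].

(* Elements of algC are algebraic over rat, so normality and separability are
   all that is left to require; minCpoly is the minimal polynomial over rat. *)
Definition galois_over_rat (E : set algC) : Prop :=
  subfield E /\
  (forall x, E x -> separable_poly (minCpoly x) /\
                    (forall y, root (minCpoly x) y -> E y)).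

Definition galois_closure (E : set algC) : set algC :=
  smallest galois_over_rat E.

Definition compositum (I : Type) (E : I -> set algC) : set algC :=
  smallest subfield (\bigcup_i E i).

Section Discriminant.
Variable K : fieldExtType rat.

Definition alg_integer (x : K) : Prop := integralOver (intr : int -> K) x.

(* The trace of multiplication by x on the rational vector space K. *)
Definition trace_rat (x : K) : rat :=
  \sum_(i < \dim {:K})
    coord (vbasis {:K}) i (x * (vbasis {:K})`_i).

(* A basis b of K over rat with O_K = Z b_0 + ... + Z b_(n-1). *)
Definition integral_basis (b : (\dim {:K}).-tuple K) : Prop :=
  [/\ basis_of {:K} b,
      (forall i, alg_integer (tnth b i))
    & (forall x, alg_integer x -> forall i, coord b i x \is a Num.int)].

(* The absolute discriminant; it does not depend on the integral basis. *)
Definition discr : int :=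
  xget 0 [set D : int | exists2 b : (\dim {:K}).-tuple K, integral_basis b &
    D%:~R = \det (\matrix_(i, j) trace_rat (tnth b i * tnth b j))].

End Discriminant.

(* For monic D of degree d: (-1)^(d(d-1)/2) Res(D, D'). *)
Definition poly_disc (D : {poly int}) : int :=
  (-1) ^+ 'C((size D).-1, 2) * resultant D D^`().

Section Height.
Variable R : realType.

Definition padic_abs (p : nat) (q : rat) : R :=
  if q == 0 then 0
  else p%:R ^ ((logn p `|denq q|)%:Z - (logn p `|numq q|)%:Z).

Section Places.
Variable K : fieldExtType rat.

Definition absolute_value (v : K -> R) : Prop :=
  [/\ (forall x, 0 <= v x), (forall x, v x = 0 <-> x = 0),
      {morph v : x y / x * y} & (forall x y, v (x + y) <= v x + v y)].

(* Every place of K contains exactly one absolute value extending one of the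
   usual absolute values of rat; it serves as the representative. *)
Definition places : set (K -> R) :=
  [set v | absolute_value v /\
    ((forall q : rat, v q%:A = `|ratr q|) \/
     (exists2 p, prime p & forall q : rat, v q%:A = padic_abs p q))].

Definition cauchy_at (v : K -> R) (u : nat -> K) : Prop :=
  forall e : R, 0 < e -> exists N, forall m n,
    (N <= m)%N -> (N <= n)%N -> v (u m - u n) < e.

Definition null_at (v : K -> R) (u : nat -> K) : Prop :=
  forall e : R, 0 < e -> exists N, forall n, (N <= n)%N -> v (u n) < e.

(* K_v is the field of Cauchy sequences in K modulo null sequences, and Q_v is
   its subfield of classes of rational Cauchy sequences.  The family e
   represents a basis of K_v over Q_v. *)
Definition local_basis (v : K -> R) (d : nat) (e : 'I_d -> nat -> K) : Prop :=
  let Qcauchy (a : 'I_d -> nat -> rat) :=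
    forall i, cauchy_at v (fun n => (a i n)%:A) in
  [/\ (forall i, cauchy_at v (e i)),
      (forall a, Qcauchy a ->
         null_at v (fun n => \sum_(i < d) a i n *: e i n) ->
         forall i, null_at v (fun n => (a i n)%:A))
    & (forall u, cauchy_at v u -> exists2 a, Qcauchy a &
         null_at v (fun n => u n - \sum_(i < d) a i n *: e i n))].

(* [K_v : Q_v] *)
Definition local_degree (v : K -> R) : nat :=
  xget 0%N [set d | exists e : 'I_d -> nat -> K, local_basis v e].

(* All but finitely many factors are 1, so the finitely supported product is
   the product over all places. *)
Definition height_in (x : K) : R :=
  \big[*%R/1]_(v \in places)
    (Num.max 1 (v x) `^ ((local_degree v)%:R / (\dim {:K})%:R)).

End Places.

(* num_field_exists [:: a] provides an abstract copy of the field Q(a),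
   together with the element corresponding to a. *)
Definition weil_height (a : algC) : R :=
  let: existT K (existT _ (exist2 s _ _)) := num_field_exists [:: a] in
  height_in (head (0 : K) s).

Definition northcott (A : set algC) : Prop :=
  forall X : R, 0 < X -> finite_set [set a | A a /\ weil_height a <= X].

End Height.

Section Conditions.
Variable K : fieldExtType rat.

Definition generates (x : K) : Prop := <<1; x>>%VS = fullv.

Definition pure_cubic_generator : Prop :=
  exists2 x : K, generates x & x ^+ 3 \in 1%VS.

Definition odd_disc_generator (p : nat) : Prop :=
  exists (x : K) (D : {poly int}),
    [/\ generates x, alg_integer x, map_poly intr D = minPoly 1 x
      & ~~ (2 %| logn p `|poly_disc D|)%N].

Definition special_cubic_generator : Prop :=
  exists (x : K) (l : nat) (a0 b0 c : int),
    [/\ generates x, l = 1%N \/ l = 2%N,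
        coprimez (2 * a0 * c) (3 * b0)
      & root (map_poly intr
                ('X^3 + (a0 * c ^+ 3) *: 'X^l + (b0 ^+ l * c ^+ 3)%:P)) x].

End Conditions.

(* Main.v *)
Require Import Defs.
From HB Require Import structures.
From mathcomp Require Import all_boot all_order all_algebra all_field.
From mathcomp Require Import all_classical all_reals all_analysis.
From mathcomp Require Import ring lra zify.

Set Implicit Arguments.
Unset Strict Implicit.
Unset Printing Implicit Defensive.

Import Order.TTheory GRing.Theory Num.Theory.
Local Open Scope classical_set_scope.
Local Open Scope ring_scope.

(** Let K_n be generated by the square roots of -3 and all conjugates of
    F_0, ..., F_(n-1).  The compositum lies in the union of the normal fields K_n.
    If a lies in K_(n+1) but not in K_n, and p = p_n > 3, then
    p <= (8 H(a)^6)^36.  Since the p_n are distinct, bounded height forces a into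
    a fixed K_n, where finiteness follows by bounding the coefficients of the
    characteristic polynomial.

    For the estimate, p is unramified in F_j for j < n, so the p-adic values of
    K_n are powers of p (Frobenius acts on the integers of F_j modulo p).  As p
    ramifies in F_n, an integer whose traces are all divisible by p provides
    an element z of F_n of trace zero whose values are fractional powers of p.
    An element of K_n(z) outside K_n then differs from some conjugate over K_n
    by a quantity divisible by p^(1/3).  In the cubic case with z^3 of value 1/p
    or 1/p^2 this requires the square root of the discriminant to lie in K_n,
    which is what the conditions (a) to (d) guarantee, or else they are
    contradictory; otherwise that square root itself is ramified over K_n(z).
    Applying the product formula to the product of the differences of all
    conjugates over K_n gives the bound. *)

(** * Absolute values on the algebraic numbers *)

(** The square root [s] of the discriminant decides the cubic case: when [z ^ 3] has value 1/p or
    1/p^2, [s] itself has an integral power of p as value, so [K_n(s)] could be a new quadratic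
    extension unramified at p, and nothing would force the heights of its elements to grow with p.
    The constants come from the ordered pairs of distinct conjugates over [K_n]: [K_n(z, s)] has
    degree at most 6, so there are at most 36 pairs; 8 is the cube of the archimedean constant 2,
    since everything is cubed to turn the saving [p^(1/3)] into p. The bound p > 3 makes the
    ramification tame and 2, 3 units at p; the finitely many indices with a smaller prime are
    swallowed by the fixed [K_n]. Ideals and decomposition groups never occur. For each rational
    place one extension to [algC] is chosen, further places arise by composing it with embeddings,
    and ramification is read off the group of values. *)

Section AbsoluteValues.
Variables (R : realType) (F : fieldType) (v : F -> R).

Definition is_abs : Prop :=
  [/\ (forall x, 0 <= v x), (forall x, v x = 0 <-> x = 0),
      {morph v : x y / x * y} & (forall x y, v (x + y) <= v x + v y)].

Definition ultrametric : Prop := forall x y, v (x + y) <= Num.max (v x) (v y).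

Hypothesis vabs : is_abs.

Lemma abs_ge0 x : 0 <= v x. Proof. by have [h _ _ _] := vabs. Qed.
Hint Resolve abs_ge0 : core.

Lemma absM : {morph v : x y / x * y}. Proof. by have [_ _ h _] := vabs. Qed.

Lemma absD x y : v (x + y) <= v x + v y. Proof. by have [_ _ _ h] := vabs. Qed.

Lemma abs_eq0 x : (v x == 0) = (x == 0).
Proof. by have [_ h _ _] := vabs; apply/eqP/eqP => /h. Qed.

Lemma abs0 : v 0 = 0. Proof. by apply/eqP; rewrite abs_eq0. Qed.

Lemma abs_gt0 x : (0 < v x) = (x != 0).
Proof. by rewrite lt_def abs_ge0 andbT abs_eq0. Qed.

Lemma abs1 : v 1 = 1.
Proof.
have h : v 1 != 0 by rewrite abs_eq0 oner_eq0.
by apply: (mulfI h); rewrite -absM !mulr1.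
Qed.

Lemma absN x : v (- x) = v x.
Proof.
rewrite -mulN1r absM; suff -> : v (-1) = 1 by rewrite mul1r.
apply/eqP; rewrite -(@eqrXn2 _ 2) ?abs_ge0 ?ler01 //.
by rewrite expr1n expr2 -absM mulrNN mulr1 abs1.
Qed.

Lemma absV x : v x^-1 = (v x)^-1.
Proof.
have [->|x0] := eqVneq x 0; first by rewrite invr0 abs0 invr0.
have h : v x != 0 by rewrite abs_eq0.
by apply: (mulfI h); rewrite -absM !divff // abs1.
Qed.

Lemma absX n x : v (x ^+ n) = v x ^+ n.
Proof. by elim: n => [|n IH]; rewrite ?expr0 ?abs1 // !exprS absM IH. Qed.

Lemma abs_prod I (r : seq I) (P : pred I) (E : I -> F) :
  v (\prod_(i <- r | P i) E i) = \prod_(i <- r | P i) v (E i).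
Proof. exact: (big_morph v absM abs1). Qed.

Lemma abs_sum I (r : seq I) (P : pred I) (E : I -> F) :
  v (\sum_(i <- r | P i) E i) <= \sum_(i <- r | P i) v (E i).
Proof.
elim/big_rec2: _ => [|i y x _ h]; first by rewrite abs0.
by apply: (le_trans (absD _ _)); rewrite lerD2l.
Qed.

Lemma ultra_sum I (r : seq I) (P : pred I) (E : I -> F) (M : R) :
  ultrametric -> 0 <= M -> (forall i, P i -> v (E i) <= M) ->
  v (\sum_(i <- r | P i) E i) <= M.
Proof.
move=> u M0 h; elim/big_ind: _ => // [|x y hx hy]; first by rewrite abs0.
by apply: (le_trans (u _ _)); rewrite ge_max hx.
Qed.

Lemma ultraB x y : ultrametric -> v (x - y) <= Num.max (v x) (v y).
Proof. by move=> u; rewrite -(absN y) u. Qed.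

Lemma ultra_lt x y : ultrametric -> v x < v y -> v (x + y) = v y.
Proof.
move=> u h; apply/eqP; rewrite eq_le; apply/andP; split.
  by apply: (le_trans (u _ _)); rewrite ge_max (ltW h) lexx.
have := ultraB (x + y) x u; rewrite addrC addKr le_max => /orP[//|].
by rewrite leNgt h.
Qed.

Lemma ultra_nat n : ultrametric -> v n%:R <= 1.
Proof.
move=> u; elim: n => [|n IH]; first by rewrite abs0.
by rewrite -addn1 natrD; apply: (le_trans (u _ _)); rewrite ge_max IH abs1 lexx.
Qed.

Lemma ultra_int n : ultrametric -> v n%:~R <= 1.
Proof. by move=> u; case: n => n; rewrite ?NegzE ?mulrNz ?absN ultra_nat. Qed.

End AbsoluteValues.

Lemma bernoulli (R : realDomainType) (h : R) n : 0 <= h ->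
  1 + h *+ n <= (1 + h) ^+ n.
Proof.
move=> h0; elim: n => [|n IH]; first by rewrite mulr0n expr0 addr0.
rewrite exprS; apply: (@le_trans _ _ ((1 + h) * (1 + h *+ n))).
  rewrite mulrDl mul1r mulrDr mulr1 -addrA lerD2l mulrSr.
  by rewrite lerD2l lerDl mulr_ge0 // mulrn_wge0.
by rewrite ler_wpM2l // addr_ge0.
Qed.

(** Binomial coefficients have value at most 1, so [v (x + y) ^+ n] is at most [(n + 1) M ^+ n];
    linear growth cannot keep up with the powers of a ratio larger than 1. *)
Lemma ultra_of_nat (R : realType) (F : fieldType) (v : F -> R) :
  is_abs v -> (forall n : nat, v n%:R <= 1) -> ultrametric v.
Proof.
move=> va vn x y; set M := Num.max _ _.
have M0 : 0 <= M by rewrite le_max (abs_ge0 va).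
have hx : v x <= M by rewrite le_max lexx.
have hy : v y <= M by rewrite le_max lexx orbT.
have pow n : v (x + y) ^+ n <= n.+1%:R * M ^+ n.
  rewrite -(absX va) exprDn; apply: (le_trans (abs_sum va _ _ _)).
  apply: (@le_trans _ _ (\sum_(i < n.+1) M ^+ n)).
    apply: ler_sum => i _; rewrite -mulr_natr !(absM va) !(absX va) -[leRHS]mulr1.
    apply: ler_pM; rewrite ?mulr_ge0 ?exprn_ge0 ?(abs_ge0 va) //.
    have -> : M ^+ n = M ^+ (n - i) * M ^+ i by rewrite -exprD subnK // -ltnS.
    by apply: ler_pM; rewrite ?exprn_ge0 ?(abs_ge0 va) // lerXn2r ?nnegrE ?(abs_ge0 va).
  by rewrite sumr_const card_ord mulr_natl.
rewrite leNgt; apply/negP => Mlt.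
have Mp : 0 < M.
  rewrite lt_def M0 andbT; apply/eqP => Mz.
  by have := pow 1%N; rewrite !expr1 Mz mulr0 leNgt -Mz Mlt.
pose h := v (x + y) / M - 1.
have hp : 0 < h by rewrite subr_gt0 ltr_pdivlMr // mul1r.
(* Bernoulli alone is linear in [n]; taken to the exponent [2 n] as a square, it beats the bound
   [2 n + 1]. *)
have key n : (1 + h *+ n) ^+ 2 <= (2 * n).+1%:R.
  apply: (@le_trans _ _ ((v (x + y) / M) ^+ (2 * n))).
    rewrite mulnC exprM lerXn2r ?nnegrE ?exprn_ge0 ?addr_ge0 ?mulrn_wge0 ?divr_ge0 ?(abs_ge0 va) ?(ltW hp) //.
    by apply: (le_trans (bernoulli n (ltW hp))); rewrite addrC subrK.
  by rewrite expr_div_n ler_pdivrMr ?exprn_gt0.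
have := key (Num.bound (2 / h ^+ 2)).
have := archi_boundP (divr_ge0 (ler0n R 2) (sqr_ge0 h)).
set n := Num.bound _; rewrite ltr_pdivrMr ?exprn_gt0 // => hn.
rewrite leNgt => /negP; apply; rewrite -addn1 natrD natrM -mulr_natr.
have n1 : 0 < n%:R :> R.
  by rewrite -(@pmulr_lgt0 _ (h ^+ 2)) ?exprn_gt0 //; apply: lt_trans hn.
have := ltr_pM2l n1 2 (n%:R * h ^+ 2); rewrite hn => hn2.
have : 0 < h * n%:R by rewrite mulr_gt0.
by nra.
Qed.

Lemma exprn_unbounded (R : realType) (t M : R) : 1 < t ->
  exists N, forall n, (N <= n)%N -> M < t ^+ n.
Proof.
move=> t1; have h0 : 0 < t - 1 by rewrite subr_gt0.
exists (Num.bound (`|M| / (t - 1))) => n hn.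
have := archi_boundP (divr_ge0 (normr_ge0 M) (ltW h0)).
rewrite ltr_pdivrMr // => /(le_lt_trans (ler_norm M)) /lt_le_trans; apply.
have := bernoulli n (ltW h0); have -> : 1 + (t - 1) = t by ring.
apply: le_trans; apply: (@le_trans _ _ (n%:R * (t - 1))).
  by rewrite ler_wpM2r ?ler_nat // ltW.
by rewrite mulr_natl lerDr.
Qed.

Lemma geometric_small (R : realType) (t e : R) : 0 <= t < 1 -> 0 < e ->
  exists N, forall n, (N <= n)%N -> t ^+ n < e.
Proof.
move=> /andP[t0 t1] e0; have [->|tn0] := eqVneq t 0.
  by exists 1%N => -[//|n] _; rewrite exprS mul0r.
have tp : 0 < t by rewrite lt_def tn0.
have [|N hN] := @exprn_unbounded R t^-1 e^-1; first by rewrite invf_gt1.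
exists N => n /hN; rewrite exprVn ltf_pV2 //; last by rewrite posrE exprn_gt0.
Qed.

Definition subring_set (F : nzRingType) (A : set F) : Prop :=
  [/\ A 1, (forall x y, A x -> A y -> A (x - y))
    & (forall x y, A x -> A y -> A (x * y))].

Section Subring.
Variables (F : nzRingType) (A : set F).
Hypothesis Ar : subring_set A.
Lemma sring1 : A 1. Proof. by case: Ar. Qed.
Lemma sringB x y : A x -> A y -> A (x - y). Proof. by case: Ar => _ h _; apply: h. Qed.
Lemma sringM x y : A x -> A y -> A (x * y). Proof. by case: Ar => _ _; apply. Qed.
Lemma sring0 : A 0. Proof. by rewrite -(subrr 1); apply: sringB; apply: sring1. Qed.
Lemma sringN x : A x -> A (- x).
Proof. by rewrite -sub0r; apply: sringB; apply: sring0. Qed.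
Lemma sringD x y : A x -> A y -> A (x + y).
Proof. by move=> hx /sringN hy; rewrite -(opprK y); apply: sringB. Qed.
Lemma sringX n x : A x -> A (x ^+ n).
Proof.
by move=> h; elim: n => [|n IH]; rewrite ?exprS; [apply: sring1|apply: sringM].
Qed.
Lemma sring_nat n : A n%:R.
Proof.
by elim: n => [|n IH]; [apply: sring0|rewrite -addn1 natrD; apply: sringD => //; apply: sring1].
Qed.
Lemma sring_int n : A n%:~R.
Proof. by case: n => n; rewrite ?NegzE ?mulrNz; try apply: sringN; apply: sring_nat. Qed.
Lemma sring_sum I (r : seq I) (P : pred I) E :
  (forall i, P i -> A (E i)) -> A (\sum_(i <- r | P i) E i).
Proof. by move=> h; elim/big_ind: _ => //; [apply: sring0|apply: sringD]. Qed.
End Subring.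

(** * Chevalley's theorem: a valuation ring of [algC] in which [p] is not invertible *)

Section ValuationRing.
Variables (p : nat).
Hypothesis p_prime : prime p.
Local Notation pC := (p%:R : algC).

Let p0 : pC != 0. Proof. by rewrite pnatr_eq0 -lt0n prime_gt0. Qed.

Lemma maximal_subring : exists O : set algC,
  [/\ subring_set O, ~ O pC^-1
    & forall B, subring_set B -> O `<=` B -> ~ B pC^-1 -> B `<=` O].
Proof.
pose P (A : set algC) := A = set0 \/ (subring_set A /\ ~ A pC^-1).
have intP : subring_set (fun x => x \in Num.int) /\ ~ (pC^-1 \in Num.int).
  split; first by split=> [|x y hx hy|x y hx hy]; rewrite ?rpred1 ?rpredB ?rpredM.
  move=> /intrP[m hm]; have : (p%:Z * m)%:~R == 1%:~R :> algC.
    by rewrite intrM -hm -pmulrn mulfV.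
  rewrite eqr_int => /eqP h.
  have := congr1 absz h; rewrite abszM /= => hh.
  have : (p %| 1)%N by rewrite -hh dvdn_mulr.
  by rewrite dvdn1 => /eqP p1; move: p_prime; rewrite p1.
have [|O [PO Omax]] := @Zorn_bigcup _ P.
  move=> C CP Ctot; have [[A [CA [x Ax]]]|hC] := pselect (exists A, C A /\ A !=set0); last first.
    left; rewrite -subset0 => x [A CA Ax]; apply: hC; exists A; split => //; by exists x.
  have CPr B z : C B -> B z -> subring_set B /\ ~ B pC^-1.
    by move=> /CP [->|].
  have join y z : (\bigcup_(X in C) X) y -> (\bigcup_(X in C) X) z ->
     exists B, [/\ C B, B y & B z].
    move=> [B CB By] [D CD Dz]; have [BD|DB] := Ctot _ _ CB CD.
      by exists D; split=> //; apply: BD.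
    by exists B; split=> //; apply: DB.
  right; split; last by move=> [B CB Bp]; have [_] := CPr _ _ CB Bp.
  split; first by exists A => //; have [/sring1] := CPr _ _ CA Ax.
    move=> y z hy hz; have [B [CB By Bz]] := join _ _ hy hz.
    by exists B => //; have [h _] := CPr _ _ CB By; apply: sringB.
  move=> y z hy hz; have [B [CB By Bz]] := join _ _ hy hz.
  by exists B => //; have [h _] := CPr _ _ CB By; apply: sringM.
case: PO => [Oe|[Osub Op]].
  exfalso; apply: (Omax (fun x => x \in Num.int)); last by right; exact: intP.
  rewrite Oe; split; first by move=> x [].
  by move=> /(_ 0) h; apply: h; rewrite rpred0.
exists O; split=> // B Br OB Bp x Bx; apply: contrapT => Ox.
by apply: (Omax B); [split=> // /(_ x Bx)|right].
Qed.

Section Maximal.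
Variable O : set algC.
Hypotheses (Or : subring_set O) (Op : ~ O pC^-1)
  (Omax : forall B, subring_set B -> O `<=` B -> ~ B pC^-1 -> B `<=` O).

Lemma adjoin_root x : ~ O x ->
  exists q : {poly algC}, (forall i, O q`_i) /\ q.[x] = pC^-1.
Proof.
move=> Ox.
pose B : set algC := [set y | exists q : {poly algC}, (forall i, O q`_i) /\ q.[x] = y].
have Br : subring_set B.
  split.
  - exists 1; split; last by rewrite hornerC.
    by move=> i; rewrite coef1; apply: (sring_nat Or).
  - move=> _ _ [q [Oq <-]] [r [Or' <-]]; exists (q - r); split; last by rewrite hornerD hornerN.
    by move=> i; rewrite coefB; apply: sringB.
  - move=> _ _ [q [Oq <-]] [r [Or' <-]]; exists (q * r); split; last by rewrite hornerM.
    by move=> i; rewrite coefM; apply: sring_sum => // j _; apply: sringM.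
apply: contrapT => nB; apply: Ox; apply: (Omax Br) => //.
  move=> y Oy; exists y%:P; split; last by rewrite hornerC.
  by move=> i; rewrite coefC; case: ifP => _ //; apply: (sring0 Or).
exists 'X; split; last by rewrite hornerX.
by move=> i; rewrite coefX; apply: (sring_nat Or).
Qed.

(** Were [1/p] a polynomial in the inverse of [u = 1 - p a], clearing denominators would put some
    [u ^+ k / p] into [O]; as [u ^+ k] is 1 modulo [p O], this would put [1/p] there as well. *)
Lemma one_sub_unit a : O a -> 1 - pC * a != 0 /\ O (1 - pC * a)^-1.
Proof.
move=> Oa; have nz : 1 - pC * a != 0.
  rewrite subr_eq0 eq_sym; apply/eqP => h; apply: Op.
  by have -> : pC^-1 = a by rewrite -[a](mulKf p0) h mulr1.
split=> //; apply: contrapT => /adjoin_root [q [Oq hq]].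
set u := 1 - pC * a in nz hq.
have Ou : O u by apply: sringB => //; [apply: sring1|apply: sringM => //; apply: sring_nat].
have Ob n : exists2 b, O b & u ^+ n = 1 - pC * b.
  elim: n => [|n [b Ob E]]; first by exists 0; rewrite ?mulr0 ?subr0 //; apply: sring0.
  exists (a + b - pC * a * b); last by rewrite exprS E /u; ring.
  apply: sringB => //; first exact: sringD.
  by apply: sringM => //; apply: sringM => //; apply: sring_nat.
have : O (pC^-1 * u ^+ size q).
  rewrite -hq horner_coef mulr_suml; apply: sring_sum => // i _.
  rewrite -mulrA; apply: sringM => //.
  have -> : u ^+ size q = u ^+ (size q - i) * u ^+ i by rewrite -exprD subnK // ltnW.
  by rewrite mulrCA exprVn mulVf ?mulr1 ?expf_neq0 //; apply: sringX.
have [b Ob' ->] := Ob (size q); rewrite mulrBr mulr1 mulKf // => h.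
by apply: Op; rewrite -(subrK b pC^-1); apply: sringD.
Qed.

(** A bound for the degree of a relation showing that [1/p] lies in [O[x]]; its minimum is the
    parameter of the descent. *)
Definition root_degree (x : algC) n := exists q : {poly algC},
  [/\ (size q <= n.+1)%N, (forall i, O q`_i) & q.[x] = pC^-1].

(** A relation for [x^-1], multiplied by [p x ^+ n.+1], expresses [(1 - p r_0) x ^+ n.+1] by lower
    powers of [x]. The factor is a unit of [O], so the top term of the relation for [x] can be
    eliminated. *)
Lemma root_degree_descent x m n : x != 0 -> (m <= n.+1)%N ->
  root_degree x n.+1 -> root_degree x^-1 m -> root_degree x n.
Proof.
move=> x0 mn [q [sq Oq hq]] [r [sr Orr hr]].
have [u0 Ou] := one_sub_unit (Orr 0%N); set u := 1 - pC * r`_0 in u0 Ou.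
have hx : u * x ^+ n.+1 = pC * \sum_(j < m) r`_j.+1 * x ^+ (n - j).
  have : pC * (r.[x^-1] * x ^+ n.+1) = x ^+ n.+1 by rewrite hr mulVKf.
  rewrite (horner_coef_wide _ sr) big_ord_recl expr0 mulr1 mulrDl mulrDr => E.
  rewrite /u mulrBl mul1r -[in X in X - _]E mulrA addrAC subrr add0r.
  congr (_ * _); rewrite mulr_suml; apply: eq_bigr => j _.
  rewrite -mulrA; congr (_ * _); rewrite lift0.
  have hj : (j.+1 <= n.+1)%N by apply: leq_trans mn.
  by rewrite -(subnK hj) subSS exprD mulrCA exprVn mulVf ?mulr1 ?expf_neq0.
pose t := \sum_(j < m) (r`_j.+1)%:P * 'X^(n - j).
exists (\poly_(i < n.+1) q`_i + (q`_n.+1 * (pC * u^-1))%:P * t); split.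
- apply: leq_trans (size_polyD _ _) _; rewrite geq_max size_poly /=.
  rewrite mul_polyC; apply: leq_trans (size_scale_leq _ _) _.
  apply: leq_trans (size_sum _ _ _) _; apply/bigmax_leqP => j _.
  rewrite mul_polyC; apply: leq_trans (size_scale_leq _ _) _.
  by rewrite size_polyXn ltnS leq_subr.
- move=> i; rewrite coefD coef_poly coefCM; apply: sringD => //.
    by case: ifP => _ //; apply: (sring0 Or).
  apply: sringM => //; first by apply: sringM => //; apply: sringM => //; apply: sring_nat.
  rewrite coef_sum; apply: sring_sum => // j _; rewrite coefCM coefXn; apply: sringM => //.
  exact: sring_nat.
- rewrite -hq hornerD hornerM hornerC horner_poly (horner_coef_wide _ sq).
  rewrite [in RHS]big_ord_recr /=; congr (_ + _).
  have -> : t.[x] = \sum_(j < m) r`_j.+1 * x ^+ (n - j).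
    by rewrite horner_sum; apply: eq_bigr => j _; rewrite hornerM hornerC hornerXn.
  by rewrite -!mulrA; congr (_ * _); rewrite mulrCA -hx mulKf.
Qed.

(** If [x] and its inverse were both outside [O], both would have relations of minimal degree, and
    the larger of the two degrees could be lowered. *)
Lemma valuation_ring x : O x \/ O x^-1.
Proof.
have [->|x0] := eqVneq x 0; first by left; apply: sring0.
apply: contrapT => /not_orP[Ox Ox'].
have ex y : ~ O y -> exists n, `[< root_degree y n >].
  move=> /adjoin_root [q [Oq hq]]; exists (size q); apply/asboolP.
  by exists q; split.
have [n /asboolP hn nmin] := ex_minnP (ex _ Ox).
have [m /asboolP hm mmin] := ex_minnP (ex _ Ox').
have pos y : root_degree y 0 -> False.
  move=> [q [sq Oq hq]]; apply: Op; rewrite -hq.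
  by rewrite (size1_polyC sq) hornerC.
case: n hn nmin => [/pos//|n] hn nmin; case: m hm mmin => [/pos//|m] hm mmin.
have [mn|nm] := leqP m n.
  have := root_degree_descent x0 (mn : (m.+1 <= n.+1)%N) hn hm.
  by move=> /asboolP/nmin; rewrite ltnn.
have x0' : x^-1 != 0 by rewrite invr_eq0.
have := @root_degree_descent x^-1 n.+1 m x0' (ltnW nm) hm; rewrite invrK.
by move=> /(_ hn) /asboolP/mmin; rewrite ltnn.
Qed.

End Maximal.
End ValuationRing.

(** * From the valuation ring to an absolute value extending the [p]-adic one *)

Section PadicExtension.
Variables (R : realType) (p : nat).
Hypothesis p_prime : prime p.
Local Notation pC := (p%:R : algC).
Variable O : set algC.
Hypotheses (Or : subring_set O) (Op : ~ O pC^-1)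
  (Oval : forall x, O x \/ O x^-1).

Let p0 : pC != 0. Proof. by rewrite pnatr_eq0 -lt0n prime_gt0. Qed.
Let pR1 : 1 < p%:R :> R. Proof. by rewrite ltr1n prime_gt1. Qed.
Let pR0 : 0 < p%:R :> R. Proof. exact: lt_trans ltr01 pR1. Qed.

Definition unit_in x := [/\ x != 0, O x & O x^-1].

Lemma unit_inM x y : unit_in x -> unit_in y -> unit_in (x * y).
Proof.
by move=> [x0 a b] [y0 c d]; split; rewrite ?mulf_neq0 ?invfM //; apply: sringM.
Qed.

Lemma unit_inV x : unit_in x -> unit_in x^-1.
Proof. by move=> [x0 a b]; split; rewrite ?invr_eq0 ?invrK. Qed.

Lemma unit_inX n x : unit_in x -> unit_in (x ^+ n).
Proof.
by move=> [x0 a b]; split; rewrite ?expf_neq0 -?exprVn //; apply: sringX.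
Qed.

Lemma unit_in_pexp (k : int) : unit_in (pC ^ k) -> k = 0.
Proof.
wlog k0 : k / 0 <= k => [th|].
  have [/th//|kn] := leP 0 k; move/unit_inV; rewrite invr_expz => /th h.
  by apply: oppr_inj; rewrite oppr0; apply: h; rewrite oppr_ge0 ltW.
case: k k0 => [[//|n]|//] _ [_ _]; rewrite -exprnP exprS invfM => h.
exfalso; apply: Op; have -> : pC^-1 = pC^-1 / pC ^+ n * pC ^+ n by rewrite divfK // expf_neq0.
by apply: sringM => //; apply: sringX => //; apply: sring_nat.
Qed.

Lemma in_expn x n : (0 < n)%N -> O (x ^+ n) -> O x.
Proof.
case: n => // n _ h; have [//|hV] := Oval x.
have [->|x0] := eqVneq x 0; first exact: sring0.
have -> : x = x ^+ n.+1 * x^-1 ^+ n by rewrite exprS -mulrA -exprMn mulfV // expr1n mulr1.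
by apply: sringM => //; apply: sringX.
Qed.

Lemma nonunitM a x : O a -> O x -> ~ unit_in x -> ~ unit_in (a * x).
Proof.
move=> Oa Ox nx [ax0 h1 h2]; apply: nx; move: ax0; rewrite mulf_eq0 negb_or => /andP[a0 x0].
by split=> //; rewrite -[x^-1](mulKf a0) mulrCA -invfM; apply: sringM.
Qed.

Lemma nonunitD x y : O x -> O y -> ~ unit_in x -> ~ unit_in y ->
  ~ unit_in (x + y).
Proof.
wlog h : x y / O (x / y) => [th|] Ox Oy nx ny.
  have [h|h] := Oval (x / y); first exact: th.
  by rewrite addrC; apply: th => //; rewrite -invf_div.
have [y0|y0] := eqVneq y 0; first by rewrite y0 addr0.
move=> [s0 _ h2]; apply: ny; split=> //.
have -> : y^-1 = (1 + x / y) * (x + y)^-1 by field; rewrite s0 y0.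
by apply: sringM => //; apply: sringD => //; apply: sring1.
Qed.

Lemma unit_in1 : unit_in 1.
Proof. by split; rewrite ?oner_eq0 ?invr1 //; apply: sring1. Qed.

Lemma coprime_unit n : coprime p n -> unit_in n%:R.
Proof.
move=> cpn; apply: contrapT => nu.
have /coprimezP [[u w] /= E] : coprimez p%:Z n%:Z by rewrite /coprimez /gcdz.
have E1 : 1 = u%:~R * pC + w%:~R * n%:R :> algC.
  by rewrite !pmulrn -!intrM -intrD E.
have := unit_in1; rewrite E1; apply: nonunitD.
- by apply: sringM => //; [apply: sring_int|apply: sring_nat].
- by apply: sringM => //; [apply: sring_int|apply: sring_nat].
- by apply: nonunitM => //; [apply: sring_int|apply: sring_nat|case].
- by apply: nonunitM => //; [apply: sring_int|apply: sring_nat].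
Qed.

Lemma nat_unit n : (0 < n)%N -> unit_in (n%:R / pC ^+ logn p n).
Proof.
move=> n0; have [m cpm E] := pfactor_coprime p_prime n0.
rewrite [in X in X / _]E natrM natrX mulfK ?expf_neq0 //.
exact: coprime_unit.
Qed.

(** The opposite of the usual [p]-adic valuation: the exponent of [p] in the absolute value of
    [c]. *)
Definition padic_ord (c : rat) : int :=
  (logn p `|denq c|)%:Z - (logn p `|numq c|)%:Z.

Lemma rat_unit c : c != 0 -> unit_in (ratr c * pC ^ padic_ord c).
Proof.
move=> c0; have h1 : (0 < `|numq c|)%N by rewrite absz_gt0 numq_eq0.
have h2 : (0 < `|denq c|)%N by rewrite absz_gt0 denq_neq0.
have -> : ratr c * pC ^ padic_ord c = (-1) ^+ (numq c < 0)%R *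
     ((`|numq c|%N%:R / pC ^+ logn p `|numq c|) / (`|denq c|%N%:R / pC ^+ logn p `|denq c|)).
  rewrite /padic_ord expfzDr // -exprnN -!exprnP /ratr.
  have -> : (denq c)%:~R = `|denq c|%N%:R :> algC by rewrite pmulrn absz_denq.
  have -> : (numq c)%:~R = (-1) ^+ (numq c < 0)%R * `|numq c|%N%:R :> algC.
    by rewrite {1}[numq c]intEsign intrM rmorphXn /= rmorphN1 pmulrn.
  rewrite invf_div; ring.
apply: unit_inM; first by apply: unit_inX; rewrite -[-1]mulN1r; split; rewrite ?mulN1r ?oppr_eq0 ?oner_eq0 ?invrN ?invr1 //; apply: sringN => //; apply: sring1.
by apply: unit_inM; [apply: nat_unit|apply/unit_inV/nat_unit].
Qed.

(** After division by a term of largest value the relation writes -1 as the sum of the other ratios;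
    if none of these were a unit, -1 would be a nonunit. *)
Lemma sum0_unit_ratio (g : nat -> algC) (I : seq nat) : I != [::] -> uniq I ->
  (forall i, i \in I -> g i != 0) -> \sum_(i <- I) g i = 0 ->
  exists i j, [/\ i \in I, j \in I, (i < j)%N & unit_in (g j / g i)].
Proof.
move=> I0 uI gI s0.
have [m mI mmax] : exists2 m, m \in I & forall i, i \in I -> O (g i / g m).
  elim: I I0 gI {uI s0} => [//|a [|b I] IH] _ gI.
    by exists a; rewrite ?mem_head // => i; rewrite inE => /eqP->; rewrite divff ?gI ?mem_head //; apply: sring1.
  have [i hi|m mI hm] := IH isT; first by apply: gI; rewrite inE hi orbT.
  have ga := gI a (mem_head _ _).
  have gm : g m != 0 by apply: gI; rewrite inE mI orbT.
  have [h|h] := Oval (g a / g m).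
    exists m; first by rewrite inE mI orbT.
    by move=> i; rewrite inE => /predU1P[->//|]; apply: hm.
  exists a; rewrite ?mem_head // => i; rewrite inE => /predU1P[->|/hm h2].
    by rewrite divff //; apply: sring1.
  have -> : g i / g a = g i / g m * (g a / g m)^-1 by field; rewrite ga gm.
  exact: sringM.
apply: contrapT => hn.
have nu i : i \in I -> i != m -> ~ unit_in (g i / g m).
  move=> iI im hu; apply: hn; have [lt|gt|e] := ltngtP i m; last by rewrite e eqxx in im.
    by exists i, m; split=> //; rewrite -invf_div; apply: unit_inV.
  by exists m, i.
have gm := gI m mI.
have E : - 1 = \sum_(i <- I | i != m) g i / g m.
  rewrite -mulr_suml; move: s0; rewrite (bigD1_seq m) //= => /eqP.
  by rewrite addrC addr_eq0 => /eqP ->; rewrite mulNr mulfV.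
suff : O (-1 : algC) /\ ~ unit_in (-1 : algC).
  by case=> _; apply; split; rewrite ?oppr_eq0 ?oner_eq0 ?invrN ?invr1 //; apply: sringN => //; apply: sring1.
rewrite E big_seq_cond; elim/big_ind: _ => [|x y [Ox nx] [Oy ny]|i /andP[iI im]].
- by split; [apply: sring0|case; rewrite eqxx].
- by split; [apply: sringD|apply: nonunitD].
- by split; [apply: mmax|apply: nu].
Qed.

(** Two terms of the minimal equation of [x] have a unit as quotient. This quotient is a power of
    [x] times a rational number, and a rational number is a unit times a power of [p]. *)
Lemma power_unit x : x != 0 ->
  exists n (m : int), (0 < n)%N /\ unit_in (x ^+ n * pC ^ m).
Proof.
move=> x0; have [f [Ef fmon] _] := minCpolyP x.
have rf : \sum_(i < size f) ratr f`_i * x ^+ i = 0 :> algC.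
  have := root_minCpoly x; rewrite Ef => /rootP.
  by rewrite horner_coef size_map_poly => E; rewrite -[RHS]E; apply: eq_bigr => i _; rewrite coef_map.
pose I := [seq i <- iota 0 (size f) | f`_i != 0].
have [||i||i [j [iI jI ij u]]] := @sum0_unit_ratio (fun i => ratr f`_i * x ^+ i) I.
- rewrite -has_filter; apply/hasP; exists (size f).-1.
    by rewrite mem_iota /= ltn_predL size_poly_gt0 monic_neq0.
  by rewrite -lead_coefE lead_coef_eq0 monic_neq0.
- by rewrite filter_uniq ?iota_uniq.
- by rewrite mem_filter => /andP[fi _]; rewrite mulf_neq0 ?expf_neq0 // fmorph_eq0.
- rewrite big_filter big_mkcond -[in iota _ _](subn0 (size f)) -/(index_iota _ _) big_mkord -[RHS]rf.
  by apply: eq_bigr => i _; case: eqP => //= ->; rewrite rmorph0 mul0r.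
have fi : f`_i != 0 by move: iI; rewrite mem_filter => /andP[].
have fj : f`_j != 0 by move: jI; rewrite mem_filter => /andP[].
exists (j - i)%N, (- padic_ord (f`_j / f`_i)); rewrite subn_gt0; split=> //.
have cu := rat_unit (mulf_neq0 fj (invr_neq0 fi)).
have := unit_inM u (unit_inV cu); congr unit_in.
rewrite -invr_expz fmorph_div /= -[in x ^+ j](subnK (ltnW ij)) exprD.
have : pC ^ padic_ord (f`_j / f`_i) != 0 by rewrite expfz_neq0.
have : x ^+ i != 0 by rewrite expf_neq0.
have : ratr f`_i != 0 :> algC by rewrite fmorph_eq0.
have : ratr f`_j != 0 :> algC by rewrite fmorph_eq0.
move: (pC ^ _) (x ^+ i) (x ^+ (j - i)) (ratr f`_j) (ratr f`_i) => P X Y A B A0 B0 X0 P0.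
by field; rewrite A0 B0 X0 P0.
Qed.

(* If [x ^+ n * p ^ m] is a unit of the valuation ring then [x] has absolute
   value [p ^ (m / n)]. *)
Lemma padic_value_ex x : exists a : R, if x == 0 then a = 0 else
  exists n (m : int), [/\ (0 < n)%N, unit_in (x ^+ n * pC ^ m)
    & a = p%:R `^ (m%:~R / n%:R)].
Proof.
have [x0|x0] := boolP (x == 0); first by exists 0.
have [n [m [n0 h]]] := power_unit x0.
by exists (p%:R `^ (m%:~R / n%:R)), n, m.
Qed.

Definition padic_value x : R := sval (cid (padic_value_ex x)).

Lemma padic_value0 : padic_value 0 = 0.
Proof. by rewrite /padic_value; case: cid => a /=; rewrite eqxx. Qed.

Lemma padic_valueE x n (m : int) : (0 < n)%N -> unit_in (x ^+ n * pC ^ m) ->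
  padic_value x = p%:R `^ (m%:~R / n%:R).
Proof.
move=> n0 u; have x0 : x != 0.
  by case: u; rewrite mulf_eq0 negb_or expf_eq0 n0 => /andP[].
rewrite /padic_value; case: cid => a /=; rewrite (negPf x0) => -[n' [m' [n0' u' ->]]].
congr (_ `^ _); apply/eqP; rewrite eqr_div ?pnatr_eq0 -?lt0n //.
rewrite !pmulrn -!intrM eqr_int -subr_eq0; apply/eqP/unit_in_pexp.
have := unit_inM (unit_inX n u') (unit_inV (unit_inX n' u)); congr unit_in.
rewrite expfzDr // -invr_expz !exprMn -!exprM [(n' * n)%N]mulnC.
rewrite !exprnP !exprz_exp invfM.
have h : x ^+ (n * n') != 0 by rewrite expf_neq0.
by rewrite mulrACA mulfV ?mul1r.
Qed.

Lemma padic_value_rat q : padic_value (ratr q) = padic_abs R p q.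
Proof.
rewrite /padic_abs; case: eqP => [->|/eqP q0]; first by rewrite rmorph0 padic_value0.
rewrite (@padic_valueE _ 1%N (padic_ord q)) // ?expr1; last exact: rat_unit.
by rewrite divr1 powR_intmul // ltW.
Qed.

Lemma padic_value_eq0 x : padic_value x = 0 <-> x = 0.
Proof.
split=> [|->]; last exact: padic_value0.
have [->//|x0] := eqVneq x 0; have [n [m [n0 u]]] := power_unit x0.
by rewrite (padic_valueE n0 u) => /eqP; rewrite gt_eqF // powR_gt0.
Qed.

Lemma padic_value_ge0 x : 0 <= padic_value x.
Proof.
have [->|x0] := eqVneq x 0; first by rewrite padic_value0.
have [n [m [n0 u]]] := power_unit x0.
by rewrite (padic_valueE n0 u) powR_ge0.
Qed.

Lemma padic_valueM : {morph padic_value : x y / x * y}.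
Proof.
move=> x y; have [->|x0] := eqVneq x 0; first by rewrite mul0r padic_value0 mul0r.
have [->|y0] := eqVneq y 0; first by rewrite mulr0 padic_value0 mulr0.
have [n [m [n0 u]]] := power_unit x0; have [n' [m' [n0' u']]] := power_unit y0.
have nn : (0 < n * n')%N by rewrite muln_gt0 n0.
have := unit_inM (unit_inX n' u) (unit_inX n u').
have -> : (x ^+ n * pC ^ m) ^+ n' * (y ^+ n' * pC ^ m') ^+ n =
    (x * y) ^+ (n * n') * pC ^ (m * n' + m' * n).
  rewrite expfzDr // !exprMn -!exprM [(n' * n)%N]mulnC !exprnP !exprz_exp.
  by rewrite mulrACA.
move=> /(padic_valueE nn) ->; rewrite (padic_valueE n0 u) (padic_valueE n0' u').
rewrite -powRD; last by rewrite (gt_eqF pR0) implybT.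
congr (_ `^ _); rewrite natrM intrD !intrM -!pmulrn.
by field; rewrite !pnatr_eq0 -!lt0n n0 n0'.
Qed.

(** The sign of [m] decides whether [x ^+ n] lies in [O], and [in_expn] passes from [x ^+ n] to
    [x]. *)
Lemma padic_value_le1 x : O x <-> padic_value x <= 1.
Proof.
have [->|x0] := eqVneq x 0.
  by rewrite padic_value0 ler01; split=> // _; apply: sring0.
have [n [m [n0 u]]] := power_unit x0; rewrite (padic_valueE n0 u).
have -> : (p%:R `^ (m%:~R / n%:R) <= 1 :> R) = (p%:R ^ m <= 1 :> R).
  rewrite -(@expr_le1 _ n) ?powR_ge0 -?lt0n // -powR_mulrn ?powR_ge0 //.
  by rewrite -powRrM divfK ?pnatr_eq0 -?lt0n // powR_intmul // ltW.
have Opn k : O (pC ^+ k) by apply: sringX => //; apply: sring_nat.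
case: m u => [[|k]|k] u.
- by rewrite expr0z lexx; split=> // _; apply: (in_expn n0); case: u; rewrite expr0z mulr1.
- rewrite -exprnP leNgt exprn_egt1 //; split=> // Ox; exfalso; apply: Op.
  case: u => nz _ u; have -> : pC^-1 = x ^+ n * (x ^+ n * pC ^ k.+1)^-1 * pC ^+ k.
    rewrite -exprnP exprS; have : x ^+ n != 0 by rewrite expf_neq0.
    have : pC ^+ k != 0 by rewrite expf_neq0.
    by move=> a0 b0; field; rewrite a0 b0 p0.
  by apply: sringM => //; apply: sringM => //; apply: sringX.
rewrite NegzE -exprnN invf_le1 ?exprn_gt0 // exprn_ege1 ?(ltW pR1) //.
split=> // _; apply: (in_expn n0); case: u => _ u _.
have -> : x ^+ n = x ^+ n * pC ^ Negz k * pC ^+ k.+1 by rewrite NegzE -exprnN divfK ?expf_neq0.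
exact: sringM.
Qed.

Lemma padic_value_ultra : ultrametric padic_value.
Proof.
move=> x y; wlog h : x y / padic_value x <= padic_value y => [th|].
  have /orP[h|h] := le_total (padic_value x) (padic_value y); first exact: (th x y h).
  by rewrite addrC maxC; apply: (th y x h).
rewrite le_max; apply/orP; right; have [y0|y0] := eqVneq y 0.
  move: h; rewrite y0 addr0; done.
have vy : padic_value y != 0 by apply/eqP => /padic_value_eq0/eqP; apply/negP.
have -> : x + y = y * (1 + x / y) by field.
rewrite padic_valueM -[leRHS]mulr1 ler_wpM2l ?padic_value_ge0 //.
apply/padic_value_le1; apply: sringD => //; first exact: sring1.
apply/padic_value_le1; rewrite -(ler_pM2r (_ : 0 < padic_value y)).
  by rewrite -padic_valueM divfK // mul1r.
by rewrite lt_def vy padic_value_ge0.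
Qed.

End PadicExtension.

Theorem padic_abs_extension (R : realType) p : prime p ->
  exists V : algC -> R,
  [/\ is_abs V, ultrametric V & forall q, V (ratr q) = padic_abs R p q].
Proof.
move=> pp; have [B [Osub Op Omax]] := maximal_subring pp.
have Oval := valuation_ring pp Osub Op Omax.
pose V := padic_value R pp Osub Op Oval.
have Vu : ultrametric V by apply: padic_value_ultra.
have V0 x : 0 <= V x by apply: padic_value_ge0.
exists V; split=> //; last exact: padic_value_rat.
split=> //; [exact: padic_value_eq0|exact: padic_valueM|].
move=> x y; apply: (le_trans (Vu x y)); rewrite ge_max.
by rewrite lerDl lerDr !V0.
Qed.

(** * The usual absolute value on [algC], with values in an arbitrary real field *)

Section RealAbs.
Variable R : realType.

(** The modulus of [x] is an element of [algC]; rational cuts carry it into the unrelated field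
    [R]. *)
Definition real_abs (x : algC) : R := sup [set ratr q | q in [set q : rat | ratr q <= `|x|]].

Lemma has_sup_abs (x : algC) : has_sup [set (ratr q : R) | q in [set q : rat | ratr q <= `|x|]].
Proof.
split; first by exists 0, 0; rewrite /= ?rmorph0.
exists (Num.bound `|x|)%:R => _ [q /= qx <-].
have := archi_boundP (normr_ge0 x) => /(le_lt_trans qx)/ltW.
by rewrite -(ratr_nat algC) ler_rat -(ler_rat R) ratr_nat.
Qed.

Lemma real_abs_ub x q : ratr q <= `|x| -> ratr q <= real_abs x.
Proof. by move=> h; apply: (sup_upper_bound (has_sup_abs x)); exists q. Qed.

Lemma real_abs_lb x q : `|x| <= ratr q -> real_abs x <= ratr q.
Proof.
move=> h; apply: sup_le_ub; first by have [] := has_sup_abs x.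
by move=> _ [r /= rx <-]; have := le_trans rx h; rewrite !ler_rat.
Qed.

Lemma real_abs_lt x q : real_abs x < ratr q -> `|x| < ratr q.
Proof.
move=> h; rewrite real_ltNge ?normr_real ?Creal_Crat ?Crat_rat //.
by apply: contraL h => /real_abs_ub; rewrite -leNgt.
Qed.

Lemma real_abs_gt x q : ratr q < real_abs x -> ratr q < `|x|.
Proof.
move=> h; rewrite real_ltNge ?normr_real ?Creal_Crat ?Crat_rat //.
by apply: contraL h => /real_abs_lb; rewrite -leNgt.
Qed.

Lemma real_abs_rat q : real_abs (ratr q) = `|ratr q|.
Proof.
apply/eqP; rewrite eq_le -!ratr_norm; apply/andP; split.
  by apply: real_abs_lb; rewrite ratr_norm.
by apply: real_abs_ub; rewrite ratr_norm.
Qed.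

Lemma real_abs_ge0 x : 0 <= real_abs x.
Proof. by rewrite -(rmorph0 (@ratr R)); apply: real_abs_ub; rewrite rmorph0. Qed.

Lemma rat_between (a b : R) : a < b -> exists q : rat, a < ratr q < b.
Proof. by move=> /rat_in_itvoo [q]; rewrite in_itv /=; exists q. Qed.

Lemma real_absD x y : real_abs (x + y) <= real_abs x + real_abs y.
Proof.
rewrite leNgt; apply/negP => /rat_between [c /andP[c1 c2]].
rewrite -ltrBrDr in c1; have [a /andP[a1 a2]] := rat_between c1.
have b1 : real_abs y < ratr (c - a) by rewrite rmorphB /= ltrBrDl -ltrBrDr.
have := ltrD (real_abs_lt a1) (real_abs_lt b1); rewrite -rmorphD subrKC.
move=> h; have := le_lt_trans (ler_normD x y) h => /ltW/real_abs_lb.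
by rewrite leNgt c2.
Qed.

Lemma real_absM : {morph real_abs : x y / x * y}.
Proof.
move=> x y; have hx := real_abs_ge0 x; have hy := real_abs_ge0 y.
apply/eqP; rewrite eq_le !leNgt; apply/andP; split; apply/negP.
  move=> /rat_between [c /andP[c1 c2]].
  have c0 : 0 < ratr c :> R by apply: le_lt_trans c1; rewrite mulr_ge0.
  have [u xu hu] : exists2 u : R, real_abs x < u & forall a, a < u -> a * real_abs y < ratr c.
    have [y0|y0] := eqVneq (real_abs y) 0.
      by exists (real_abs x + 1) => [|a _]; rewrite ?ltrDl ?y0 ?mulr0.
    have yp : 0 < real_abs y by rewrite lt_def y0.
    by exists (ratr c / real_abs y) => [|a]; rewrite ltr_pdivlMr.
  have [a /andP[a1 /hu a2]] := rat_between xu.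
  have a0 : 0 < ratr a :> R by apply: le_lt_trans a1.
  have : real_abs y < ratr c / ratr a by rewrite ltr_pdivlMr // mulrC.
  move=> /rat_between [b /andP[b1 b2]].
  have ab : a * b < c by rewrite -(ltr_rat R) rmorphM /= mulrC -ltr_pdivlMr.
  have : `|x * y| <= ratr c.
    rewrite normrM (@le_trans _ _ (ratr (a * b))) ?ler_rat ?(ltW ab) // rmorphM /=.
    by rewrite ler_pM // ltW // real_abs_lt.
  by move=> /real_abs_lb; rewrite leNgt c2.
move=> /rat_between [c /andP[c1 c2]].
have c0 : 0 < ratr c :> R by apply: le_lt_trans c1; apply: real_abs_ge0.
have yp : 0 < real_abs y.
  rewrite lt_def hy andbT; apply: contraTneq c2 => ->.
  by rewrite mulr0 -leNgt ltW.
have /rat_between [a /andP[a1 a2]] : ratr c / real_abs y < real_abs x by rewrite ltr_pdivrMr.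
have a0 : 0 < ratr a :> R by apply: lt_trans a1; rewrite divr_gt0.
have /rat_between [b /andP[b1 b2]] : ratr c / ratr a < real_abs y.
  by rewrite ltr_pdivrMr // mulrC -ltr_pdivrMr.
have b0 : 0 < ratr b :> R by apply: lt_trans b1; rewrite divr_gt0.
have ab : c < a * b by rewrite -(ltr_rat R) rmorphM /= mulrC -ltr_pdivrMr.
have : ratr (a * b) <= `|x * y|.
  rewrite rmorphM /= normrM ler_pM ?ltW ?real_abs_gt //.
    by rewrite -(rmorph0 (@ratr algC)) ltr_rat -(ltr_rat R) rmorph0.
  by rewrite -(rmorph0 (@ratr algC)) ltr_rat -(ltr_rat R) rmorph0.
move=> /real_abs_ub; rewrite leNgt => /negP; apply.
by apply: (lt_trans c1); rewrite ltr_rat.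
Qed.

Lemma real_abs_is_abs : is_abs real_abs.
Proof.
split; [exact: real_abs_ge0| |exact: real_absM|exact: real_absD].
move=> x; split=> [x0|->]; last by rewrite -(rmorph0 (@ratr algC)) real_abs_rat rmorph0 normr0.
apply: contrapT => /eqP xn0; have n0 : 0 < `|x| by rewrite normr_gt0.
have h := archi_boundP (ltW (etrans (invr_gt0 _) n0)); set n := Num.bound _ in h.
have np : (0 < n)%N.
  have v0 : 0 < `|x|^-1 by rewrite invr_gt0.
  by have := lt_trans v0 h; rewrite ltr0n.
have : ratr n%:R^-1 <= `|x|.
  by rewrite fmorphV /= ratr_nat -[leRHS]invrK lef_pV2 ?posrE ?invr_gt0 ?ltr0n // ltW.
move=> /real_abs_ub; rewrite x0 leNgt => /negP; apply.
by rewrite -(rmorph0 (@ratr R)) ltr_rat invr_gt0 ltr0n.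
Qed.

End RealAbs.

(* A place of the rationals is [None] for the usual absolute value and
   [Some p] for the [p]-adic one. *)
Definition rat_abs (R : realType) (l : option nat) (q : rat) : R :=
  if l is Some p then padic_abs R p q else `|ratr q|.

Definition rat_place (l : option nat) := if l is Some p then prime p else true.

Lemma abs_extension_ex (R : realType) l : exists V : algC -> R,
  rat_place l -> [/\ is_abs V, l -> ultrametric V & forall q, V (ratr q) = rat_abs R l q].
Proof.
case: l => [p|]; last first.
  exists (@real_abs R) => _; split=> //; last exact: real_abs_rat.
  exact: real_abs_is_abs.
have [pp|np] := boolP (prime p); last by exists (fun=> 0) => /=; rewrite (negPf np).
by have [V [h1 h2 h3]] := padic_abs_extension R pp; exists V.
Qed.

(** [rat_place] stands under the existential in [abs_extension_ex], so the choice is total in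
    [l]. *)
Definition algC_abs (R : realType) l : algC -> R := sval (cid (abs_extension_ex R l)).

Lemma algC_absP (R : realType) l : rat_place l -> is_abs (algC_abs R l).
Proof. by rewrite /algC_abs; case: cid => V h /= /h[]. Qed.

Lemma algC_abs_ultra (R : realType) p : prime p -> ultrametric (algC_abs R (Some p)).
Proof. by rewrite /algC_abs; case: cid => V h /= /h[_ u _]; apply: u. Qed.

Lemma algC_abs_rat (R : realType) l q : rat_place l ->
  algC_abs R l (ratr q) = rat_abs R l q.
Proof. by rewrite /algC_abs; case: cid => V h /= /h[]. Qed.

(** * Embeddings, traces and discriminants *)

Section Embeddings.
Variable K : fieldExtType rat.

Lemma primitive_element_exists : exists t : K, <<1; t>>%VS = fullv.
Proof.
have sep : separable 1%AS {:K}.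
  apply/separableP => y _; apply: pcharf0_separable => q.
  by rewrite pchar_lalg pchar_num.
by exists (separable_generator 1 {:K}); rewrite -(eq_adjoin_separable_generator sep) ?sub1v.
Qed.

Lemma rmorph_horner_alg (phi : {rmorphism K -> algC}) (q : {poly rat}) x :
  phi (map_poly (in_alg K) q).[x] = (map_poly ratr q).[phi x].
Proof.
rewrite -horner_map -map_poly_comp; congr (_.[_]); apply: eq_map_poly => a /=.
by rewrite alg_num_field fmorph_rat.
Qed.

Lemma rmorph_generator_eq (phi psi : {rmorphism K -> algC}) t :
  <<1; t>>%VS = fullv -> phi t = psi t -> phi =1 psi.
Proof.
move=> tgen e x; have : x \in <<1; t>>%VS by rewrite tgen memvf.
by move=> /Fadjoin1_polyP [q ->]; rewrite !rmorph_horner_alg e.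
Qed.

Lemma rmorph_to_root (t : K) (g : {poly rat}) (r : algC) :
  <<1; t>>%VS = fullv -> map_poly (in_alg K) g = minPoly 1 t ->
  root (map_poly ratr g) r -> exists phi : {rmorphism K -> algC}, phi t = r.
Proof.
move=> tgen eg rg.
have ex x : exists q, x = (map_poly (in_alg K) q).[t].
  by apply/Fadjoin1_polyP; rewrite tgen memvf.
pose phi x := (map_poly ratr (sval (cid (ex x)))).[r] : algC.
have phiE q : phi (map_poly (in_alg K) q).[t] = (map_poly ratr q).[r].
  rewrite /phi; case: cid => q' /= e; apply/eqP; rewrite -subr_eq0 -hornerN -hornerD -rmorphB.
  have : minPoly 1 t %| map_poly (in_alg K) (q' - q).
    apply: minPoly_dvdp; first exact: alg_polyOver.
    by rewrite rootE rmorphB hornerD hornerN /= e subrr.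
  rewrite -eg dvdp_map => /dvdpP [s ->]; rewrite rmorphM hornerM.
  by move/rootP: rg => ->; rewrite mulr0.
have phiB : zmod_morphism phi.
  move=> x y; have [[q ->] [q' ->]] := (ex x, ex y).
  by rewrite -hornerN -hornerD -rmorphB !phiE rmorphB hornerD hornerN.
have phiM : monoid_morphism phi.
  split; first by have := phiE 1; rewrite !rmorph1 !hornerC.
  move=> x y; have [[q ->] [q' ->]] := (ex x, ex y).
  by rewrite -hornerM -rmorphM !phiE rmorphM hornerM.
pose phiR := HB.pack phi (GRing.isZmodMorphism.Build _ _ phi phiB)
  (GRing.isMonoidMorphism.Build _ _ phi phiM) : {rmorphism K -> algC}.
exists phiR; have := phiE 'X; rewrite !map_polyX !hornerX; exact.
Qed.

Lemma embeddings_exist : exists (e : 'I_(\dim {:K}) -> {rmorphism K -> algC}) (t : K),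
  [/\ <<1; t>>%VS = fullv, injective (fun k => e k t)
    & forall phi : {rmorphism K -> algC}, exists k, phi =1 e k].
Proof.
have [t tgen] := primitive_element_exists.
have /polyOver1P [g eg] := minPolyOver 1 t.
have g_monic : g \is monic by rewrite -(map_monic (in_alg K)) -eg monic_minPoly.
have sz : size g = (\dim {:K}).+1.
  rewrite -(size_map_poly (in_alg K)) -eg size_minPoly; congr _.+1.
  by rewrite -tgen dim_Fadjoin dimv1 muln1.
have [r er] := closed_field_poly_normal (map_poly ratr g : {poly algC}).
rewrite lead_coef_map (monicP g_monic) rmorph1 scale1r in er.
have szr : size r = \dim {:K}.
  by apply: succn_inj; rewrite -sz -(size_map_poly (@ratr algC)) er size_prod_XsubC.
have ur : uniq r.
  rewrite -separable_prod_XsubC -er separable_map -(separable_map (in_alg K)) -eg.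
  by apply: pcharf0_separable => q; rewrite pchar_lalg pchar_num.
have rr (k : 'I_(\dim {:K})) : root (map_poly ratr g) r`_k.
  by rewrite er root_prod_XsubC mem_nth // szr.
pose e k := sval (cid (rmorph_to_root tgen (esym eg) (rr k))).
have ek k : e k t = r`_k by rewrite /e; case: cid.
exists e, t; split=> // [k l|phi].
  rewrite !ek => /eqP; rewrite nth_uniq ?szr // => /eqP; exact: val_inj.
have : root (map_poly ratr g) (phi t).
  rewrite rootE -rmorph_horner_alg -eg minPolyxx rmorph0 //.
rewrite er root_prod_XsubC => /(nthP 0) [k]; rewrite szr => kn hk.
by exists (Ordinal kn); apply: (rmorph_generator_eq tgen); rewrite ek.
Qed.

Definition emb : 'I_(\dim {:K}) -> {rmorphism K -> algC} :=
  sval (cid embeddings_exist).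

Lemma emb_all (phi : {rmorphism K -> algC}) : exists k, phi =1 emb k.
Proof. by rewrite /emb; case: cid => e [t [_ _ h]] /=; apply: h. Qed.

Lemma emb_generator_inj t : <<1; t>>%VS = fullv -> injective (fun k => emb k t).
Proof.
rewrite /emb; case: cid => e [t' [_ inj _]] /= tgen k l h.
by apply: inj; apply: (rmorph_generator_eq tgen h).
Qed.

Lemma emb_alg k (a : rat) : emb k a%:A = ratr a.
Proof. by rewrite alg_num_field fmorph_rat. Qed.

Lemma embZ k (a : rat) x : emb k (a *: x) = ratr a * emb k x.
Proof. exact: rmorphZ_num. Qed.

Definition emb_mx (b : (\dim {:K}).-tuple K) := \matrix_(i, k) emb k (tnth b i).

Lemma emb_coord (b : (\dim {:K}).-tuple K) k x : basis_of {:K} b ->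
  emb k x = \sum_i ratr (coord b i x) * emb k (tnth b i).
Proof.
move=> bb; rewrite {1}(coord_basis bb (memvf x)) rmorph_sum; apply: eq_bigr => i _.
by rewrite /= embZ (tnth_nth 0).
Qed.

Lemma emb_coord_mx (b : (\dim {:K}).-tuple K) n (x : 'I_n -> K) : basis_of {:K} b ->
  \matrix_(i, k) emb k (x i) =
    map_mx ratr (\matrix_(i, j) coord b j (x i)) *m emb_mx b.
Proof.
move=> bb; apply/matrixP => i k; rewrite !mxE (emb_coord _ _ bb).
by apply: eq_bigr => j _; rewrite !mxE.
Qed.

(** The powers of a primitive element have a Vandermonde matrix with distinct nodes as embedding
    matrix, and this is a rational matrix times [emb_mx b]. *)
Lemma det_emb_mx_neq0 (b : (\dim {:K}).-tuple K) : basis_of {:K} b -> \det (emb_mx b) != 0.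
Proof.
move=> bb; have [t tgen] := primitive_element_exists.
have := emb_coord_mx (fun i : 'I_(\dim {:K}) => t ^+ i) bb => /(congr1 determinant).
rewrite det_mulmx => e.
have : \det (\matrix_(i < \dim {:K}, k < \dim {:K}) emb k (t ^+ i)) != 0.
  have -> : \matrix_(i < \dim {:K}, k < \dim {:K}) emb k (t ^+ i) = Vandermonde (\dim {:K}) (\row_k emb k t).
    by apply/matrixP => i k; rewrite !mxE rmorphXn.
  rewrite det_Vandermonde; apply/prodf_neq0 => i _; apply/prodf_neq0 => j ij.
  rewrite !mxE subr_eq0; apply/eqP => /(emb_generator_inj tgen) h.
  by rewrite h ltnn in ij.
by rewrite e mulf_eq0 negb_or => /andP[].
Qed.

Let vb := vbasis {:K}.
Let vbb : basis_of {:K} vb. Proof. exact: vbasisP. Qed.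
Let mulK x := \matrix_(i, j) coord vb j (x * vb`_i) : 'M[rat]_(\dim {:K}).

(** The embedding matrix diagonalises multiplication by [x]; trace and characteristic polynomial
    over the rationals are read off from this. *)
Lemma mul_emb_mx x :
  map_mx ratr (mulK x) *m emb_mx vb = emb_mx vb *m diag_mx (\row_k emb k x).
Proof.
rewrite -(emb_coord_mx (fun i : 'I_(\dim {:K}) => x * vb`_i) vbb).
apply/matrixP => i k; rewrite mul_mx_diag !mxE rmorphM mulrC (tnth_nth 0) //.
Qed.

Lemma trace_emb x : ratr (trace_rat x) = \sum_k emb k x.
Proof.
have -> : trace_rat x = \tr (mulK x) by rewrite /mxtrace /trace_rat; apply: eq_bigr => i _; rewrite mxE.
have u : emb_mx vb \in unitmx by rewrite unitmxE unitfE det_emb_mx_neq0.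
rewrite -trace_map_mx -[X in \tr X](mulmxK u) mul_emb_mx mxtrace_mulC mulmxA mulVmx // mul1mx.
by rewrite mxtrace_diag; apply: eq_bigr => k _; rewrite mxE.
Qed.

Lemma char_poly_emb x :
  map_poly ratr (char_poly (mulK x)) = \prod_k ('X - (emb k x)%:P).
Proof.
have u : \det (map_mx polyC (emb_mx vb)) != 0.
  by rewrite det_map_mx polyC_eq0 det_emb_mx_neq0.
apply: (mulIf u); rewrite map_char_poly /char_poly -det_mulmx /char_poly_mx mulmxBl.
rewrite -map_mxM mul_emb_mx map_mxM /= mul_scalar_mx -mul_mx_scalar -mulmxBr det_mulmx mulrC.
congr (_ * _).
have -> : 'X%:M - map_mx polyC (diag_mx (\row_k emb k x)) =
    diag_mx (\row_k ('X - (emb k x)%:P)).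
  apply/matrixP => i j; rewrite !mxE; case: eqP => [->|_] /=; first by rewrite mulr1n mulr1n.
  by rewrite !mulr0n subr0.
by rewrite det_diag; apply: eq_bigr => k _; rewrite mxE.
Qed.

Lemma conj_poly_rat x : exists P : {poly rat},
  map_poly ratr P = \prod_k ('X - (emb k x)%:P).
Proof. by exists (char_poly (mulK x)); apply: char_poly_emb. Qed.

Lemma alg_integerE (phi : {rmorphism K -> algC}) x : alg_integer x <-> phi x \in Aint.
Proof.
have mapE (q : {poly int}) : map_poly phi (map_poly intr q) = map_poly intr q.
  by rewrite -map_poly_comp; apply: eq_map_poly => a /=; rewrite rmorph_int.
split=> [[q qm qx]|h].
  apply: (@root_monic_Aint (map_poly intr q)); first by rewrite -mapE fmorph_root.
    exact: monic_map.
  by apply/polyOverP => i; rewrite coef_map /= rpred_int.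
move: (h); rewrite /Aint unfold_in => /floorpP [q eq].
exists q; last by rewrite -(fmorph_root phi) mapE -eq root_minCpoly.
have := minCpoly_monic (phi x); rewrite eq => /monicP.
rewrite lead_coef_map_inj //; last exact: intr_inj.
by rewrite -[1]/(1%:~R) => /intr_inj /eqP.
Qed.

Lemma alg_integer_subring : subring_set (@alg_integer K).
Proof.
split; [exact: integral1|exact: integral_sub|exact: integral_mul].
Qed.

Lemma rat_Aint_int (a : rat) : ratr a \in Aint -> a \is a Num.int.
Proof. by move=> h; rewrite -Cint_rat; apply: Cint_rat_Aint; rewrite ?Crat_rat. Qed.

Lemma trace_int (x : K) : alg_integer x -> trace_rat x \is a Num.int.
Proof.
move=> xi; apply: rat_Aint_int; rewrite trace_emb rpred_sum // => k _.
exact/alg_integerE.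
Qed.

End Embeddings.

Lemma binomial_prime_sum (F : comNzRingType) (A : set F) p x y : subring_set A ->
  prime p -> A x -> A y ->
  exists2 z, A z & (x + y) ^+ p = x ^+ p + y ^+ p + p%:R * z.
Proof.
move=> Ar pp Ax Ay; case: p pp => [//|[//|p]] pp.
exists (\sum_(i < p.+1) (x ^+ (p.+1 - i) * y ^+ i.+1) *+ ('C(p.+2, i.+1) %/ p.+2)).
  apply: sring_sum => // i _; rewrite -mulr_natr; apply: sringM => //; last exact: sring_nat.
  by apply: sringM => //; apply: sringX.
rewrite exprDn big_ord_recr big_ord_recl /= subn0 subnn !expr0 binn bin0 !mulr1 mul1r !mulr1n.
rewrite addrAC; congr (_ + _); rewrite mulr_sumr.
apply: eq_bigr => i _; rewrite /bump /= add1n subSS mulr_natl -mulrnA; congr (_ *+ _).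
rewrite divnK // prime_dvd_bin //= ltnS; exact: ltn_ord.
Qed.

Lemma binomial_prime_power (F : comNzRingType) (A : set F) p k x y : subring_set A ->
  prime p -> A x -> A y ->
  exists2 z, A z & (x + y) ^+ (p ^ k) = x ^+ (p ^ k) + y ^+ (p ^ k) + p%:R * z.
Proof.
move=> Ar pp Ax Ay; elim: k => [|k [z Az E]].
  by exists 0; rewrite ?mulr0 ?addr0 //; apply: sring0.
have Ap : A p%:R by apply: sring_nat.
have [z1 Az1 E1] := binomial_prime_sum Ar pp (sringX Ar (p ^ k) Ax) (sringX Ar (p ^ k) Ay).
have As : A (x ^+ (p ^ k) + y ^+ (p ^ k)) by apply: sringD => //; apply: sringX.
have [z2 Az2 E2] := binomial_prime_sum Ar pp As (sringM Ar Ap Az).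
exists (z1 + p%:R ^+ p.-1 * z ^+ p + z2).
  by do 2?apply: sringD => //; apply: sringM => //; apply: sringX.
have hp : p%:R ^+ p = p%:R * p%:R ^+ p.-1 :> F by rewrite -exprS prednK ?prime_gt0.
rewrite expnSr !exprM E E2 E1 exprMn hp.
ring.
Qed.

Lemma sum_prime_power (F : comNzRingType) (A : set F) p I (r : seq I) (E : I -> F) :
  subring_set A -> prime p -> (forall i, A (E i)) ->
  exists2 z, A z & (\sum_(i <- r) E i) ^+ p = \sum_(i <- r) E i ^+ p + p%:R * z.
Proof.
move=> Ar pp AE; elim: r => [|a r [z Az IH]].
  exists 0; first exact: sring0.
  by rewrite !big_nil mulr0 addr0 expr0n gtn_eqF ?prime_gt0.
have As : A (\sum_(i <- r) E i) by apply: sring_sum.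
have [z1 Az1 E1] := binomial_prime_sum Ar pp (AE a) As.
exists (z + z1); first exact: sringD.
by rewrite !big_cons E1 IH; ring.
Qed.

(** * Discriminant, Frobenius modulo [p] and ramification *)

Section Discriminant.
Variable K : fieldExtType rat.
Notation n := (\dim {:K}).

(** The default value 0 of [discr] stands for a missing integral basis, so a nonzero discriminant
    supplies one and its existence needs no separate proof. *)
Lemma discr_basis : discr K != 0 -> exists (b : n.-tuple K) (T : 'M[int]_n),
  [/\ integral_basis b, (forall i j, (T i j)%:~R = trace_rat (tnth b i * tnth b j))
    & \det T = discr K].
Proof.
rewrite /discr; case: xgetP => [D _ [b hb eD] _|]; last by rewrite eqxx.
have tint i j : exists m : int, m%:~R = trace_rat (tnth b i * tnth b j).
  have [_ bi _] := hb.
  have : trace_rat (tnth b i * tnth b j) \is a Num.int.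
    by apply: trace_int; apply: integral_mul; apply: bi.
  by move=> /intrP [m ->]; exists m.
pose T := \matrix_(i, j) sval (cid (tint i j)).
have hT i j : (T i j)%:~R = trace_rat (tnth b i * tnth b j).
  by rewrite mxE; case: cid.
exists b, T; split=> //; apply: (@intr_inj rat); rewrite eD -det_map_mx.
by congr (\det _); apply/matrixP => i j; rewrite !mxE; case: cid.
Qed.

Lemma trace_ratD : {morph @trace_rat K : x y / x + y}.
Proof.
move=> x y; apply: (fmorph_inj (@ratr algC)); rewrite rmorphD /= !trace_emb -big_split.
by apply: eq_bigr => k _; rewrite rmorphD.
Qed.

Lemma trace_ratZ a (x : K) : trace_rat (a *: x) = a * trace_rat x :> rat.
Proof.
apply: (fmorph_inj (@ratr algC)); rewrite rmorphM /= !trace_emb mulr_sumr.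
by apply: eq_bigr => k _; rewrite embZ.
Qed.

Lemma trace_rat_sum I (r : seq I) (E : I -> K) :
  trace_rat (\sum_(i <- r) E i) = \sum_(i <- r) trace_rat (E i).
Proof.
apply: (big_morph _ trace_ratD); apply: (fmorph_inj (@ratr algC)).
by rewrite /= trace_emb rmorph0 big1 // => k _; rewrite rmorph0.
Qed.

Let Or := alg_integer_subring K.

Lemma alg_int (m : int) : (m%:~R : rat)%:A = m%:~R :> K.
Proof. by rewrite -in_algE rmorph_int. Qed.

Lemma alg_natV (m : nat) : (m%:R^-1 : rat)%:A = m%:R^-1 :> K.
Proof. by rewrite -in_algE fmorphV rmorph_nat. Qed.

Lemma integral_basis_int (b : n.-tuple K) (c : 'I_n -> rat) : integral_basis b ->
  alg_integer (\sum_i c i *: tnth b i) <-> forall i, c i \is a Num.int.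
Proof.
move=> [bb bi bc]; split=> [h i|ci]; last first.
  apply: sring_sum => // i _; have /intrP [m ->] := ci i.
  rewrite -[_ *: _]mulr_algl alg_int; apply: sringM => //; exact: sring_int.
have := bc _ h i; under eq_bigr do rewrite (tnth_nth 0).
by rewrite coord_sum_free // (basis_free bb).
Qed.

Lemma dvd_by_nat_integral (b : n.-tuple K) (m : nat) x : integral_basis b -> (0 < m)%N ->
  alg_integer x -> (forall i, exists k : int, coord b i x = m%:R * k%:~R) ->
  alg_integer (x / m%:R).
Proof.
move=> bi m0 xi hk; have [bb _ _] := bi.
have mn0 : m%:R != 0 :> rat by rewrite pnatr_eq0 -lt0n.
have -> : x / m%:R = \sum_i (coord b i x / m%:R) *: tnth b i.
  rewrite [in LHS](coord_basis bb (memvf x)) mulr_suml; apply: eq_bigr => i _.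
  by rewrite -(tnth_nth 0) mulrC [_ / m%:R]mulrC -scalerA -[in RHS]mulr_algl alg_natV.
apply/integral_basis_int => // i; have [k ->] := hk i.
by rewrite mulrC mulKf // rpred_int.
Qed.

(** The [p]-th power of the trace of [y b_j] is, modulo [p], the sum of the conjugates of
    [(y b_j) ^+ p], hence divisible by [p]. So the coordinates of [y] lie in the kernel of the trace
    form modulo [p], which is trivial because the determinant is prime to [p]. *)
Lemma frobenius_reduced p (y : K) : prime p -> ~~ (p%:Z %| discr K)%Z ->
  alg_integer y -> alg_integer (y ^+ p / p%:R) -> alg_integer (y / p%:R).
Proof.
move=> pp pD yi ypi.
have D0 : discr K != 0 by apply: contraNneq pD => ->.
have [b [T [bi hT dT]]] := discr_basis D0; have [bb bint bc] := bi.
have cint i : exists m : int, coord b i y = m%:~R by apply/intrP/bc.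
pose c := \row_i sval (cid (cint i)).
have hc i : (c 0 i)%:~R = coord b i y by rewrite mxE; case: cid.
have pnz (F : numFieldType) : p%:R != 0 :> F by rewrite pnatr_eq0 -lt0n prime_gt0.
have key j : exists s : int, (c *m T) 0 j = p%:Z * s.
  have eT : ((c *m T) 0 j)%:~R = trace_rat (y * tnth b j) :> rat.
    rewrite mxE rmorph_sum {1}(coord_basis bb (memvf y)) mulr_suml trace_rat_sum.
    apply: eq_bigr => i _; rewrite rmorphM /= hT hc -scalerAl trace_ratZ.
    by rewrite (tnth_nth 0).
  set t := (c *m T) 0 j in eT *.
  have Aintr : subring_set [set x : algC | x \in Aint].
    by split=> [|x z|x z] /=; rewrite ?Aint1 // => xi zi; rewrite ?rpredB ?rpredM.
  have embi k (x : K) : alg_integer x -> emb k x \in Aint by move=> /(alg_integerE (emb k)).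
  have [z zi E] := @sum_prime_power algC _ p _ (index_enum 'I_n)
     (fun k => emb k (y * tnth b j)) Aintr pp (fun k => embi k _ (integral_mul yi (bint j))).
  have tp : (t ^+ p)%:~R / p%:R \in Aint.
    have -> : (t ^+ p)%:~R = (\sum_k emb k (y * tnth b j)) ^+ p :> algC.
      by rewrite -trace_emb -eT ratr_int rmorphXn.
    rewrite E mulrDl rpredD //; last by rewrite mulrC (mulKf (pnz _)).
    rewrite mulr_suml rpred_sum // => k _; rewrite -rmorphXn exprMn.
    have -> : emb k (y ^+ p * tnth b j ^+ p) / p%:R = emb k (y ^+ p / p%:R * tnth b j ^+ p).
      by rewrite !rmorphM /= fmorphV rmorph_nat mulrAC.
    by apply: embi; apply: integral_mul; [exact: ypi|apply: (sringX Or); apply: bint].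
  have : (t ^+ p)%:~R / p%:R \is a @Num.int rat.
    by apply: rat_Aint_int; rewrite fmorph_div /= ratr_int ratr_nat.
  move=> /intrP [s hs].
  have : (p%:Z %| t ^+ p)%Z.
    apply/dvdzP; exists s; apply: (@intr_inj rat); rewrite intrM -hs divfK //.
    by rewrite pnatr_eq0 -lt0n prime_gt0.
  rewrite dvdzE abszX Euclid_dvdX //= => /andP[pt _].
  have /dvdzP [s' ->] : (p%:Z %| t)%Z by rewrite dvdzE.
  by exists s'; rewrite mulrC.
apply: (dvd_by_nat_integral bi (prime_gt0 pp) yi) => i.
pose s := \row_j sval (cid (key j)).
have es : c *m T = p%:Z *: s.
  by apply/rowP => j; rewrite !mxE; case: cid => s' /= <-; rewrite mxE.
have : c *m T *m \adj T = p%:Z *: (s *m \adj T) by rewrite es scalemxAl.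
rewrite -mulmxA mul_mx_adj mul_mx_scalar dT => /rowP/(_ i); rewrite !mxE => e.
have : (p%:Z %| discr K * c 0%R i)%Z.
  by apply/dvdzP; eexists; rewrite mxE e; apply: mulrC.
rewrite Gauss_dvdzr; last by rewrite /coprimez /gcdz -[_ == _]/(coprime p _) prime_coprime.
by move=> /dvdzP [k hk]; exists k; rewrite -hc hk mulrC intrM.
Qed.

(** Coordinates modulo [p] take finitely many values, so [x ^+ (p ^ k)] and [x ^+ (p ^ l)] agree
    modulo [p] for some [k < l]. Their difference is a [p ^ k]-th power modulo [p], and
    [frobenius_reduced] cancels that exponent. *)
Lemma unramified_frobenius p (x : K) : prime p -> ~~ (p%:Z %| discr K)%Z ->
  alg_integer x -> exists2 r, (0 < r)%N & alg_integer ((x ^+ (p ^ r) - x) / p%:R).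
Proof.
move=> pp pD xi.
have D0 : discr K != 0 by apply: contraNneq pD => ->.
have [b [_ [bi _ _]]] := discr_basis D0; have [bb bint bc] := bi.
have p0 := prime_gt0 pp.
have xki k : alg_integer (x ^+ (p ^ k)) by apply: sringX.
have cint i k : exists m : int, coord b i (x ^+ (p ^ k)) = m%:~R by apply/intrP/bc.
pose c i k := sval (cid (cint i k)).
have hc i k : coord b i (x ^+ (p ^ k)) = (c i k)%:~R by rewrite /c; case: cid.
pose f k := [ffun i : 'I_n => Ordinal (ltn_pmod `|(c i k %% p%:Z)%Z|%N p0)].
have [k [l [kl fkl]]] : exists k l, (k < l)%N /\ f k = f l.
  apply: contrapT => hn.
  have finj : injective (fun k : 'I_(#|{: {ffun 'I_n -> 'I_p}}|.+1) => f k).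
    move=> k l e; apply: val_inj; have [lt|gt|//] := ltngtP k l; exfalso; apply: hn.
      by exists k, l.
    by exists l, k.
  by have := leq_card _ finj; rewrite card_ord ltnn.
have cpl i : exists s : int, c i l - c i k = p%:Z * s.
  have := congr1 (fun g : {ffun 'I_n -> 'I_p} => val (g i)) fkl; rewrite !ffunE /=.
  have pz : p%:Z != 0 by rewrite eqz_nat -lt0n.
  rewrite !modn_small; try by rewrite -ltz_nat gez0_abs ?modz_ge0 // ltz_pmod.
  move=> /(congr1 Posz); rewrite !gez0_abs ?modz_ge0 // => /eqP e.
  have : (p%:Z %| c i l - c i k)%Z by rewrite -eqz_mod_dvd eq_sym.
  by move=> /dvdzP [s ->]; exists s; rewrite mulrC.
have diff : alg_integer ((x ^+ (p ^ l) - x ^+ (p ^ k)) / p%:R).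
  apply: (dvd_by_nat_integral bi p0); first exact: sringB.
  move=> i; have [s hs] := cpl i; exists s.
  by rewrite linearB /= !hc -rmorphB /= hs intrM.
exists (l - k)%N; first by rewrite subn_gt0.
have reduce m : forall y : K, alg_integer y -> alg_integer (y ^+ (p ^ m) / p%:R) -> alg_integer (y / p%:R).
  elim: m => [|m IH] y yi; first by rewrite expn0 expr1.
  by rewrite expnS exprM => /(IH _ (sringX Or p yi)); apply: frobenius_reduced.
have ui := xki (l - k)%N; set u := x ^+ _ in ui *.
apply: (reduce k); first exact: sringB.
have [z zi E] := binomial_prime_power k Or pp (sringB Or ui xi) xi.
have -> : (u - x) ^+ (p ^ k) = u ^+ (p ^ k) - x ^+ (p ^ k) - p%:R * z.
  by move: E; rewrite subrK => ->; ring.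
have pK : p%:R != 0 :> K by rewrite -(rmorph_nat (GRing.in_alg K)) fmorph_eq0 pnatr_eq0 -lt0n.
rewrite mulrBl [p%:R * z]mulrC mulfK // /u -exprM -expnD subnK ?(ltnW kl) //.
exact: sringB.
Qed.

(** The determinant of the trace form vanishes modulo [p], so the form has a nonzero kernel vector
    over ['F_p]; [y] is a lift of it. *)
Lemma ramified_element p : prime p -> discr K != 0 -> (p%:Z %| discr K)%Z ->
  exists y : K, [/\ alg_integer y, ~ alg_integer (y / p%:R) &
    forall z, alg_integer z -> exists m : int, trace_rat (y * z) = p%:R * m%:~R].
Proof.
move=> pp D0 pD; have [b [T [bi hT dT]]] := discr_basis D0; have [bb bint bc] := bi.
have pchar : p \in [pchar 'F_p] by apply: pchar_Fp.
have : \det (map_mx (intr : int -> 'F_p) T) == 0.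
  by rewrite det_map_mx dT -(dvdz_pcharf pchar).
move=> /det0P [v v0 vT].
pose c i : int := (val (v 0 i))%:Z.
have hc i : (c i)%:~R = v 0 i by rewrite /c -pmulrn natr_Zp.
pose y := \sum_i (c i)%:~R *: tnth b i.
have yi : alg_integer y by apply/integral_basis_int => // i; rewrite rpred_int.
have pnz : p%:R != 0 :> rat by rewrite pnatr_eq0 -lt0n prime_gt0.
exists y; split=> //.
  have -> : y / p%:R = \sum_i ((c i)%:~R / p%:R) *: tnth b i.
    rewrite mulr_suml; apply: eq_bigr => i _.
    by rewrite mulrC [_ / p%:R]mulrC -scalerA -[in RHS]mulr_algl alg_natV.
  move=> /integral_basis_int -/(_ bi) h; case/eqP: v0; apply/rowP => i; rewrite mxE.
  have /intrP [m hm] := h i; rewrite -hc; apply/eqP; rewrite -(dvdz_pcharf pchar).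
  apply/dvdzP; exists m; apply: (@intr_inj rat); rewrite intrM -hm divfK //.
have key j : exists s : int, trace_rat (y * tnth b j) = p%:R * s%:~R.
  have e : trace_rat (y * tnth b j) = (\sum_i c i * T i j)%:~R.
    rewrite mulr_suml trace_rat_sum rmorph_sum; apply: eq_bigr => i _.
    by rewrite -scalerAl trace_ratZ -hT rmorphM.
  have /dvdzP [s hs] : (p%:Z %| \sum_i c i * T i j)%Z.
    rewrite (dvdz_pcharf pchar) rmorph_sum; move/rowP: vT => /(_ j); rewrite !mxE => h.
    by apply/eqP; rewrite -[RHS]h; apply: eq_bigr => i _; rewrite mxE rmorphM /= hc.
  by exists s; rewrite e hs intrM mulrC.
move=> z zi; exists (\sum_j sval (cid (key j)) * Num.floor (coord b j z)).
rewrite rmorph_sum mulr_sumr {1}(coord_basis bb (memvf z)) mulr_sumr trace_rat_sum.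
apply: eq_bigr => j _; rewrite -scalerAr trace_ratZ -(tnth_nth 0).
case: cid => s /= ->; rewrite rmorphM /= floorK ?bc //; ring.
Qed.

End Discriminant.

(** * The tower of normal fields *)

Lemma splitting_number_field (s : seq algC) :
  exists (N : splittingFieldType rat) (iota : {rmorphism N -> algC}),
    forall x, x \in s -> exists y, iota y = x.
Proof.
pose q x : {poly rat} := s2val (minCpolyP x).
have qE x : minCpoly x = map_poly ratr (q x) by rewrite /q; case: (minCpolyP x) => ? [].
have q0 x : q x != 0 by rewrite -(map_poly_eq0 (@ratr algC)) -qE minCpoly_eq0.
pose P := \prod_(x <- s) q x.
have P0 : P != 0 by rewrite prodf_seq_neq0; apply/allP => x _; rewrite q0 implybT.
have [r er] := closed_field_poly_normal (map_poly ratr P : {poly algC}).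
have [N [iota [s1 es1 gen]]] := num_field_exists r.
have PN : map_poly (in_alg N) P = (lead_coef P)%:A *: \prod_(z <- s1) ('X - z%:P).
  apply: (map_poly_inj iota); rewrite -map_poly_comp.
  have -> : map_poly (iota \o in_alg N) P = map_poly ratr P.
    by apply: eq_map_poly => a /=; rewrite alg_num_field fmorph_rat.
  rewrite er -es1 big_map lead_coef_map map_polyZ /= rmorph_prod /=.
  rewrite alg_num_field fmorph_rat; congr (_ *: _).
  by apply: eq_bigr => z _; rewrite map_polyXsubC.
have ax : splitting_field_axiom N.
  exists (map_poly (in_alg N) P); first exact: alg_polyOver.
  exists s1 => //; rewrite PN; apply: eqp_scale.
  by rewrite -in_algE fmorph_eq0 lead_coef_eq0.
pose N' := HB.pack_for (splittingFieldType rat) N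
  (FieldExt_isSplittingField.Build rat N ax).
exists N', iota => x xs.
have : x \in r.
  have : root (map_poly ratr P) x.
    rewrite rootE rmorph_prod /= horner_prod prodf_seq_eq0; apply/hasP; exists x => //=.
    by rewrite -rootE -qE root_minCpoly.
  rewrite er rootZ ?root_prod_XsubC // lead_coef_eq0 map_poly_eq0 //.
by rewrite -es1 => /mapP [y _ ->]; exists y.
Qed.

Section SplittingField.
Variables (N : splittingFieldType rat) (iota : {rmorphism N -> algC}).

Lemma number_field_galois (K : {subfield N}) : galois K {:N}.
Proof.
rewrite /galois subvf normalFieldf andbT /=.
apply/separableP => y _; apply: pcharf0_separable => q.
by rewrite pchar_lalg pchar_num.
Qed.

Lemma gal_moves (K : {subfield N}) x : x \notin K ->
  exists2 g, g \in 'Gal({:N} / K)%g & g x != x.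
Proof.
move=> xK; apply: contrapT => hn; case/negP: xK.
have /galois_fixedField <- := number_field_galois K.
apply/fixedFieldP => [|g gG]; first exact: memvf.
by apply: contrapT => /eqP h; apply: hn; exists g.
Qed.

Lemma gal_fix (K : {subfield N}) g x : g \in 'Gal({:N} / K)%g -> x \in K -> g x = x.
Proof. by move=> gG xK; apply: (fixed_gal (subvf K) gG). Qed.

Lemma gal_fixP (K : {subfield N}) (g : gal_of {:N}) :
  (forall x, x \in K -> g x = x) -> g \in 'Gal({:N} / K)%g.
Proof.
move=> h; rewrite gal_kHom ?subvf //; apply/kAHomP => x xK; exact: h.
Qed.

Lemma gal_fix_rat (g : gal_of {:N}) x : x \in 1%VS -> g x = x.
Proof. by move=> /vlineP [k ->]; rewrite linearZ /= rmorph1. Qed.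

Lemma galM_all (g h : gal_of {:N}) x : (g * h)%g x = h (g x).
Proof. by rewrite galM ?memvf. Qed.

Lemma galVK (g : gal_of {:N}) x : (g^-1)%g (g x) = x.
Proof. by rewrite -galM_all mulgV gal_id. Qed.

Lemma galKV (g : gal_of {:N}) x : g ((g^-1)%g x) = x.
Proof. by rewrite -galM_all mulVg gal_id. Qed.

Lemma gal_extends (g : gal_of {:N}) :
  exists tau : {rmorphism algC -> algC}, forall x, iota (g x) = tau (iota x).
Proof. by have [tau h] := extend_algC_subfield_aut iota g; exists tau. Qed.

(** A subspace of largest dimension inside [P] absorbs every element of [P]. This turns fields given
    as sets, such as a level of the tower, into subfields of [N]. *)
Lemma subfield_of_set (P : set N) :
  P 1 -> (forall x y, P x -> P y -> P (x - y)) -> (forall x y, P x -> P y -> P (x * y)) ->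
  (forall (a : rat) x, P x -> P (a *: x)) ->
  exists K : {subfield N}, forall x, x \in K <-> P x.
Proof.
move=> P1 PB PM PZ.
have P0 : P 0 by rewrite -(subrr 1); apply: PB.
have PD x y : P x -> P y -> P (x + y).
  by move=> hx hy; rewrite -(opprK y) -[- y]sub0r; apply: (PB _ _ hx); apply: PB.
pose Q d := `[< exists U : {vspace N}, (forall x, x \in U -> P x) /\ \dim U = d >].
have Qex : exists d, Q d.
  exists 0%N; apply/asboolP; exists 0%VS; split; last exact: dimv0.
  by move=> x; rewrite memv0 => /eqP ->.
have Qb d : Q d -> (d <= \dim {:N})%N by move=> /asboolP [U [_ <-]]; apply: dimvS; apply: subvf.
have [d /asboolP [U [UP dU]] dmax] := ex_maxnP Qex Qb.
have Ufull x : P x -> x \in U.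
  move=> Px; have [//|xU] := boolP (x \in U).
  have : Q (\dim (U + <[x]>)%VS).
    apply/asboolP; exists (U + <[x]>)%VS; split=> // y /memv_addP [u uU [w /vlineP [k ->] ->]].
    by apply: PD; [apply: UP|apply: PZ].
  move=> /dmax; rewrite -dU => h; have /eqP eU : U == (U + <[x]>)%VS by rewrite eqEdim addvSl.
  have : x \in (U + <[x]>)%VS by apply: (subvP (addvSr _ _)); apply: memv_line.
  by rewrite -eU (negPf xU).
have Ua : is_aspace U.
  rewrite /is_aspace has_algid1 ?Ufull //=; apply/prodvP => x y xU yU.
  by apply: Ufull; apply: PM; apply: UP.
by exists (ASpace Ua) => x; split=> [/UP|/Ufull].
Qed.

End SplittingField.

Lemma minCpoly_dvd_minPoly (N : fieldExtType rat) (iota : {rmorphism N -> algC}) a :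
  exists2 m : {poly rat}, minPoly 1 a = map_poly (in_alg N) m &
    minCpoly (iota a) %| map_poly ratr m.
Proof.
have /polyOver1P [m em] := minPolyOver 1 a; exists m => //.
have [q [-> qm] qd] := minCpolyP (iota a).
rewrite dvdp_map -qd; have -> : map_poly ratr m = map_poly iota (minPoly 1 a).
  rewrite em -map_poly_comp; apply: eq_map_poly => c /=.
  by rewrite alg_num_field fmorph_rat.
by rewrite fmorph_root root_minPoly.
Qed.

(** Both elements are placed in one splitting field, whose Galois group is transitive on the roots;
    the automorphism found there extends to [algC]. *)
Lemma conjugate_aut x y : root (minCpoly x) y ->
  exists tau : {rmorphism algC -> algC}, tau x = y.
Proof.
move=> rxy; have [N [iota h]] := splitting_number_field [:: x; y].
have [a ea] := h x (mem_head _ _); have [b eb] : exists b, iota b = y.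
  by apply: h; rewrite !inE eqxx orbT.
have [m em] := minCpoly_dvd_minPoly iota a; rewrite ea => md.
have : root (minPoly 1 a) b.
  rewrite em -(fmorph_root iota) eb -map_poly_comp.
  have -> : map_poly (iota \o in_alg N) m = map_poly ratr m.
    by apply: eq_map_poly => c /=; rewrite alg_num_field fmorph_rat.
  by move/dvdpP: md => [c ->]; rewrite rootM rxy orbT.
move=> /(normalField_root_minPoly (sub1v _) (normalFieldf _) (memvf a)) [g _ gab].
have [tau ht] := gal_extends iota g.
by exists tau; rewrite -ea -ht gab.
Qed.

Lemma minCpoly_separable x : separable_poly (minCpoly x).
Proof.
have [N [iota h]] := splitting_number_field [:: x].
have [a <-] := h x (mem_head _ _).
have [m em md] := minCpoly_dvd_minPoly iota a.
apply: dvdp_separable md _; rewrite separable_map -(separable_map (in_alg N)) -em.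
by apply: pcharf0_separable => q; rewrite pchar_lalg pchar_num.
Qed.

Section SubfieldSets.
Variable E : set algC.
Hypothesis Ef : subfield E.
Lemma sfield1 : E 1. Proof. by case: Ef. Qed.
Lemma sfieldB x y : E x -> E y -> E (x - y). Proof. by case: Ef => _ h _; apply: h. Qed.
Lemma sfield_div x y : E x -> E y -> E (x / y). Proof. by case: Ef => _ _; apply. Qed.
Lemma sfieldM x y : E x -> E y -> E (x * y).
Proof.
move=> hx hy; rewrite -(invrK y); apply: sfield_div => //.
by rewrite -[y^-1]mul1r; apply: sfield_div => //; apply: sfield1.
Qed.
Lemma sfield_subring : subring_set E.
Proof. by split; [exact: sfield1|exact: sfieldB|exact: sfieldM]. Qed.
Lemma sfield_rat (a : rat) : E (ratr a).
Proof. by apply: sfield_div; apply: sring_int; apply: sfield_subring. Qed.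
End SubfieldSets.

Lemma smallest_subfield A : subfield (smallest subfield A).
Proof.
split; first by move=> M [Mf _]; apply: sfield1.
  by move=> x y hx hy M MA; case: (MA) => Mf _; apply: sfieldB => //; [apply: hx|apply: hy].
by move=> x y hx hy M MA; case: (MA) => Mf _; apply: sfield_div => //; [apply: hx|apply: hy].
Qed.

Lemma smallest_subring (A : set algC) : subring_set (smallest (@subring_set algC) A).
Proof.
split; first by move=> M [Mf _]; apply: sring1.
  by move=> x y hx hy M MA; case: (MA) => Mf _; apply: sringB => //; [apply: hx|apply: hy].
by move=> x y hx hy M MA; case: (MA) => Mf _; apply: sringM => //; [apply: hx|apply: hy].
Qed.

Lemma subfield_preimage (F : fieldType) (f : {rmorphism F -> algC}) (E : set algC) :
  subfield E -> [/\ E (f 1), (forall x y, E (f x) -> E (f y) -> E (f (x - y)))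
    & (forall x y, E (f x) -> E (f y) -> E (f (x / y)))].
Proof.
move=> Ef; split=> [|x y hx hy|x y hx hy]; first by rewrite rmorph1; apply: sfield1.
  by rewrite rmorphB; apply: sfieldB.
by rewrite fmorph_div; apply: sfield_div.
Qed.

Lemma smallest_subfield_aut A (tau : {rmorphism algC -> algC}) :
  (forall x, A x -> smallest subfield A (tau x)) ->
  forall x, smallest subfield A x -> smallest subfield A (tau x).
Proof.
move=> h x hx; apply: (hx [set y | smallest subfield A (tau y)]); split=> //.
exact: (subfield_preimage tau (smallest_subfield A)).
Qed.

Section Tower.
Variable F : nat -> fieldExtType rat.

(* For a pure cubic field the square root of the discriminant is a rational
   multiple of a square root of -3, which is therefore adjoined from the start. *)
Definition tower_gen n : set algC :=
  [set x | x ^+ 2 = - 3%:R \/ exists j (k : 'I_(\dim {: F j})) y, (j < n)%N /\ x = emb k y].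

Definition tower n : set algC := smallest subfield (tower_gen n).

Lemma tower_subfield n : subfield (tower n).
Proof. exact: smallest_subfield. Qed.

Lemma tower_mem n : tower_gen n `<=` tower n.
Proof. exact: sub_gen_smallest. Qed.

Lemma towerS m n : (m <= n)%N -> tower m `<=` tower n.
Proof.
move=> mn; apply: smallest_sub; first exact: tower_subfield.
move=> x [h|[j [k [y [jm ->]]]]]; apply: tower_mem; first by left.
by right; exists j, k, y; split=> //; apply: leq_trans mn.
Qed.

(** An automorphism changes at most the sign of a square root of -3, and it permutes the embeddings
    of each [F j]. *)
Lemma tower_aut n (tau : {rmorphism algC -> algC}) x : tower n x -> tower n (tau x).
Proof.
apply: smallest_subfield_aut => {}x [h|[j [k [y [jm ->]]]]]; apply: tower_mem.
  by left; rewrite -rmorphXn h rmorphN rmorph_nat.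
have [l hl] := emb_all (tau \o emb k).
by right; exists j, l, y; split=> //; rewrite -hl.
Qed.

Lemma tower_galois n : galois_over_rat (tower n).
Proof.
split; first exact: tower_subfield.
move=> x xn; split; first exact: minCpoly_separable.
by move=> y /conjugate_aut [tau <-]; apply: tower_aut.
Qed.

Lemma galois_closure_tower (iota : forall i, {rmorphism F i -> algC}) i :
  galois_closure (range (iota i)) `<=` tower i.+1.
Proof.
apply: smallest_sub; first exact: tower_galois.
move=> _ [y _ <-]; apply: tower_mem; have [k hk] := emb_all (iota i).
by right; exists i, k, y; split.
Qed.

Lemma compositum_tower (iota : forall i, {rmorphism F i -> algC}) :
  compositum (fun i => galois_closure (range (iota i))) `<=` \bigcup_n tower n.
Proof.
have join x y : (\bigcup_n tower n) x -> (\bigcup_n tower n) y ->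
    exists n, tower n x /\ tower n y.
  move=> [m _ xm] [n _ yn]; exists (maxn m n); split.
    by apply: (towerS (leq_maxl m n)).
  by apply: (towerS (leq_maxr m n)).
apply: smallest_sub.
  split; first by exists 0%N => //; apply: sfield1; apply: tower_subfield.
    move=> x y hx hy; have [n [xn yn]] := join _ _ hx hy.
    by exists n => //; apply: (sfieldB (tower_subfield n)).
  move=> x y hx hy; have [n [xn yn]] := join _ _ hx hy.
  by exists n => //; apply: (sfield_div (tower_subfield n)).
by move=> x [i _ /galois_closure_tower h]; exists i.+1.
Qed.

End Tower.

Lemma integral_multiple (K : fieldExtType rat) (x : K) : discr K != 0 ->
  exists2 m : nat, (0 < m)%N & alg_integer (m%:R * x).
Proof.
move=> D0; have [b [_ [bi _ _]]] := discr_basis D0; have [bb _ _] := bi.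
exists (\prod_i `|denq (coord b i x)|)%N.
  by apply/prodn_gt0 => i; rewrite absz_gt0 denq_neq0.
set m := (\prod_i _)%N.
have -> : m%:R * x = \sum_i (m%:R * coord b i x) *: tnth b i.
  rewrite [in LHS](coord_basis bb (memvf x)) mulr_sumr; apply: eq_bigr => i _.
  rewrite -(tnth_nth 0) -scalerA -[in RHS]mulr_algl.
  by have := alg_int K m; rewrite -!pmulrn => ->.
apply/integral_basis_int => // i; rewrite /m (bigD1 i) //= natrM mulrAC.
apply: rpredM; last exact: rpred_nat.
have -> : `|denq (coord b i x)|%:R = (denq (coord b i x))%:~R :> rat.
  by rewrite pmulrn absz_denq.
by rewrite mulrC -[X in X * _]divq_num_den divfK ?intr_eq0 ?denq_neq0 // rpred_int.
Qed.

Lemma abs_integral_le1 (R : realType) (E : fieldType) (v : E -> R) (q : {poly E}) x :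
  is_abs v -> ultrametric v -> q \is monic -> (forall i, v q`_i <= 1) -> root q x -> v x <= 1.
Proof.
move=> va vu qm qi /rootP; rewrite leNgt => qx; apply/negP => x1.
have [d sq] : exists d, size q = d.+1.
  by exists (size q).-1; rewrite prednK // size_poly_gt0 monic_neq0.
move: qx; rewrite horner_coef sq big_ord_recr /= => /eqP; rewrite addrC addr_eq0.
have -> : q`_d = 1 by move/monicP: qm; rewrite /lead_coef sq.
rewrite mul1r => /eqP e; have := congr1 v e; rewrite absN // absX // => h.
have : v x ^+ d <= v x ^+ d.-1.
  rewrite h; apply: ultra_sum => // [|i _]; first by rewrite exprn_ge0 ?(abs_ge0 va).
  rewrite absM // absX // -[leRHS]mul1r ler_pM ?exprn_ge0 ?(abs_ge0 va) //.
  by rewrite ler_weXn2l ?(ltW x1) // -ltnS (leq_trans (ltn_ord i)) // leqSpred.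
rewrite leNgt => /negP; apply.
case: d sq e h => [|d] sq e h; last by rewrite /= ltr_eXn2l.
by move: e; rewrite big_ord0 oppr0 => /eqP; rewrite expr0 oner_eq0.
Qed.

Lemma abs_Aint_le1 (R : realType) p x : prime p -> x \in Aint -> algC_abs R (Some p) x <= 1.
Proof.
move=> pp; rewrite /Aint unfold_in => /polyOverP h.
have va := @algC_absP R (Some p) pp; have vu := algC_abs_ultra R pp.
apply: (abs_integral_le1 va vu (minCpoly_monic x) _ (root_minCpoly x)) => i.
by have /intrP [m ->] := h i; apply: ultra_int.
Qed.

(* In an unramified ring [B] the map [x |-> x ^+ q] is the identity modulo [p]
   for a suitable power [q] of [p]; so [V x < 1] forces [V x = V (p y)] with
   [y] in [B], and the values of [B] are powers of [p]. *)
Section UnramifiedRing.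
Variables (R : realType) (p : nat).
Hypothesis pp : prime p.
Local Notation V := (algC_abs R (Some p)).
Let va : is_abs V. Proof. exact: (@algC_absP R (Some p) pp). Qed.
Let vu : ultrametric V. Proof. exact: algC_abs_ultra. Qed.

Lemma padic_abs_p : V p%:R = p%:R^-1.
Proof.
rewrite -(ratr_nat algC) algC_abs_rat //= /padic_abs pnatr_eq0 gtn_eqF ?prime_gt0 //.
have -> : numq p%:R = p by rewrite -[p%:R]/(p%:Z%:~R) numq_int.
have -> : denq p%:R = 1 by rewrite -[p%:R]/(p%:Z%:~R) denq_int.
by rewrite /= logn1 logn_prime // eqxx.
Qed.

Definition unramified_ring (B : set algC) := [/\ subring_set B, (forall x, B x -> V x <= 1) &
  forall x, B x -> exists r, (0 < r)%N /\ exists2 y, B y & x ^+ (p ^ r) = x + p%:R * y].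

Lemma unramified_ring_value B x : unramified_ring B -> B x -> x != 0 ->
  exists m : nat, V x = p%:R ^- m.
Proof.
move=> [Br B1 Bf] Bx x0.
have p0 : 0 < p%:R :> R by rewrite ltr0n prime_gt0.
have p1 : 1 < p%:R :> R by rewrite ltr1n prime_gt1.
have vx : 0 < V x by rewrite abs_gt0.
(* [n] bounds how often [p] can be divided out, which makes the induction possible. *)
have [n /(_ n (leqnn n)) hn] := exprn_unbounded (V x)^-1 p1.
have {hn} : 1 < p%:R ^+ n * V x by rewrite -ltr_pdivrMr // div1r.
elim: n x Bx x0 {vx} => [|n IH] x Bx x0.
  by rewrite expr0 mul1r ltNge B1.
have vx : 0 < V x by rewrite abs_gt0.
have := B1 _ Bx; rewrite le_eqVlt => /predU1P [->|vx1 hn]; first by exists 0%N; rewrite expr0 invr1.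
have [r [r0 [y By ey]]] := Bf _ Bx.
have lt : V (x ^+ (p ^ r)) < V (- x).
  rewrite absN // absX // -[ltRHS]expr1 ltr_iXn2l //.
  by rewrite (leq_trans (prime_gt1 pp)) // -{1}[p]expn1 leq_exp2l // prime_gt1.
have : V (p%:R * y) = V x.
  by rewrite -(absN va x) -(ultra_lt va vu lt) ey addrC addKr.
rewrite absM // padic_abs_p => h.
have vy : V y = p%:R * V x by rewrite -h mulVKf ?gt_eqF.
have y0 : y != 0 by rewrite -(abs_eq0 va) vy mulf_neq0 ?gt_eqF.
have [|m hm] := IH y By y0; first by rewrite vy mulrA -exprSr.
by exists m.+1; rewrite -h hm exprS invfM.
Qed.

(** The Frobenius congruence passes from generators to differences and products once both exponents
    are replaced by their common multiple [r * s]. *)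
Lemma unramified_smallest (A : set algC) : (forall x, A x -> x \in Aint) ->
  (forall x, A x -> exists r, (0 < r)%N /\
    exists2 y, smallest (@subring_set algC) A y & x ^+ (p ^ r) = x + p%:R * y) ->
  unramified_ring (smallest (@subring_set algC) A).
Proof.
move=> Ai Af; set B := smallest _ A; have Br : subring_set B by apply: smallest_subring.
have Bp : B p%:R by apply: sring_nat.
split=> //.
  move=> x Bx; apply: abs_Aint_le1 => //.
  apply: (Bx [set x | x \in Aint]); split; last exact: Ai.
  by split=> [|z y|z y] /=; rewrite ?Aint1 // => xi zi; rewrite ?rpredB ?rpredM.
pose cong x y := exists2 z, B z & x = y + p%:R * z.
have congX n x y : B y -> cong x y -> cong (x ^+ n) (y ^+ n).
  move=> By [z Bz e]; elim: n => [|n [w Bw IH]].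
    by exists 0; rewrite ?mulr0 ?addr0 //; apply: (sring0 Br).
  exists (y * w + z * y ^+ n + p%:R * z * w); last by rewrite !exprS IH e; ring.
  by do ?apply: (sringD Br) => //; do ?apply: (sringM Br) => //; apply: (sringX Br).
have congT x y z : cong x y -> cong y z -> cong x z.
  by move=> [a Ba ->] [b Bb ->]; exists (b + a); [apply: (sringD Br)|ring].
have iter x r k : B x -> cong (x ^+ (p ^ r)) x -> cong (x ^+ (p ^ (r * k))) x.
  move=> Bx h; elim: k => [|k IH].
    by rewrite muln0 expn0 expr1; exists 0; rewrite ?mulr0 ?addr0 //; apply: (sring0 Br).
  rewrite mulnSr expnD exprM; apply: (congT _ (x ^+ (p ^ r))) => //; exact: congX.
pose S : set algC := [set x | B x /\ exists r, (0 < r)%N /\ cong (x ^+ (p ^ r)) x].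
have SB : S `<=` B by move=> x [].
suff BS : B `<=` S by move=> x /BS [_ h].
apply: smallest_sub; last by move=> x Ax; split; [apply: sub_gen_smallest|apply: Af].
split.
- split; first exact: (sring1 Br).
  by exists 1%N; split=> //; exists 0; rewrite ?expr1n ?mulr0 ?addr0 //; apply: (sring0 Br).
- move=> x y [Bx [r [r0 hr]]] [By [s [s0 hs]]]; split; first exact: (sringB Br).
  exists (r * s)%N; rewrite muln_gt0 r0 s0; split=> //.
  have [a Ba ea] := iter _ _ s Bx hr.
  have [b Bb eb] := iter _ _ r By hs; rewrite mulnC in eb.
  have [z Bz E] := binomial_prime_power (r * s) Br pp (sringB Br Bx By) By.
  exists (a - b - z); first by do 2?apply: (sringB Br).
  have -> : (x - y) ^+ (p ^ (r * s)) = x ^+ (p ^ (r * s)) - y ^+ (p ^ (r * s)) - p%:R * z.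
    by move: E; rewrite subrK => ->; ring.
  by rewrite ea eb; ring.
move=> x y [Bx [r [r0 hr]]] [By [s [s0 hs]]]; split; first exact: (sringM Br).
exists (r * s)%N; rewrite muln_gt0 r0 s0; split=> //.
have [a Ba ea] := iter _ _ s Bx hr.
have [b Bb eb] := iter _ _ r By hs; rewrite mulnC in eb.
exists (x * b + a * y + p%:R * a * b); last by rewrite exprMn ea eb; ring.
by do ?apply: (sringD Br) => //; do ?apply: (sringM Br) => //.
Qed.

End UnramifiedRing.

(** For [c = -3] this says that Frobenius applied twice fixes a square root of -3 modulo [p]: the
    exponent is [(p ^ 2 - 1) / 2], a multiple of [p - 1] as [p] is odd. *)
Lemma fermat_half (p : nat) (c : int) : prime p -> odd p -> ~~ (p%:Z %| c)%Z ->
  (p%:Z %| c ^+ (p ^ 2)./2 - 1)%Z.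
Proof.
move=> pp po pc; have pchar := pchar_Fp pp.
rewrite (dvdz_pcharf pchar) rmorphB rmorphXn rmorph1 subr_eq0 /=.
have c0 : c%:~R != 0 :> 'F_p by rewrite -(dvdz_pcharf pchar).
have h1 : c%:~R ^+ p.-1 = 1 :> 'F_p.
  apply: (mulfI c0); rewrite -exprS prednK ?prime_gt0 // mulr1.
  by rewrite -[X in _ ^+ X](card_Fp pp) expf_card.
have -> : ((p ^ 2)./2 = p.-1 * (p.+1)./2)%N.
  have p0 := prime_gt0 pp.
  have [m ->] : exists m, p = m.*2.+1 by exists p./2; rewrite -[LHS]odd_double_half po.
  have -> : (m.*2.+1 ^ 2 = (2 * m * m + 2 * m).*2.+1)%N by rewrite expnS expn1 -!muln2; lia.
  have hh k : (k.*2.+1)./2 = k by rewrite /= uphalf_double.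
  by rewrite hh -[m.*2.+2]/(m.+1.*2) doubleK /= -muln2; lia.
by rewrite exprM h1 expr1n.
Qed.

(** The integers of the earlier fields, together with the square roots of -3, generate an unramified
    ring, and the tower lies in its field of fractions. *)
Lemma tower_value (R : realType) (F : nat -> fieldExtType rat) p n x : prime p -> (3 < p)%N ->
  (forall j, (j < n)%N -> ~~ (p%:Z %| discr (F j))%Z) ->
  tower F n x -> x != 0 -> exists k : int, algC_abs R (Some p) x = p%:R ^ k.
Proof.
move=> pp p3 hd.
have va := @algC_absP R (Some p) pp.
have p0 : (p%:R : R) != 0 by rewrite pnatr_eq0 -lt0n prime_gt0.
pose A : set algC := [set x | x ^+ 2 = - 3%:R \/
  exists j (k : 'I_(\dim {: F j})) y, [/\ (j < n)%N, alg_integer y & x = emb k y]].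
have D0 j : (j < n)%N -> discr (F j) != 0 by move=> /hd; apply: contraNneq => ->.
pose B := smallest (@subring_set algC) A.
have Br : subring_set B by apply: smallest_subring.
have Bu : unramified_ring R p B.
  apply: unramified_smallest => //.
    move=> z [h|[j [k [y [jn yi ->]]]]]; last exact/alg_integerE.
    apply: (@root_monic_Aint ('X^2 + 3%:R%:P)).
    - by rewrite rootE hornerD hornerXn hornerC h addNr.
    - by rewrite monicE lead_coefDl ?lead_coefXn // size_polyXn size_polyC; case: eqP.
    - apply/polyOverP => i; rewrite coefD coefXn coefC.
      by apply: rpredD; first exact: rpred_nat; case: ifP => _; rewrite ?rpred_nat ?rpred0.
  move=> z [h|[j [k [y [jn yi ->]]]]]; last first.
    have [r r0 hr] := unramified_frobenius pp (hd j jn) yi; exists r; split=> //.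
    exists (emb k ((y ^+ (p ^ r) - y) / p%:R)).
      by apply: sub_gen_smallest; right; exists j, k, ((y ^+ (p ^ r) - y) / p%:R).
    rewrite fmorph_div rmorphB rmorphXn rmorph_nat /= mulrC divfK ?pnatr_eq0 -?lt0n ?prime_gt0 //.
    by rewrite addrC subrK.
  (* The exponent 1 would not do: if -3 is not a square modulo [p], Frobenius changes the sign of
     [z]. *)
  exists 2%N; split=> //.
  have po : odd p by case/even_prime: pp => // p2; rewrite p2 in p3.
  have /dvdzP [m em] : (p%:Z %| (-3) ^+ (p ^ 2)./2 - 1)%Z.
    by apply: fermat_half => //; rewrite dvdzE /= dvdn_prime2 // gtn_eqF.
  exists (z * m%:~R).
    by apply: (sringM Br) => //; [apply: sub_gen_smallest; left|apply: (sring_int Br)].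
  rewrite -[in LHS](odd_double_half (p ^ 2)) oddX po orbT exprD expr1 -mul2n exprM h.
  have := congr1 (fun a : int => a%:~R : algC) em.
  rewrite /= rmorphB rmorphXn rmorphM rmorphN /= => /(canRL (subrK _)) e.
  have -> : - 3%:R = - (3%:~R) :> algC by [].
  rewrite e -pmulrn; ring.
pose Q : set algC := [set x | exists a b, [/\ B a, B b, b != 0 & x = a / b]].
suff TQ : tower F n `<=` Q.
  move=> /TQ [a [b [Ba Bb b0 ->]]]; rewrite mulf_eq0 negb_or => /andP[a0 _].
  have [m hm] := unramified_ring_value pp Bu Ba a0.
  have [l hl] := unramified_ring_value pp Bu Bb b0.
  exists (l%:Z - m%:Z); rewrite absM // absV // hm hl invrK.
  by rewrite expfzDr // mulrC -!exprnP -exprnN.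
apply: smallest_sub.
  split.
  - by exists 1, 1; rewrite oner_eq0 divr1; split=> //; apply: (sring1 Br).
  - move=> _ _ [a [b [Ba Bb b0 ->]]] [c [d [Bc Bd d0 ->]]].
    exists (a * d - c * b), (b * d); rewrite mulf_neq0 //; split=> //.
    + by apply: (sringB Br) => //; apply: (sringM Br).
    + exact: (sringM Br).
    + by field; rewrite b0 d0.
  move=> _ _ [a [b [Ba Bb b0 ->]]] [c [d [Bc Bd d0 ->]]].
  have [->|c0] := eqVneq c 0.
    rewrite mul0r invr0 mulr0; exists 0, 1; rewrite oner_eq0 mul0r.
    by split=> //; [apply: (sring0 Br)|apply: (sring1 Br)].
  exists (a * d), (b * c); rewrite mulf_neq0 //; split=> //; try exact: (sringM Br).
  by field; rewrite b0 c0 d0.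
move=> z [h|[j [k [y [jn ->]]]]].
  exists z, 1; rewrite oner_eq0 divr1; split=> //; last exact: (sring1 Br).
  by apply: sub_gen_smallest; left.
have [m m0 mi] := integral_multiple y (D0 j jn).
exists (emb k (m%:R * y)), m%:R; rewrite pnatr_eq0 -lt0n m0; split=> //.
- by apply: sub_gen_smallest; right; exists j, k, (m%:R * y).
- exact: (sring_nat Br).
- by rewrite rmorphM rmorph_nat mulrC mulKf // pnatr_eq0 -lt0n.
Qed.

(** * Places and local degrees *)

Section LocalDegree.
Variables (R : realType) (K : fieldExtType rat) (v : K -> R).
Hypothesis va : is_abs v.

(** Stands for a generating family of the completion, which is never constructed as a field. *)
Definition dense_span d (c : 'I_d -> K) := forall x (e : R), 0 < e ->
  exists q : 'I_d -> rat, v (x - \sum_i q i *: c i) < e.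

Lemma absZ (q : rat) x : v (q *: x) = v q%:A * v x.
Proof. by rewrite -[q *: x]mulr_algl (absM va). Qed.

(** A combination of small value with a large [i]-th coefficient approximates [c i] by the remaining
    vectors. *)
Lemma dense_span_drop d (c : 'I_d.+1 -> K) i : dense_span c ->
  (forall C : R, 0 < C -> exists q : 'I_d.+1 -> rat,
     C * v (\sum_j q j *: c j) < v (q i)%:A) ->
  dense_span (fun j => c (lift i j)).
Proof.
move=> cd hC x e e0; have e20 : 0 < e / 2 by rewrite divr_gt0.
have [q0 hq0] := cd x _ e20.
pose t := v (q0 i)%:A; have t0 : 0 <= t by apply: (abs_ge0 va).
(* This bound makes the correction cost at most [e / 2]; the added 1 keeps it positive when
   [t = 0]. *)
have C0 : 0 < (2 * t + 1) / e by rewrite divr_gt0 // ltr_wpDl // mulr_ge0.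
have [q hq] := hC _ C0.
have vqi : 0 < v (q i)%:A.
  by apply: le_lt_trans hq; apply: mulr_ge0; [apply: ltW|apply: (abs_ge0 va)].
have qi : q i != 0.
  by apply: contraTneq vqi => ->; rewrite scale0r (abs0 va) // ltxx.
pose q' j := q0 j - q0 i / q i * q j.
have q'i : q' i = 0 by rewrite /q' divfK // subrr.
exists (fun j => q' (lift i j)).
have -> : \sum_j q' (lift i j) *: c (lift i j) = \sum_j q' j *: c j.
  by rewrite [RHS](bigD1_ord i) //= q'i scale0r add0r.
have -> : \sum_j q' j *: c j = \sum_j q0 j *: c j - (q0 i / q i) *: \sum_j q j *: c j.
  by rewrite scaler_sumr -sumrB; apply: eq_bigr => j _; rewrite scalerBl scalerA.
rewrite opprB addrCA addrC; apply: (le_lt_trans (absD va _ _)).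
rewrite [e]splitr; apply: ltr_leD => //.
rewrite absZ; have -> : v (q0 i / q i)%:A = t / v (q i)%:A.
  by rewrite -in_algE fmorph_div (absM va) (absV va).
set S := v (\sum_j _) in hq *; rewrite mulrAC ler_pdivrMr //.
have S0 : 0 <= S by apply: (abs_ge0 va).
move: hq; rewrite mulrAC ltr_pdivrMr // => hq.
nra.
Qed.

(** In a dense family of minimal size every coefficient is bounded by a constant times the value of
    the combination; this yields independence as well as Cauchy coefficients. *)
Lemma local_basis_exists : exists d (e : 'I_d -> nat -> K), local_basis v e.
Proof.
have vbd : dense_span (fun i : 'I_(\dim {:K}) => (vbasis {:K})`_i).
  move=> x e e0; exists (fun i => coord (vbasis {:K}) i x).
  by rewrite -(coord_vbasis (memvf x)) subrr (abs0 va).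
have ex : exists d, `[< exists c : 'I_d -> K, dense_span c >].
  by exists (\dim {:K}); apply/asboolP; exists (fun i => (vbasis {:K})`_i).
have [d /asboolP [c cd] dmin] := ex_minnP ex.
have bound1 i : exists2 C : R, 0 < C &
    forall q : 'I_d -> rat, v (q i)%:A <= C * v (\sum_j q j *: c j).
  apply: contrapT => hn; case: d c cd dmin i hn => [|d] c cd dmin i hn; first by case: i hn.
  have : dense_span (fun j => c (lift i j)).
    apply: dense_span_drop => // C C0; apply: contrapT => hn2; apply: hn.
    by exists C => // q; rewrite leNgt; apply/negP => h; apply: hn2; exists q.
  move=> h; have /dmin : `[< exists c : 'I_d -> K, dense_span c >].
    by apply/asboolP; exists (fun j => c (lift i j)).
  by rewrite ltnn.
pose C i := s2val (cid2 (bound1 i)).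
have C0 i : 0 < C i by rewrite /C; case: cid2.
have hC i : forall q : 'I_d -> rat, v (q i)%:A <= C i * v (\sum_j q j *: c j).
  by rewrite /C; case: cid2.
exists d, (fun i _ => c i); split.
- by move=> i e e0; exists 0%N => m n _ _; rewrite subrr (abs0 va).
- move=> a _ na i e e0; have [|M hM] := na (e / C i); first by rewrite divr_gt0.
  exists M => n /hM; rewrite ltr_pdivlMr // mulrC; apply: le_lt_trans.
  exact: (hC i (fun i => a i n)).
move=> u uc.
have hq n : exists q : 'I_d -> rat, v (u n - \sum_i q i *: c i) < n.+1%:R^-1.
  by apply: cd; rewrite invr_gt0.
pose q n := sval (cid (hq n)).
have hq' n : v (u n - \sum_i q n i *: c i) < n.+1%:R^-1 by rewrite /q; case: cid.
have small (e : R) : 0 < e -> exists M, forall n, (M <= n)%N -> n.+1%:R^-1 < e.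
  move=> e0; exists (Num.bound e^-1) => n hn.
  have ei : 0 < e^-1 by rewrite invr_gt0.
  rewrite -[ltRHS]invrK ltf_pV2 ?posrE ?ltr0n //.
  by apply: (lt_trans (archi_boundP (ltW ei))); rewrite ltr_nat ltnS.
exists (fun i n => q n i).
  move=> i e e0; have e3 : 0 < e / C i / 3%:R by rewrite !divr_gt0.
  have [M1 h1] := uc _ e3; have [M2 h2] := small _ e3.
  exists (maxn M1 M2) => m n; rewrite !geq_max => /andP[m1 m2] /andP[n1 n2].
  have := hC i (fun j => q m j - q n j); rewrite scalerBl => /le_lt_trans; apply.
  rewrite mulrC -ltr_pdivlMr //.
  have -> : \sum_j (q m j - q n j) *: c j =
      (u m - u n) - (u m - \sum_j q m j *: c j) + (u n - \sum_j q n j *: c j).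
    under eq_bigr do rewrite scalerBl.
    by rewrite sumrB; ring.
  apply: (le_lt_trans (absD va _ _)); apply: (le_lt_trans (lerD (absD va _ _) (lexx _))).
  rewrite (absN va); have := h1 _ _ m1 n1; have := lt_trans (hq' m) (h2 _ m2).
  have := lt_trans (hq' n) (h2 _ n2); lra.
move=> e /small [M hM]; exists M => n /hM h; exact: lt_trans (hq' n) h.
Qed.

End LocalDegree.

(** The invertible matrix of the [phi j (t ^+ i)] is approximated by [A *m E], where [A] is rational
    with only [d] columns. If [d < m], some nonzero row vector is killed by [A], hence reproduced by
    [(X - A *m E) *m Y], whose entries are too small for that. *)
Lemma local_basis_ge (R : realType) (K : fieldExtType rat) (v : K -> R) (V : algC -> R)
    m d (phi : 'I_m -> {rmorphism K -> algC}) (t : K) (e : 'I_d -> nat -> K) :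
  is_abs V -> injective (fun j => phi j t) -> (forall j x, V (phi j x) = v x) ->
  local_basis v e -> (m <= d)%N.
Proof.
move=> Va tinj Vphi [_ _ espan]; rewrite leqNgt; apply/negP => dm.
have m0 : (0 < m)%N by apply: leq_ltn_trans dm.
pose j0 := Ordinal m0.
have v0 : v 0 = 0 by rewrite -(Vphi j0) rmorph0 (abs0 Va).
pose X := \matrix_(i < m, j < m) phi j (t ^+ i).
have Xu : X \in unitmx.
  rewrite unitmxE unitfE; have -> : X = Vandermonde m (\row_j phi j t).
    by apply/matrixP => i j; rewrite !mxE rmorphXn.
  rewrite det_Vandermonde; apply/prodf_neq0 => i _; apply/prodf_neq0 => j ij.
  by rewrite !mxE subr_eq0; apply/eqP => /tinj h; rewrite h ltnn in ij.
pose Y := invmx X; pose M := \sum_l \sum_j V (Y l j).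
have M0 : 0 <= M by apply: sumr_ge0 => l _; apply: sumr_ge0 => j _; apply: (abs_ge0 Va).
pose dl := (M + 1)^-1.
have dl0 : 0 < dl by rewrite invr_gt0 ltr_wpDl.
have happ (i : 'I_m) : exists a : 'I_d -> nat -> rat, exists Ni, forall n, (Ni <= n)%N ->
    v (t ^+ i - \sum_l a l n *: e l n) < dl.
  have [|a _ na] := espan (fun=> t ^+ i).
    by move=> eps eps0; exists 0%N => m1 n1 _ _; rewrite subrr v0.
  by exists a; have [Ni h] := na _ dl0; exists Ni.
pose a i := sval (cid (happ i)).
have ha (i : 'I_m) : exists Ni, forall n, (Ni <= n)%N ->
    v (t ^+ i - \sum_l a i l n *: e l n) < dl by rewrite /a; case: cid.
pose Nf i := sval (cid (ha i)); pose n := (\max_i Nf i)%N.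
have hn (i : 'I_m) : v (t ^+ i - \sum_l a i l n *: e l n) < dl.
  by rewrite /n; have := leq_bigmax i (F := Nf); rewrite {1}/Nf; case: cid => Ni h /= /h.
pose A := \matrix_(i, l) (ratr (a i l n) : algC).
pose E := \matrix_(l, j) phi j (e l n).
pose Dl := X - A *m E.
have VD i j : V (Dl i j) < dl.
  have -> : Dl i j = phi j (t ^+ i - \sum_l a i l n *: e l n).
    rewrite !mxE rmorphB rmorph_sum; congr (_ - _); apply: eq_bigr => l _.
    by rewrite !mxE /= rmorphZ_num.
  by rewrite Vphi.
have [u u0 uA] : exists2 u : 'rV_m, u != 0 & u *m A = 0.
  have : kermx A != 0.
    rewrite kermx_eq0 /row_free neq_ltn; apply/orP; left.
    exact: leq_ltn_trans (rank_leq_col A) dm.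
  move=> /rowV0Pn [u us u0]; exists u => //; exact/sub_kermxP.
have eu : u = u *m Dl *m Y.
  by rewrite /Dl mulmxBr mulmxA uA mul0mx subr0 /Y mulmxK.
pose S := \sum_j V (u 0 j).
have S0 : 0 < S.
  have [j uj] : exists j, u 0 j != 0.
    apply: contrapT => hn0; case/eqP: u0; apply/rowP => j; rewrite mxE.
    by apply: contrapT => /eqP h; apply: hn0; exists j.
  rewrite /S (bigD1 j) //=; apply: ltr_pwDl; first by rewrite (abs_gt0 Va).
  by apply: sumr_ge0 => k _; apply: (abs_ge0 Va).
have : S <= S * dl * M.
  have hj j : V (u 0 j) <= \sum_l (S * dl) * V (Y l j).
    rewrite {1}eu mxE; apply: (le_trans (abs_sum Va _ _ _)); apply: ler_sum => l _.
    rewrite (absM Va); apply: ler_wpM2r; first exact: (abs_ge0 Va).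
    rewrite mxE; apply: (le_trans (abs_sum Va _ _ _)); rewrite /S mulr_suml.
    apply: ler_sum => i _; rewrite (absM Va); apply: ler_wpM2l; first exact: (abs_ge0 Va).
    exact: ltW.
  rewrite {1}/S; apply: (le_trans (ler_sum _ (fun j _ => hj j))).
  by rewrite exchange_big /= /M mulr_sumr; apply: ler_sum => l _; rewrite mulr_sumr.
rewrite leNgt => /negP; apply; rewrite -mulrA gtr_pMr //.
by rewrite /dl mulrC ltr_pdivrMr ?mul1r ?ltrDl // ltr_wpDl.
Qed.

(** * Weak approximation and the finiteness of the places above a rational one *)

Section WeakApproximation.
Variables (R : realType) (K : fieldExtType rat) (w : rat -> R).
Hypothesis w_gt1 : exists c, 1 < w c.

Definition abs_over (v : K -> R) := is_abs v /\ forall q : rat, v q%:A = w q.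

Lemma eventually_all (T : eqType) (s : seq T) (P : T -> nat -> Prop) :
  (forall u, u \in s -> exists M, forall n, (M <= n)%N -> P u n) ->
  exists M, forall n, (M <= n)%N -> forall u, u \in s -> P u n.
Proof.
elim: s => [|a s IH] h; first by exists 0%N.
have [M1 h1] := h a (mem_head _ _).
have [|M2 h2] := IH; first by move=> u us; apply: h; rewrite inE us orbT.
exists (maxn M1 M2) => n; rewrite geq_max => /andP[n1 n2] u; rewrite inE => /predU1P[->|us].
  exact: h1.
exact: h2.
Qed.

Lemma power_between (g a b : R) : 1 < g -> 0 < a -> g * a < b ->
  exists k : int, a < g ^ k <= b.
Proof.
move=> g1 a0 ab.
have g0 : 0 < g by apply: lt_trans g1.
have [n0 hn0] := exprn_unbounded a^-1 g1.
have lo : g ^ (- n0%:Z) < a.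
  by rewrite -exprnN -[ltRHS]invrK ltf_pV2 ?posrE ?invr_gt0 ?exprn_gt0 ?hn0.
have [m hm] : exists m, a < g ^ (m%:Z - n0%:Z).
  have [m hm] := exprn_unbounded (a * g ^+ n0) g1; exists m.
  by rewrite expfzDr ?gt_eqF // -exprnN -exprnP ltr_pdivlMr ?exprn_gt0 // hm.
have [k hk kmin] := ex_minnP (ex_intro (fun m : nat => a < g ^ (m%:Z - n0%:Z)) m hm).
exists (k%:Z - n0%:Z); rewrite hk /=.
case: k hk kmin => [|k] hk kmin; first by move: hk; rewrite sub0r ltNge (ltW lo).
have : g ^ (k%:Z - n0%:Z) <= a.
  by rewrite leNgt; apply/negP => /kmin; rewrite ltnn.
have -> : k.+1%:Z - n0%:Z = (k%:Z - n0%:Z) + 1 by rewrite -addn1 PoszD; ring.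
have -> : g ^ (k%:Z - n0%:Z + 1) = g ^ (k%:Z - n0%:Z) * g by rewrite expfzDr ?gt_eqF.
move=> h; apply: ltW; apply: le_lt_trans ab.
by rewrite mulrC ler_pM2l.
Qed.

(** For large [n] the quotient of [u x ^+ n] by [v x ^+ n] exceeds [w c], so a power of the rational
    [c], on which [v] and [u] agree, fits in between. *)
Lemma abs_separate1 v u x : abs_over v -> abs_over u -> v x < u x ->
  exists a, v a < 1 /\ 1 <= u a.
Proof.
move=> [va vw] [ua uw] lt; have [c c1] := w_gt1.
have ux : 0 < u x by apply: le_lt_trans lt; apply: (abs_ge0 va).
have x0 : x != 0 by rewrite -(abs_gt0 ua).
have vx : 0 < v x by rewrite (abs_gt0 va).
have [|n hn] := @exprn_unbounded R (u x / v x) (w c).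
  by rewrite ltr_pdivlMr // mul1r.
have [|k /andP[k1 k2]] := @power_between (w c) (v x ^+ n) (u x ^+ n) c1 (exprn_gt0 n vx).
  by rewrite -ltr_pdivlMr ?exprn_gt0 // -expr_div_n hn.
have c0 : c%:A != 0 :> K.
  by rewrite -(abs_gt0 va) vw; apply: lt_trans c1.
have absz y (abs : K -> R) : is_abs abs -> abs y != 0 -> abs (y ^ k) = abs y ^ k.
  by move=> ha _; case: (k) => j; rewrite ?NegzE -?exprnP -?exprnN ?(absV ha) (absX ha).
exists (x ^+ n / c%:A ^ k); rewrite (absM va) (absM ua) (absV va) (absV ua) (absX va) (absX ua).
rewrite !absz ?(abs_eq0 va) ?(abs_eq0 ua) // vw uw.
have ck : 0 < w c ^ k by rewrite exprz_gt0 // (lt_trans _ c1).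
by rewrite ltr_pdivrMr // mul1r ler_pdivlMr // mul1r.
Qed.

Lemma abs_separate2 v u : abs_over v -> abs_over u -> v <> u ->
  exists x, 1 < v x /\ u x < 1.
Proof.
move=> vo uo neq.
have [x hx] : exists x, v x < u x.
  apply: contrapT => hn; apply: neq; apply/funext => x.
  have le y : u y <= v y by rewrite leNgt; apply/negP => h; apply: hn; exists y.
  have [va _] := vo; have [ua _] := uo.
  have [->|x0] := eqVneq x 0; first by rewrite (abs0 va) (abs0 ua).
  apply/eqP; rewrite eq_le le andbT; have := le x^-1.
  by rewrite (absV va) (absV ua) lef_pV2 // posrE ?(abs_gt0 va) ?(abs_gt0 ua).
have [va vw] := vo; have [ua uw] := uo.
have ux : 0 < u x by apply: le_lt_trans hx; apply: (abs_ge0 va).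
have x0 : x != 0 by rewrite -(abs_gt0 ua).
have [a [a1 a2]] := abs_separate1 vo uo hx.
have [|b [b1 b2]] := @abs_separate1 u v x^-1 uo vo.
  by rewrite (absV va) (absV ua) ltf_pV2 // posrE (abs_gt0 va).
have a0 : a != 0 by rewrite -(abs_gt0 ua) (lt_le_trans _ a2).
exists (b / a); rewrite (absM va) (absM ua) (absV va) (absV ua).
rewrite ltr_pdivlMr ?(abs_gt0 va) // mul1r (lt_le_trans a1) //; split=> //.
by rewrite ltr_pdivrMr ?(abs_gt0 ua) // mul1r (lt_le_trans b1).
Qed.

(** Induction of Artin and Whaples: an element [z] that works for [s] is corrected by an element [y]
    separating [v] from [u]. If [u z] is at most 1, [z ^+ n * y] works for large [n]; otherwise
    [z ^+ n / (1 + z ^+ n) * y] does, since its first factor tends to 1 at [v] and [u] and to 0 on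
    [s]. *)
Lemma abs_separate v (s : seq (K -> R)) : abs_over v ->
  (forall u, u \in s -> abs_over u /\ u <> v) ->
  exists x, 1 < v x /\ forall u, u \in s -> u x < 1.
Proof.
move=> vo; have [va vw] := vo; elim: s => [|u s IH] hs.
  by have [c c1] := w_gt1; exists c%:A; rewrite vw.
have [|z [z1 zs]] := IH; first by move=> u' us; apply: hs; rewrite inE us orbT.
have [uo uv] := hs u (mem_head _ _); have [ua uw] := uo.
have [y [y1 yu]] : exists y, 1 < v y /\ u y < 1 by apply: abs_separate2 => // e; apply: uv.
have so u' : u' \in s -> is_abs u' by move=> us; have [[]] := hs u' (@mem_behead _ (u :: s) _ us).
have [uz|uz] := leP (u z) 1.
  have [M hM] : exists M, forall n, (M <= n)%N -> forall u', u' \in s -> u' (z ^+ n * y) < 1.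
    apply: (eventually_all (P := fun u' n => u' (z ^+ n * y) < 1)) => u' us; have u'a := so _ us.
    have [||M hM] := @geometric_small R (u' z) (u' y + 1)^-1.
    - by rewrite (abs_ge0 u'a) zs.
    - by rewrite invr_gt0 ltr_wpDl // (abs_ge0 u'a).
    exists M => n /hM; rewrite -[ltRHS]mul1r ltr_pdivlMr ?ltr_wpDl ?(abs_ge0 u'a) //.
    rewrite (absM u'a) (absX u'a); apply: le_lt_trans.
    by rewrite ler_wpM2l ?exprn_ge0 ?(abs_ge0 u'a) // lerDl.
  exists (z ^+ M * y); split.
    rewrite (absM va) (absX va); apply: (lt_le_trans y1); rewrite ler_peMl ?(abs_ge0 va) //.
    by rewrite exprn_ege1 // ltW.
  move=> u'; rewrite inE => /predU1P [->|us]; last exact: hM.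
  rewrite (absM ua) (absX ua); apply: le_lt_trans yu; rewrite ler_piMl ?(abs_ge0 ua) //.
  by rewrite exprn_ile1 // (abs_ge0 ua).
have [M1 h1] := exprn_unbounded (v y - 1)^-1 z1.
have [M2 h2] := exprn_unbounded (1 - u y)^-1 uz.
have [M3 h3] : exists M, forall n, (M <= n)%N -> forall u', u' \in s ->
    u' z ^+ n * (1 + u' y) < 1.
  apply: (eventually_all (P := fun u' n => u' z ^+ n * (1 + u' y) < 1)) => u' us; have u'a := so _ us.
  have [||M hM] := @geometric_small R (u' z) (1 + u' y)^-1.
  - by rewrite (abs_ge0 u'a) zs.
  - by rewrite invr_gt0 ltr_pwDl // (abs_ge0 u'a).
  by exists M => n /hM; rewrite -[ltRHS]mul1r ltr_pdivlMr // ltr_pwDl // (abs_ge0 u'a).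
pose n := (maxn M1 (maxn M2 M3)).+1.
have n1 : (M1 <= n)%N by rewrite leqW // leq_max leqnn.
have n2 : (M2 <= n)%N by rewrite leqW // !leq_max leqnn /= orbT.
have n3 : (M3 <= n)%N by rewrite leqW // !leq_max leqnn !orbT.
pose Z := z ^+ n.
have vy1 : 0 < v y - 1 by rewrite subr_gt0.
have uy1 : 0 < 1 - u y by rewrite subr_gt0.
have vZ : 1 < v Z * (v y - 1) by rewrite -ltr_pdivrMr // div1r (absX va) h1.
have uZ : 1 < u Z * (1 - u y) by rewrite -ltr_pdivrMr // div1r (absX ua) h2.
have up (abs : K -> R) : is_abs abs -> abs (1 + Z) <= 1 + abs Z.
  by move=> ha; apply: (le_trans (absD ha _ _)); rewrite (abs1 ha).
have dn1 (abs : K -> R) : is_abs abs -> abs Z - 1 <= abs (1 + Z).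
  move=> ha; rewrite lerBlDr -[Z in leLHS](addrK 1 Z) [Z + 1]addrC.
  by apply: (le_trans (absD ha _ _)); rewrite (absN ha) (abs1 ha).
have dn2 (abs : K -> R) : is_abs abs -> 1 - abs Z <= abs (1 + Z).
  move=> ha; rewrite lerBlDr -(abs1 ha) -[X in abs X <= _](addrK Z 1).
  by apply: (le_trans (absD ha _ _)); rewrite (absN ha).
have vZ1 : 1 < v Z by rewrite (absX va) exprn_egt1.
have nz : 1 + Z != 0.
  by rewrite -(abs_gt0 va); apply: lt_le_trans (dn1 _ va); rewrite subr_gt0.
exists (Z / (1 + Z) * y); split.
  rewrite !(absM va) (absV va) mulrAC ltr_pdivlMr ?(abs_gt0 va) // mul1r.
  by apply: le_lt_trans (up _ va) _; move: vZ; rewrite mulrBr mulr1; lra.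
move=> u'; rewrite inE => /predU1P [->|us].
  rewrite !(absM ua) (absV ua) mulrAC ltr_pdivrMr ?(abs_gt0 ua) // mul1r.
  by apply: lt_le_trans (dn1 _ ua); move: uZ; rewrite mulrBr mulr1; lra.
have u'a := so _ us.
rewrite !(absM u'a) (absV u'a) mulrAC ltr_pdivrMr ?(abs_gt0 u'a) // mul1r.
apply: lt_le_trans (dn2 _ u'a); have := h3 n n3 u' us.
by rewrite -(absX u'a) -/Z mulrDr mulr1; lra.
Qed.

(** High powers of elements separating each [v i] from the others are linearly independent: in a
    relation, the term whose coefficient has the largest value dominates at its own place. *)
Lemma abs_over_card (m : nat) (v : 'I_m -> K -> R) : injective v ->
  (forall i, abs_over (v i)) -> (m <= \dim {:K})%N.
Proof.
move=> vinj vo.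
have sep i : exists x, 1 < v i x /\ forall j, j != i -> v j x < 1.
  have [|x [x1 xs]] := @abs_separate (v i) [seq v j | j <- enum 'I_m & j != i] (vo i).
    move=> u /mapP [j jm ->]; move: jm; rewrite mem_filter => /andP[ji _]; split; first exact: vo.
    by move=> /vinj e; rewrite e eqxx in ji.
  exists x; split=> // j ji; apply: xs; apply/mapP; exists j => //.
  by rewrite mem_filter ji mem_enum.
pose x i := sval (cid (sep i)).
have x1 i : 1 < v i (x i) by rewrite /x; case: cid => y [].
have xs i j : j != i -> v j (x i) < 1 by rewrite /x; case: cid => y /= h; case: h => _; apply.
have [k hk] : exists k, forall n, (k <= n)%N -> forall ij, ij \in enum {: 'I_m * 'I_m} ->
    ij.1 != ij.2 -> v ij.1 (x ij.2) ^+ n < m%:R^-1.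
  apply: (eventually_all (P := fun ij n => ij.1 != ij.2 -> v ij.1 (x ij.2) ^+ n < m%:R^-1)).
  move=> [i j] _ /=; have [<-|ij] := eqVneq i j; first by exists 0%N.
  have m0 : (0 < m)%N by apply: leq_ltn_trans (ltn_ord i).
  have [va _] := vo i.
  have [||M hM] := @geometric_small R (v i (x j)) m%:R^-1.
  - by rewrite (abs_ge0 va) xs.
  - by rewrite invr_gt0 ltr0n.
  by exists M => n /hM.
pose X := [tuple x i ^+ k | i < m].
have Xfree : free X.
  apply/freeP => q q0 i; apply: contrapT => /eqP qi0.
  have [va0 vw0] := vo i.
  have m0 : (0 < m)%N by apply: leq_ltn_trans (ltn_ord i).
  have [j _ jmax] := @arg_maxP _ _ _ i xpredT (fun j => w (q j)) isT.
  have [va vw] := vo j.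
  have wj : 0 < w (q j).
    apply: lt_le_trans (jmax i isT); rewrite -vw0 (abs_gt0 va0).
    by rewrite -in_algE fmorph_eq0.
  have : q j *: x j ^+ k = - \sum_(i | i != j) q i *: x i ^+ k.
    apply/eqP; rewrite -addr_eq0; apply/eqP; rewrite -[RHS]q0 [RHS](bigD1 j) //.
    have xe (l : 'I_m) : X`_l = x l ^+ k by rewrite -tnth_nth tnth_mktuple.
    by rewrite xe; congr (_ + _); apply: eq_bigr => l _; rewrite xe.
  move=> /(congr1 (v j)); rewrite (absN va) (absZ va) vw (absX va) => e.
  have : w (q j) <= w (q j) * \sum_(l | l != j) v j (x l) ^+ k.
    apply: (@le_trans _ _ (w (q j) * v j (x j) ^+ k)).
      by apply: ler_peMr; [apply: ltW|rewrite exprn_ege1 // ltW].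
    rewrite e; apply: (le_trans (abs_sum va _ _ _)); rewrite mulr_sumr; apply: ler_sum => l _.
    by rewrite (absZ va) vw (absX va) ler_wpM2r ?exprn_ge0 ?(abs_ge0 va) //; apply: jmax.
  rewrite leNgt => /negP; apply; rewrite gtr_pMr //.
  have hl l : l != j -> v j (x l) ^+ k < m%:R^-1.
    by move=> lj; apply: (hk k (leqnn k) (j, l)) => /=; rewrite ?mem_enum // eq_sym.
  apply: (@lt_le_trans _ _ (\sum_(l < m) m%:R^-1)); last first.
    by rewrite sumr_const card_ord -[leLHS]mulr_natr mulVf ?pnatr_eq0 -?lt0n.
  rewrite [ltRHS](bigD1 j) //=; apply: (@le_lt_trans _ _ (\sum_(l < m | l != j) m%:R^-1)).
    by apply: ler_sum => l lj; apply/ltW/hl.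
  by rewrite ltrDr invr_gt0 ltr0n.
have := dimvS (subvf <<X>>%VS); move/eqP: Xfree => ->.
by rewrite size_tuple.
Qed.

Lemma finite_abs_over : finite_set [set v : K -> R | abs_over v].
Proof.
apply: contrapT => /(infinite_set_fset (\dim {:K}).+1) [B Bs Bn].
pose v (i : 'I_(size (finmap.enum_fset B))) := nth (fun=> 0) (finmap.enum_fset B) i.
have : (size (finmap.enum_fset B) <= \dim {:K})%N.
  apply: (@abs_over_card _ v) => [i j|i].
    move=> /eqP; rewrite nth_uniq ?finmap.fset_uniq // => /eqP; exact: val_inj.
  by apply: Bs; apply: mem_nth.
by rewrite leqNgt Bn.
Qed.

End WeakApproximation.

(** * The height bounded below by a product over embeddings *)

Section PlaceSupport.
Variable R : realType.

Lemma rat_abs_gt1 l : rat_place l -> exists c, 1 < rat_abs R l c.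
Proof.
case: l => [p|] /= pp; last by exists 2%:R; rewrite ratr_nat normr_nat ltr1n.
exists p%:R^-1; have va := @algC_absP R (Some p) pp.
rewrite -[padic_abs R p _]/(rat_abs R (Some p) _) -algC_abs_rat // fmorphV /= ratr_nat.
by rewrite (absV va) padic_abs_p // invrK ltr1n prime_gt1.
Qed.

Lemma rat_abs_inj l l' : rat_place l -> rat_place l' -> rat_abs R l =1 rat_abs R l' -> l = l'.
Proof.
have small p q : prime p -> rat_abs R (Some q) p%:R != 1 -> prime q -> p = q.
  move=> pp h pq; apply: contrapT => pq'; case/negP: h.
  rewrite /= /padic_abs pnatr_eq0 gtn_eqF ?prime_gt0 //.
  have -> : numq p%:R = p by rewrite -[p%:R]/(p%:Z%:~R) numq_int.
  have -> : denq p%:R = 1 by rewrite -[p%:R]/(p%:Z%:~R) denq_int.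
  have qp : (q == p) = false by apply/eqP => e; apply: pq'.
  by rewrite /= logn1 logn_prime // qp subrr expr0z.
have pabs p : prime p -> rat_abs R (Some p) p%:R < 1.
  move=> pp; rewrite -algC_abs_rat // ratr_nat padic_abs_p // invf_lt1 ?ltr1n ?prime_gt1 //.
  by rewrite ltr0n prime_gt0.
have oo p : rat_abs R None p%:R = p%:R by rewrite /= ratr_nat normr_nat.
case: l l' => [p|] [q|] //= pp pq h.
- by congr Some; apply: small => //; rewrite -[rat_abs _ _ _]h lt_eqF // pabs.
- have := pabs p pp; rewrite h oo ltNge.
  by rewrite ler1n prime_gt0.
- have := pabs q pq; rewrite -h oo ltNge.
  by rewrite ler1n prime_gt0.
Qed.

Lemma padic_abs_le1 p (q : rat) : ~~ (p %| `|denq q|)%N -> padic_abs R p q <= 1.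
Proof.
move=> pq; rewrite /padic_abs; case: eqP => // _.
rewrite [logn p `|denq q|]lognE (negPf pq) !andbF sub0r -exprnN.
case: p pq => [|p] _; first by rewrite lognE /= expr0 invr1.
by rewrite invf_le1 ?exprn_gt0 ?ltr0n // exprn_ege1 // ler1n.
Qed.

Variable K : fieldExtType rat.

Lemma placesP (v : K -> R) : @places R K v <->
  exists2 l, rat_place l & abs_over (rat_abs R l) v.
Proof.
split=> [[va [h|[p pp h]]]|[[p|] /= pl [va h]]].
- by exists None.
- by exists (Some p).
- by split=> //; right; exists p.
- by split=> //; left.
Qed.

(** Such a [v] is archimedean or lies over a prime dividing a denominator of the minimal polynomial
    of [x]. *)
Lemma finite_places_gt1 (x : K) : finite_set [set v | @places R K v /\ 1 < v x].
Proof.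
have /polyOver1P [P eP] := minPolyOver 1 x.
have Pm : map_poly (in_alg K) P \is monic by rewrite -eP monic_minPoly.
have Px : root (map_poly (in_alg K) P) x by rewrite -eP root_minPoly.
pose S := None :: [seq Some p | p <- flatten [seq primes `|denq P`_i| | i <- iota 0 (size P)]].
apply: (@sub_finite_set _ _ (\bigcup_(l in [set` S]) [set v : K -> R | abs_over (rat_abs R l) v /\ rat_place l])).
  move=> v [/placesP [l pl vo] vx]; exists l => //=.
  case: l pl vo => [p|] pl [va vo]; last by rewrite inE eqxx.
  rewrite inE /=; apply: contraT => pS; move: vx; rewrite ltNge => /negP; case.
  apply: (abs_integral_le1 va _ Pm _ Px).
    apply: ultra_of_nat => // n.
    have -> : n%:R = (n%:R : rat)%:A :> K by have := alg_int K n; rewrite -!pmulrn => ->.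
    rewrite vo; apply: padic_abs_le1.
    rewrite -[n%:R]/(n%:Z%:~R) denq_int /= dvdn1; apply/eqP => p1.
    by move: pl; rewrite p1.
  move=> i; rewrite coef_map /= vo; apply: padic_abs_le1; apply: contra pS => pd.
  apply/mapP; exists p => //; apply/flatten_mapP; exists i.
    rewrite mem_iota /= ltnNge; apply: contraTN pd => /(nth_default 0) ->.
    by rewrite (_ : denq 0 = 1) //= dvdn1; apply/eqP => p1; move: pl; rewrite p1.
  by rewrite mem_primes (pl : prime p) pd absz_gt0 denq_neq0.
apply: bigcup_finite; first exact: finite_seq.
move=> l _; have [pl|npl] := boolP (rat_place l); last first.
  by apply: (@sub_finite_set _ _ set0) => // v [].
by apply: sub_finite_set (finite_abs_over K (rat_abs_gt1 pl)) => v [].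
Qed.

Lemma local_degree_ge m (phi : 'I_m -> {rmorphism K -> algC}) (t : K) (v : K -> R) (V : algC -> R) :
  @places R K v -> is_abs V -> injective (fun j => phi j t) ->
  (forall j x, V (phi j x) = v x) -> (m <= local_degree v)%N.
Proof.
move=> /placesP [l _ [va _]] Va tinj Vphi.
rewrite /local_degree; case: xgetP => [d _ [e he]|hn].
  exact: (local_basis_ge Va tinj Vphi he).
(* Rules out the default value 0 of [local_degree]. *)
have [d [e he]] := local_basis_exists va.
by case: (hn d); exists e.
Qed.

Lemma emb_primitive : exists t : K, injective (fun k => emb k t).
Proof.
by have [t tgen] := primitive_element_exists K; exists t; apply: emb_generator_inj.
Qed.

Definition emb_place (l : option nat) (k : 'I_(\dim {:K})) : K -> R :=
  fun y => algC_abs R l (emb k y).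

Lemma emb_place_over l k : rat_place l -> abs_over (rat_abs R l) (emb_place l k).
Proof.
move=> pl; have va := algC_absP R pl; split; last first.
  by move=> q; rewrite /emb_place emb_alg algC_abs_rat.
split=> [x|x|x y|x y]; rewrite /emb_place.
- exact: abs_ge0 va _.
- by split=> [/eqP|->]; [rewrite (abs_eq0 va) fmorph_eq0 => /eqP|rewrite rmorph0 (abs0 va)].
- by rewrite rmorphM (absM va).
- by rewrite rmorphD (absD va).
Qed.

(** This one-sided estimate is enough to bound heights from below, so local degrees are never
    computed exactly. *)
Lemma count_emb_place (L : seq (option nat)) (v : K -> R) : uniq L ->
  (forall l, l \in L -> rat_place l) ->
  (count_mem v [seq emb_place l k | l <- L, k <- enum 'I_(\dim {:K})] <= local_degree v)%N.
Proof.
move=> uL Lp.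
have [/allpairsP [[l k] /= [lL _ ev]]|vP] := boolP (v \in [seq emb_place l k | l <- L, k <- enum 'I_(\dim {:K})]);
  last by rewrite (count_memPn vP).
have vp : @places R K v by apply/placesP; exists l; rewrite ?ev; [apply: Lp|apply: emb_place_over; apply: Lp].
pose J := [seq j <- enum 'I_(\dim {:K}) | emb_place l j == v].
have cJ : count_mem v [seq emb_place l k | l <- L, k <- enum 'I_(\dim {:K})] = size J.
  rewrite count_flatten sumnE !big_map (bigD1_seq l) //= big1_seq ?addn0.
    by rewrite count_map size_filter; apply: eq_count.
  move=> l' /andP[ll' l'L]; apply/count_memPn/mapP => -[k' _ ev'].
  case/eqP: ll'; apply: rat_abs_inj; rewrite ?Lp // => q.
  have [_ h] := emb_place_over k (Lp _ lL); have [_ h'] := emb_place_over k' (Lp _ l'L).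
  by rewrite -h -h' -ev -ev'.
rewrite cJ; have [t tinj] := emb_primitive.
apply: (@local_degree_ge _ (fun i => emb (tnth (in_tuple J) i)) t v (algC_abs R l)) => //.
- exact: algC_absP (Lp _ lL).
- move=> i j /tinj /eqP; rewrite !(tnth_nth k) nth_uniq //; first by move=> /eqP; apply: val_inj.
  exact: filter_uniq (enum_uniq _).
- move=> i y; have : tnth (in_tuple J) i \in J by apply: mem_tnth.
  by rewrite mem_filter => /andP[/eqP <- _].
Qed.

(** Grouping the embeddings by the place they induce gives at most [local_degree v] copies of each
    [v]; all factors are at least 1, so further places and larger exponents only help. *)
Theorem height_in_ge (L : seq (option nat)) (x : K) : uniq L ->
  (forall l, l \in L -> rat_place l) ->
  \prod_(l <- L) \prod_k Num.max 1 (algC_abs R l (emb k x)) <= height_in R x ^+ \dim {:K}.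
Proof.
move=> uL Lp; pose n := \dim {:K}.
have n0 : (0 < n)%N by rewrite /n lt0n dimv_eq0 -subv0; apply/negP => /subvP/(_ 1 (memvf 1)); rewrite memv0 oner_eq0.
pose f (v : K -> R) := Num.max 1 (v x) `^ ((local_degree v)%:R / n%:R).
pose P := [seq emb_place l k | l <- L, k <- enum 'I_(\dim {:K})].
have m1 (v : K -> R) : 1 <= Num.max 1 (v x) by rewrite le_max lexx.
have f1 v : 1 <= f v.
  have : Num.max 1 (v x) `^ 0 <= f v by apply: ler_powR => //; rewrite divr_ge0.
  by rewrite powRr0.
have Pplaces v : v \in P -> @places R K v.
  move=> /allpairsP [[l k] /= [lL _ ->]]; apply/placesP; exists l; first exact: Lp.
  exact: emb_place_over (Lp _ lL).
have /finite_seqP [s es] := finite_places_gt1 x.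
(* A finite list containing [P] and every place at which the factor of the height differs from 1. *)
pose r := undup (P ++ [seq v <- s | `[< @places R K v >]]).
have rplaces v : v \in r -> @places R K v.
  by rewrite mem_undup mem_cat => /orP[/Pplaces //|]; rewrite mem_filter => /andP[/asboolP].
have hr : height_in R x = \prod_(v <- r) f v.
  rewrite /height_in (@fsbigE _ _ _ _ _ r); first last.
  - move=> v vp; rewrite mem_undup mem_cat negb_or => /andP[_].
    rewrite mem_filter asboolT //= => vs; have : ~ (1 < v x).
      by move=> v1; have : [set v | @places R K v /\ 1 < v x] v by []; rewrite es /= (negPf vs).
    by move=> /negP; rewrite -leNgt => /max_idPl ->; rewrite powR1.
  - by move=> v /=; apply: rplaces.
  - exact: undup_uniq.
  rewrite [LHS]big_seq_cond [RHS]big_seq; apply: eq_bigl => v.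
  by case vr: (v \in r) => //=; apply/mem_set/rplaces.
have undP : \prod_(v <- undup P) f v <= \prod_(v <- r) f v.
  rewrite [leRHS](bigID (fun v => v \in P)) /=.
  have -> : \prod_(v <- r | v \in P) f v = \prod_(v <- undup P) f v.
    rewrite -big_filter; apply: perm_big; apply: uniq_perm; rewrite ?filter_uniq ?undup_uniq //.
    by move=> v; rewrite mem_filter !mem_undup mem_cat; case: (v \in P).
  rewrite ler_peMr //; first by apply: prodr_ge0 => v _; apply: le_trans (f1 v).
  by elim/big_ind: _ => // a b a1 b1; rewrite -[1]mulr1 ler_pM ?ler01.
have -> : \prod_(l <- L) \prod_k Num.max 1 (algC_abs R l (emb k x)) = \prod_(v <- P) Num.max 1 (v x).
  rewrite big_allpairs_dep; apply: eq_bigr => l _.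
  by rewrite big_enum.
rewrite hr; apply: (@le_trans _ _ ((\prod_(v <- undup P) f v) ^+ n)); last first.
  by apply: lerXn2r => //; rewrite nnegrE; apply: prodr_ge0 => v _; apply: le_trans (f1 v).
rewrite -prodrXl -big_undup_iterop_count /=.
apply: ler_prod => v _; rewrite -[iterop _ _ _ _]/(Num.max 1 (v x) ^+ count_mem v P).
rewrite exprn_ge0 ?(le_trans ler01) //=.
have -> : f v ^+ n = Num.max 1 (v x) ^+ local_degree v.
  rewrite -!powR_mulrn ?powR_ge0 ?(le_trans ler01 (m1 v)) // /f -powRrM divfK //.
  by rewrite pnatr_eq0 -lt0n.
by apply: ler_weXn2l => //; apply: count_emb_place.
Qed.

End PlaceSupport.

(** * Tamely ramified elements *)

Section TameValues.
Variables (R : realType) (E : fieldType) (W : E -> R) (p : nat).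
Hypotheses (Wa : is_abs W) (Wu : ultrametric W) (p1 : (1 < p)%N).

Let pR0 : 0 < p%:R :> R. Proof. by rewrite ltr0n ltnW. Qed.
Let pR1 : 1 < p%:R :> R. Proof. by rewrite ltr1n. Qed.

Definition integral_value x := exists k : int, W x = p%:R ^ k.

Lemma ultra_sum_lt I (r : seq I) (P : pred I) (F : I -> E) (M : R) : 0 < M ->
  (forall i, P i -> W (F i) < M) -> W (\sum_(i <- r | P i) F i) < M.
Proof.
move=> M0 h; elim/big_ind: _ => // [|x y hx hy]; first by rewrite (abs0 Wa).
by apply: (le_lt_trans (Wu _ _)); rewrite gt_max hx.
Qed.

Lemma ultra_sum_ge (I : finType) (F : I -> E) :
  (forall i j, F i != 0 -> F j != 0 -> W (F i) = W (F j) -> i = j) ->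
  forall i, W (F i) <= W (\sum_i F i).
Proof.
move=> inj i; have [m _ mmax] := @arg_maxP _ _ _ i xpredT (fun j => W (F j)) isT.
apply: (le_trans (mmax i isT)); have [m0|m0] := eqVneq (F m) 0.
  by rewrite m0 (abs0 Wa) (abs_ge0 Wa).
rewrite (bigD1 m) //= addrC (ultra_lt Wa Wu) //.
apply: ultra_sum_lt; first by rewrite (abs_gt0 Wa).
move=> j jm; have le : W (F j) <= W (F m) := mmax j isT.
rewrite lt_neqAle le andbT; apply/eqP => e.
have [j0|j0] := eqVneq (F j) 0.
  by move: e; rewrite j0 (abs0 Wa) => /esym/eqP; rewrite (abs_eq0 Wa) (negPf m0).
by move: jm; rewrite (inj j m) ?eqxx.
Qed.

Lemma exprz_inj (i j : int) : p%:R ^ i = p%:R ^ j :> R -> i = j.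
Proof.
wlog ij : i j / i <= j => [th|].
  by have /orP[/th //|/th h /esym/h] := le_total i j.
move=> e; have [k ek] : exists k : nat, j = i + k%:Z.
  by exists `|j - i|%N; lia.
move: e; rewrite ek expfzDr ?gt_eqF // -[LHS]mulr1 => /mulfI; rewrite expfz_neq0 ?gt_eqF //.
move=> /(_ isT) /eqP; case: k ek => [|k] _; first by rewrite addr0.
by rewrite lt_eqF // -exprnP exprn_egt1.
Qed.

Lemma exprz_le1 (i : int) : (p%:R ^ i <= 1 :> R) = (i <= 0).
Proof.
case: i => [[|k]|k]; first by rewrite expr0z lexx.
  by rewrite -exprnP leNgt exprn_egt1.
by rewrite NegzE -exprnN invf_le1 ?exprn_gt0 // exprn_ege1 // ltW.
Qed.

(* The terms [a i * z ^+ i] have values in distinct cosets of the powers of [p],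
   hence each of them is bounded by [W x]. *)
Lemma tame_difference e (a : 'I_e -> E) (z z' x x' : E) (k : int) :
  (0 < e)%N -> (forall i, a i != 0 -> integral_value (a i)) ->
  W z' = W z -> W z ^+ e = p%:R ^ k -> coprimez k e ->
  x = \sum_i a i * z ^+ i -> x' = \sum_i a i * z' ^+ i ->
  W (x' - x) ^+ e * p%:R <= (Num.max 1 (W x) * Num.max 1 (W x')) ^+ e.
Proof.
move=> e0 ai Wz' We cop xE x'E.
have z0 : z != 0.
  apply/eqP => z0; move: We; rewrite z0 (abs0 Wa) expr0n gtn_eqF // => /esym/eqP.
  by rewrite expfz_eq0 (gt_eqF pR0) andbF.
pose T i := W (a i * z ^+ i).
have T' i : W (a i * z' ^+ i) = T i by rewrite /T !(absM Wa) !(absX Wa) Wz'.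
have Tval i : a i != 0 -> exists m : int, T i ^+ e = p%:R ^ (e%:Z * m + i%:Z * k).
  move=> /ai [m hm]; exists m; rewrite /T (absM Wa) (absX Wa) hm exprMn.
  rewrite -exprM mulnC exprM We expfzDr ?gt_eqF // !exprnP !exprz_exp.
  by rewrite mulrC [k * _]mulrC [m * _]mulrC mulrC.
have dvd (c : int) : (e%:Z %| c * k)%Z -> (e%:Z %| c)%Z.
  by rewrite mulrC Gauss_dvdzr // coprimez_sym.
have Tinj i j : a i * z ^+ i != 0 -> a j * z ^+ j != 0 -> T i = T j -> i = j.
  rewrite !mulf_eq0 !negb_or => /andP[i0 _] /andP[j0 _] e1.
  have [m hm] := Tval i i0; have [l hl] := Tval j j0.
  have : p%:R ^ (e%:Z * m + i%:Z * k) = p%:R ^ (e%:Z * l + j%:Z * k) :> R by rewrite -hm -hl e1.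
  move=> /exprz_inj e2; have : (e%:Z %| i%:Z - j%:Z)%Z.
    apply: dvd; apply/dvdzP; exists (l - m); move: e2; rewrite mulrBl mulrBl => e2.
    by rewrite [l * _]mulrC [m * _]mulrC; lia.
  rewrite -eqz_mod_dvd => /eqP h; apply: val_inj; move: h.
  by rewrite !modz_nat !modn_small ?ltn_ord // => -[].
have Tx i : T i <= W x by rewrite xE; apply: (ultra_sum_ge Tinj).
have Tx' i : T i <= W x'.
  rewrite x'E -T'; apply: (@ultra_sum_ge _ (fun i => a i * z' ^+ i)) => {}i j i0 j0.
  rewrite !T'; apply: Tinj; rewrite mulf_neq0 ?expf_neq0 ?z0 //.
    by move: i0; rewrite mulf_eq0 negb_or => /andP[].
  by move: j0; rewrite mulf_eq0 negb_or => /andP[].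
set M := Num.max 1 (W x) * Num.max 1 (W x').
have m1 (y : E) : 1 <= Num.max 1 (W y) by rewrite le_max lexx.
have m2 (y : E) : W y <= Num.max 1 (W y) by rewrite le_max lexx orbT.
have M1 : 1 <= M by rewrite -[1]mulr1 ler_pM.
have W0 y := abs_ge0 Wa y.
(* For [0 < i < e] the exponent [c] of [T i ^+ e] is nonzero. If it is negative, the factor [p] is
   absorbed in 1; if it is positive, in a second copy of [T i ^+ e], which is why both [W x] and
   [W x'] enter the bound. *)
have Tb (i : 'I_e) : (0 < i)%N -> T i ^+ e * p%:R <= M ^+ e.
  move=> i0; have [a0|a0] := eqVneq (a i) 0.
    by rewrite /T a0 mul0r (abs0 Wa) expr0n gtn_eqF ?mul0r ?exprn_ge0 ?(le_trans ler01).
  have [m hm] := Tval i a0; set c := _ + _ in hm.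
  have c0 : c != 0.
    apply/eqP => c0; have : (e%:Z %| i%:Z)%Z.
      apply: dvd; apply/dvdzP; exists (- m); move: c0; rewrite /c => c0.
      by rewrite mulNr [m * _]mulrC; lia.
    by rewrite dvdzE /= => /(dvdn_leq i0); rewrite leqNgt ltn_ord.
  have [c1|c1] := leP c 0.
    apply: (@le_trans _ _ 1); last by rewrite exprn_ege1.
    rewrite hm -[X in _ * X]expr1z -expfzDr ?gt_eqF // exprz_le1.
    by move: c0 c1; lia.
  apply: (@le_trans _ _ (T i ^+ e * T i ^+ e)).
    rewrite ler_wpM2l ?exprn_ge0 ?W0 // hm.
    have [d ->] : exists d : nat, c = d.+1%:Z by exists `|c|.-1%N; lia.
    by rewrite -exprnP exprS; apply: ler_peMr; [exact: ltW|apply/exprn_ege1/ltW].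
  rewrite -exprMn; apply: lerXn2r; rewrite ?nnegrE ?mulr_ge0 ?W0 ?(le_trans ler01) //.
  by apply: ler_pM; rewrite ?W0 // (le_trans _ (m2 _)).
(* The constant terms cancel, so only indices to which [Tb] applies remain. *)
have dE : x' - x = \sum_(i < e | (0 < i)%N) a i * (z' ^+ i - z ^+ i).
  rewrite x'E xE -sumrB [RHS]big_mkcond; apply: eq_bigr => i _.
  by case: posnP => [->|_]; rewrite ?expr0 ?subrr // mulrBr.
have Db i : W (a i * (z' ^+ i - z ^+ i)) <= T i.
  rewrite mulrBr; apply: (le_trans (ultraB Wa _ _ Wu)).
  by rewrite T' ge_max lexx.
case: (pickP (fun i : 'I_e => (0 < i)%N)) => [i0 i0P|none]; last first.
  by rewrite dE big_pred0 // (abs0 Wa) expr0n gtn_eqF // mul0r exprn_ge0 // (le_trans ler01).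
have [i iP imax] := @arg_maxP _ _ _ i0 (fun i : 'I_e => (0 < i)%N) T i0P.
apply: le_trans (Tb i iP); rewrite ler_wpM2r ?(ltW pR0) // lerXn2r ?nnegrE ?W0 //.
rewrite dE; apply: (ultra_sum Wa); rewrite ?W0 // => j jP.
exact: le_trans (Db j) (imax j jP).
Qed.

End TameValues.

Section IntegerValues.
Variables (R : realType) (p : nat).
Hypothesis pp : prime p.
Local Notation V := (algC_abs R (Some p)).
Let va : is_abs V. Proof. exact: (@algC_absP R (Some p) pp). Qed.
Let vu : ultrametric V. Proof. exact: algC_abs_ultra. Qed.

Lemma padic_abs_coprime (m : int) : ~~ (p%:Z %| m)%Z -> V m%:~R = 1.
Proof.
move=> pm; apply/eqP; rewrite eq_le ultra_int //= leNgt; apply/negP => lt.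
have /coprimezP [[u w] /= e] : coprimez p%:Z m.
  by rewrite /coprimez /gcdz eqz_nat -[_ == _]/(coprime p _) prime_coprime.
have : V 1 < 1.
  have -> : 1 = u%:~R * p%:R + w%:~R * m%:~R :> algC by rewrite pmulrn -!intrM -intrD e.
  have p1 : p%:R^-1 < 1 :> R by rewrite invf_lt1 ?ltr1n ?ltr0n ?prime_gt1 ?prime_gt0.
  apply: (le_lt_trans (vu _ _)); rewrite gt_max !(absM va) padic_abs_p //; apply/andP; split.
    by apply: le_lt_trans p1; rewrite ler_piMl ?invr_ge0 // ultra_int.
  by apply: le_lt_trans lt; rewrite ler_piMl ?(abs_ge0 va) // ultra_int.
by rewrite (abs1 va) ltxx.
Qed.

Lemma padic_abs_rat_value (q : rat) : q != 0 -> exists k : int, V (ratr q) = p%:R ^ k.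
Proof.
by move=> q0; rewrite algC_abs_rat //= /padic_abs (negPf q0); eexists.
Qed.

Lemma padic_abs_int_dvd (m : int) : V m%:~R < 1 -> (p%:Z %| m)%Z.
Proof. by apply: contraTT => /padic_abs_coprime ->; rewrite ltxx. Qed.

End IntegerValues.

Section SmallDegree.
Variable K : fieldExtType rat.

(** The dimension occurs in the type of [emb]; quantifying over [P] lets the equation on the
    dimension be used once for all properties of the embeddings. *)
Lemma emb_reindex d : \dim {:K} = d -> exists e : 'I_d -> {rmorphism K -> algC},
  forall P : (forall n, ('I_n -> {rmorphism K -> algC}) -> Prop), P _ (@emb K) -> P d e.
Proof. by move=> <-; exists (@emb K). Qed.

End SmallDegree.

(** * Trace-zero generators at a ramified prime *)

Section RamifiedGenerator.
Variable K : fieldExtType rat.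
Local Notation d := (\dim {:K}).

Let Ar := @alg_integer_subring K.

Lemma trace_rat_scalar (a : rat) : trace_rat (a%:A : K) = d%:R * a :> rat.
Proof.
have h : ratr (trace_rat (a%:A : K)) = ratr (d%:R * a) :> algC.
  rewrite trace_emb rmorphM /= ratr_nat.
  by under eq_bigr do rewrite emb_alg; rewrite sumr_const card_ord mulr_natl.
exact: fmorph_inj h.
Qed.

(* The trace of the centered element vanishes, so its minimal equation is
   governed by the power sums of degree 2 and 3, which ramified_element controls. *)
Lemma ramified_trace_zero p : prime p -> (3 < p)%N -> (d <= 3)%N -> discr K != 0 ->
  (p%:Z %| discr K)%Z ->
  exists (z : K) (m2 m3 : int),
    [/\ alg_integer z, trace_rat z = 0, trace_rat (z ^+ 2) = p%:R * m2%:~R,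
        trace_rat (z ^+ 3) = p%:R * m3%:~R
      & forall k, coprime k p -> ~ alg_integer (k%:R * z / p%:R)].
Proof.
move=> pp p3 d3 D0 pD; have [y [yi yp ty]] := ramified_element pp D0 pD.
have d0 : (0 < d)%N by apply: adim_gt0.
have [m1 e1] := ty 1 (sring1 Ar); rewrite mulr1 in e1.
(* [p * m1] is the trace of [y], so this is [d] times the centred element. *)
pose z := d%:R * y - (p%:R * m1%:~R : rat)%:A.
have pm (m : int) : (p%:R * m%:~R : rat)%:A = p%:R * m%:~R :> K.
  by rewrite -[p%:R * _ in LHS](intrM rat p%:Z m) alg_int intrM.
have zi : alg_integer z.
  rewrite /z pm; apply: (sringB Ar); apply: (sringM Ar) => //; try exact: sring_nat.
  exact: sring_int.
have zT : trace_rat z = 0.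
  have -> : z = (d%:R : rat) *: y + (- (p%:R * m1%:~R) : rat)%:A.
    by rewrite /z scaler_nat mulr_natl scaleNr.
  by rewrite trace_ratD trace_ratZ trace_rat_scalar e1 mulrN subrr.
have trz x : trace_rat (z * x) = d%:R * trace_rat (y * x) - p%:R * m1%:~R * trace_rat x.
  have -> : z * x = (d%:R : rat) *: (y * x) + (- (p%:R * m1%:~R) : rat) *: x.
    rewrite /z mulrBl mulr_algl scaleNr; congr (_ - _).
    by rewrite -mulrA mulr_natl scaler_nat.
  by rewrite trace_ratD !trace_ratZ mulNr.
have trz' x : alg_integer x -> exists m : int, trace_rat (z * x) = p%:R * m%:~R.
  move=> xi; rewrite trz; have [m ->] := ty x xi; have /intrP [l ->] := trace_int xi.
  by exists (d%:Z * m - m1 * l); rewrite intrD mulrDr rmorphN /= !intrM -pmulrn; ring.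
have [m2 e2] := trz' z zi; have [m3 e3] := trz' (z ^+ 2) (sringX Ar 2 zi).
exists z, m2, m3; split=> // k kp h; apply: yp.
have {}h : alg_integer ((k * d)%:R * y / p%:R).
  have -> : (k * d)%:R * y / p%:R = k%:R * z / p%:R + k%:R * m1%:~R.
    have p0 : p%:R != 0 :> K.
      by rewrite -(rmorph_nat (in_alg K)) fmorph_eq0 pnatr_eq0 -lt0n prime_gt0.
    by rewrite /z pm natrM; field.
  by apply: (sringD Ar) => //; apply: (sringM Ar); [exact: sring_nat|exact: sring_int].
(* As [d] is at most 3 and [p] is larger, multiplication by [k * d] is invertible modulo [p]. *)
have /coprimezP [[u w] /= e] : coprimez (k * d)%:Z p%:Z.
  rewrite /coprimez /gcdz eqz_nat -[_ == _]/(coprime (k * d) p) coprimeMl kp /=.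
  by rewrite coprime_sym prime_coprime // gtnNdvd // (leq_ltn_trans d3).
have p0 : p%:R != 0 :> K.
  by rewrite -(rmorph_nat (in_alg K)) fmorph_eq0 pnatr_eq0 -lt0n prime_gt0.
have -> : y / p%:R = u%:~R * ((k * d)%:R * y / p%:R) + w%:~R * y.
  have : 1 = u%:~R * (k * d)%:R + w%:~R * p%:R :> K.
    by rewrite [(k * d)%:R]pmulrn [p%:R]pmulrn -!intrM -intrD e.
  move=> e'; rewrite -[y in LHS]mul1r {1}e'.
  by field.
by apply: (sringD Ar); apply: (sringM Ar) => //; exact: sring_int.
Qed.

End RamifiedGenerator.

Section Conjugates.
Variable K : fieldExtType rat.
Local Notation d := (\dim {:K}).

Definition vandermonde_emb n (e : 'I_n -> {rmorphism K -> algC}) (x : K) : algC :=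
  \prod_(i < n) \prod_(j < n | (i < j)%N) (e j x - e i x).

(** Each such product is a Vandermonde determinant, that is, a rational determinant times the fixed
    embedding determinant. Square roots of discriminants thus agree up to rational factors. *)
Lemma vandermonde_emb_ratio (x y : K) : <<1; x>>%VS = fullv ->
  exists q : rat, vandermonde_emb (@emb K) y = ratr q * vandermonde_emb (@emb K) x.
Proof.
move=> gx; have bb := vbasisP {:K}.
have rel z : exists q : rat, vandermonde_emb (@emb K) z = ratr q * \det (emb_mx (vbasis {:K})).
  have e1 := emb_coord_mx (fun i : 'I_d => z ^+ i) bb.
  exists (\det (\matrix_(i < d, j < d) coord (vbasis {:K}) j (z ^+ i))).
  rewrite -det_map_mx -det_mulmx -e1.
  have -> : vandermonde_emb (@emb K) z = \det (Vandermonde d (\row_(k < d) emb k z)).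
    by rewrite det_Vandermonde; apply: eq_bigr => i _; apply: eq_bigr => j _; rewrite !mxE.
  by congr (\det _); apply/matrixP => i j; rewrite !mxE rmorphXn.
have x0 : vandermonde_emb (@emb K) x != 0.
  apply/prodf_neq0 => i _; apply/prodf_neq0 => j ij; rewrite subr_eq0.
  by apply: contraTneq ij => /(emb_generator_inj gx) ->; rewrite ltnn.
have [a ea] := rel x; have [b eb] := rel y; exists (b / a); rewrite eb ea mulrA fmorph_div /= mulfVK //.
by apply: contraNneq x0 => a0; rewrite ea a0 mul0r.
Qed.

Lemma conjugates2 : d = 2%N -> exists e1 e2 : {rmorphism K -> algC},
  (forall x, ratr (trace_rat x) = e1 x + e2 x) /\
  (forall phi : {rmorphism K -> algC}, phi =1 e1 \/ phi =1 e2).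
Proof.
move=> /emb_reindex [e he]; exists (e ord0), (e (lift ord0 ord0)); split=> [x|phi].
  rewrite (he (fun n e => ratr (trace_rat x) = \sum_(i < n) e i x)) ?trace_emb //.
  by rewrite !big_ord_recl big_ord0 addr0.
have := he (fun n e => exists i : 'I_n, phi =1 e i) (emb_all phi).
by case=> -[[|[|//]] h] eq; [left|right] => x; rewrite eq; congr (e _ x); apply: val_inj.
Qed.

Lemma conjugates3 : d = 3%N -> exists e1 e2 e3 : {rmorphism K -> algC},
  [/\ forall x, ratr (trace_rat x) = e1 x + e2 x + e3 x,
      forall phi : {rmorphism K -> algC}, [\/ phi =1 e1, phi =1 e2 | phi =1 e3],
      forall x, <<1; x>>%VS = fullv -> [/\ e1 x != e2 x, e1 x != e3 x & e2 x != e3 x],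
      forall x, exists q, ratr q = e1 x * e2 x * e3 x
    & forall x y, <<1; x>>%VS = fullv -> exists q : rat,
        (e1 y - e2 y) * (e1 y - e3 y) * (e2 y - e3 y) =
        ratr q * ((e1 x - e2 x) * (e1 x - e3 x) * (e2 x - e3 x))].
Proof.
move=> /emb_reindex [e he].
set i1 : 'I_3 := ord0; set i2 : 'I_3 := lift ord0 ord0; set i3 : 'I_3 := lift ord0 (lift ord0 ord0).
exists (e i1), (e i2), (e i3); split=> [x|phi|x gx|x|x y gx].
- rewrite (he (fun n e => ratr (trace_rat x) = \sum_(i < n) e i x)) ?trace_emb //.
  by rewrite !big_ord_recl big_ord0 addr0 addrA.
- have := he (fun n e => exists i : 'I_n, phi =1 e i) (emb_all phi).
  by case=> -[[|[|[|//]]] h] eq; [apply: Or31|apply: Or32|apply: Or33] => x; rewrite eq;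
    congr (e _ x); apply: val_inj.
- have inj := he (fun n e => injective (fun i : 'I_n => e i x)) (emb_generator_inj gx).
  by split; apply/eqP => /inj.
- have [P eP] := conj_poly_rat x.
  have {}eP := he (fun n e => map_poly ratr P = \prod_(k < n) ('X - (e k x)%:P)) eP.
  exists (- P.[0]); rewrite rmorphN /= -horner_map rmorph0 eP !big_ord_recl big_ord0 mulr1.
  by rewrite !hornerM !hornerXsubC -/i1 -/i2 -/i3; ring.
- have := he (fun n e => exists q : rat, vandermonde_emb e y = ratr q * vandermonde_emb e x)
    (vandermonde_emb_ratio y gx).
  case=> q; rewrite /vandermonde_emb !big_ord_recl !big_ord0.
  do 6!rewrite big_mkcond !big_ord_recl big_ord0 /=.
  rewrite !mulr1 !mul1r -/i1 -/i2 -/i3 => eq; exists q.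
  have s3 (a b c : algC) : (a - b) * (a - c) * (b - c) = - ((b - a) * (c - a) * (c - b)) by ring.
  by rewrite !s3 eq mulrN.
Qed.

End Conjugates.

Lemma cubic_Aint (B C : int) (x : algC) : x ^+ 3 + B%:~R * x + C%:~R = 0 -> x \in Aint.
Proof.
move=> h; apply: (@root_monic_Aint (map_poly intr ('X^3 + B *: 'X + C%:P))).
- by rewrite rmorphD rmorphD /= map_polyXn map_polyZ map_polyX map_polyC /= /root !hornerE h.
- rewrite monic_map // -addrA monicE lead_coefDl ?lead_coefXn //.
  rewrite size_polyXn ltnS (leq_trans (size_polyD _ _)) // geq_max.
  by rewrite (leq_trans (size_scale_leq _ _)) ?size_polyX // (leq_trans (size_polyC_leq1 _)).
- by apply/polyOverP => i; rewrite coef_map /= intr_int.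
Qed.

Lemma newton3 (a b c B C : algC) : a + b + c = 0 -> a ^+ 2 + b ^+ 2 + c ^+ 2 = - 2%:R * B ->
  a ^+ 3 + b ^+ 3 + c ^+ 3 = - 3%:R * C -> a * b + a * c + b * c = B /\ a * b * c = - C.
Proof.
move=> h h2 h3.
have -> : B = - (a ^+ 2 + b ^+ 2 + c ^+ 2) / 2%:R by rewrite h2; field.
have -> : C = - (a ^+ 3 + b ^+ 3 + c ^+ 3) / 3%:R by rewrite h3; field.
have -> : c = - a - b by rewrite -[LHS]subr0 -h; ring.
by split; field.
Qed.

Lemma cubic_root3 (a b c B C : algC) : a + b + c = 0 -> a * b + a * c + b * c = B ->
  a * b * c = - C -> a ^+ 3 + B * a + C = 0.
Proof.
move=> h <- h3; have -> : C = - (a * b * c) by rewrite h3 opprK.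
by have -> : c = - a - b; [rewrite -[LHS]subr0 -h; ring|ring].
Qed.

Section RamifiedSmall.
Variables (K : fieldExtType rat) (p : nat) (R : realType).
Hypotheses (pp : prime p) (p3 : (3 < p)%N) (D0 : discr K != 0) (pD : (p%:Z %| discr K)%Z).
Local Notation d := (\dim {:K}).
Local Notation V := (algC_abs R (Some p)).
Let va : is_abs V. Proof. exact: (@algC_absP R (Some p) pp). Qed.
Let vu : ultrametric V. Proof. exact: algC_abs_ultra. Qed.

Lemma prime_dim_generates (x : K) : prime d -> x \notin 1%VS -> <<1; x>>%VS = fullv.
Proof.
move=> pd x1; apply/eqP; rewrite eqEdim subvf /=.
have /(prime_nt_dvdP pd) -> // : (\dim <<1; x>>%VS %| d)%N by apply: field_dimS; apply: subvf.
apply: contraNneq x1 => d1; have -> : (1%VS : {vspace K}) = <<1; x>>%VS; last exact: memv_adjoin.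
by apply/eqP; rewrite eqEdim (subv_adjoin 1%AS) d1 dimv1.
Qed.

Lemma ramified_generator (z : K) : prime d -> trace_rat z = 0 -> z != 0 -> <<1; z>>%VS = fullv.
Proof.
move=> pd tz z0; apply: prime_dim_generates => //; apply: contra_neqN z0 => /vlineP [a e].
move: tz; rewrite e trace_rat_scalar => /eqP; rewrite mulf_eq0 pnatr_eq0 gtn_eqF ?prime_gt0 //=.
by move=> /eqP ->; rewrite scale0r.
Qed.

Lemma ramified_dim : d <> 1%N.
Proof.
move=> d1; have [y [yi yp ty]] := ramified_element pp D0 pD.
have /vlineP [a e] : y \in 1%VS by rewrite (_ : 1%VS = fullv) ?memvf //; apply/eqP; rewrite eqEdim subvf d1 dimv1.
have [m] := ty 1 (sring1 (@alg_integer_subring K)); rewrite mulr1 e trace_rat_scalar d1 mul1r => em.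
apply: yp; rewrite e em.
have -> : (p%:R * m%:~R : rat)%:A / p%:R = m%:~R :> K.
  have p0 : p%:R != 0 :> K.
    by rewrite -(rmorph_nat (in_alg K)) fmorph_eq0 pnatr_eq0 -lt0n prime_gt0.
  by rewrite -[p%:R * _ in LHS](intrM rat p%:Z m) alg_int intrM -pmulrn mulrAC mulfV // mul1r.
exact: sring_int (@alg_integer_subring K) m.
Qed.

Lemma padic_abs_small (k : nat) : (0 < k <= 3)%N -> V k%:R = 1.
Proof.
case/andP=> k0 k3; rewrite pmulrn padic_abs_coprime // dvdzE /=.
by rewrite gtnNdvd // (leq_ltn_trans k3).
Qed.

Lemma ramified_quadratic : d = 2%N -> exists z : K,
  [/\ <<1; z>>%VS = fullv, z ^+ 2 \in 1%VS & forall phi : {rmorphism K -> algC}, V (phi z) ^+ 2 = p%:R^-1].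
Proof.
move=> d2; have [|z [m2 [m3 [zi tz tz2 _ zp]]]] := ramified_trace_zero pp p3 _ D0 pD; first by rewrite d2.
have [e1 [e2 [te ee]]] := conjugates2 d2.
have e12 : e2 z = - e1 z by apply/eqP; rewrite -addr_eq0 addrC -te tz rmorph0.
have ez2 : z ^+ 2 = (p%:R * m2%:~R / 2%:R : rat)%:A.
  apply: (fmorph_inj e1); have := te (z ^+ 2); rewrite tz2 !rmorphXn /= e12 sqrrN => h.
  have -> : e1 (p%:R * m2%:~R / 2%:R)%:A = ratr (p%:R * m2%:~R) / 2%:R.
    by rewrite -[_%:A]/(in_alg K _) -[e1 _]/((e1 \o in_alg K) _) fmorph_eq_rat fmorph_div /= ratr_nat.
  by rewrite h; field.
have p0 : p%:R != 0 :> algC by rewrite pnatr_eq0 -lt0n prime_gt0.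
have phi2 (phi : {rmorphism K -> algC}) : phi z ^+ 2 = p%:R * m2%:~R / 2%:R.
  rewrite -rmorphXn /= ez2.
  rewrite -[_%:A]/(in_alg K _) -[phi _]/((phi \o in_alg K) _) fmorph_eq_rat fmorph_div /= ratr_nat.
  by rewrite rmorphM /= ratr_nat ratr_int.
have pm2 : ~~ (p%:Z %| m2)%Z.
  (* With [m2 = m * p] the element [2 z / p] has square [2 m] and would be integral. *)
  apply/negP => /dvdzP [m em]; apply: (zp 2%N); first by rewrite coprime_sym prime_coprime // gtnNdvd // ltnW.
  apply/(alg_integerE e1)/(@cubic_Aint (- 2 * m) 0).
  have e : e1 (2%:R * z / p%:R) ^+ 2 = (2 * m)%:~R.
    rewrite fmorph_div rmorphM /= !rmorph_nat expr_div_n exprMn phi2 em !intrM -!pmulrn.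
    by field.
  by rewrite exprS e mulNr rmorphN /= mulNr [_ * (2 * m)%:~R]mulrC subrr add0r.
have Vz : forall phi : {rmorphism K -> algC}, V (phi z) ^+ 2 = p%:R^-1.
  move=> phi; rewrite -(absX va) phi2.
  rewrite !(absM va) padic_abs_p // padic_abs_coprime // mulr1 (absV va) (padic_abs_small (k := 2)) //.
  by rewrite invr1 mulr1.
exists z; split=> //; last by rewrite ez2 memvZ ?mem1v.
apply: ramified_generator => //; first by rewrite d2.
apply/eqP => z0; have := Vz e1; rewrite z0 rmorph0 (abs0 va) expr0n /= => /esym/eqP.
by rewrite invr_eq0 pnatr_eq0 -leqn0 leqNgt prime_gt0.
Qed.

(** If [p ^ 2] divided [B] and [p ^ 3] divided [C], the roots would stay integral after division by
    [p], against the choice of [z]. *)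
Lemma ramified_cubic : d = 3%N -> exists (w : K) (B C : int),
  [/\ <<1; w>>%VS = fullv, (p%:Z %| B)%Z, (p%:Z %| C)%Z,
     (p%:Z ^+ 2 %| B)%Z -> ~ (p%:Z ^+ 3 %| C)%Z
   & forall a b c : {rmorphism K -> algC}, (forall x, ratr (trace_rat x) = a x + b x + c x) ->
     [/\ a w + b w + c w = 0, a w * b w + a w * c w + b w * c w = B%:~R
       & a w * b w * c w = - C%:~R]].
Proof.
move=> d3; have [|z [m2 [m3 [zi tz tz2 tz3 zp]]]] := ramified_trace_zero pp p3 _ D0 pD.
  by rewrite d3.
(* The factor 6 clears the denominators in Newton's identities: -18 is [- 6 ^ 2 / 2] and -72 is
   [- 6 ^ 3 / 3]. *)
pose w : K := 6%:R * z; pose B := - 18%:Z * p%:Z * m2; pose C := - 72%:Z * p%:Z * m3.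
have rel (a b c : {rmorphism K -> algC}) : (forall x, ratr (trace_rat x) = a x + b x + c x) ->
     [/\ a w + b w + c w = 0, a w * b w + a w * c w + b w * c w = B%:~R
       & a w * b w * c w = - C%:~R].
  move=> te; have s0 : a z + b z + c z = 0 by rewrite -te tz rmorph0.
  have h2 := te (z ^+ 2); have h3 := te (z ^+ 3).
  rewrite tz2 !rmorphXn !rmorphM /= ratr_nat ratr_int in h2.
  rewrite tz3 !rmorphXn !rmorphM /= ratr_nat ratr_int in h3.
  have ew (phi : {rmorphism K -> algC}) : phi w = 6%:R * phi z by rewrite rmorphM rmorph_nat.
  have e0 : a w + b w + c w = 0 by rewrite !ew -!mulrDr s0 mulr0.
  have [||e2 e3] := @newton3 (a w) (b w) (c w) B%:~R C%:~R e0.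
  - rewrite !ew !exprMn -!mulrDr -h2 /B !intrM rmorphN /= -!pmulrn; ring.
  - rewrite !ew !exprMn -!mulrDr -h3 /C !intrM rmorphN /= -!pmulrn; ring.
  by split.
have [e1 [e2 [e3 [te _ _ _ _]]]] := conjugates3 d3; have [w0 w2 w3] := rel _ _ _ te.
have p0 : p%:R != 0 :> algC by rewrite pnatr_eq0 -lt0n prime_gt0.
have eq := cubic_root3 w0 w2 w3.
have cop k : (0 < k <= 3)%N -> coprimez (k%:Z) p%:Z.
  case/andP=> k0 k3; rewrite /coprimez /gcdz eqz_nat -[_ == _]/(coprime _ _).
  by rewrite coprime_sym prime_coprime // gtnNdvd // (leq_ltn_trans k3).
have npq : (p%:Z ^+ 2 %| B)%Z -> ~ (p%:Z ^+ 3 %| C)%Z.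
  move=> /dvdzP [B' eB] /dvdzP [C' eC]; apply: (zp 6%N).
    have := cop 2%N isT; have := cop 3%N isT; rewrite /coprimez /gcdz !eqz_nat => h3 h2.
    by rewrite -[6%N]/(2 * 3)%N coprimeMl; apply/andP.
  apply/(alg_integerE e1)/(@cubic_Aint B' C'); move: eq.
  have -> : B%:~R = B'%:~R * p%:R ^+ 2 :> algC by rewrite eB !intrM -!pmulrn.
  have -> : C%:~R = C'%:~R * p%:R ^+ 3 :> algC by rewrite eC !intrM -!pmulrn.
  rewrite -/w fmorph_div rmorph_nat.
  set u := e1 w => eq.
  have -> : (u / p%:R) ^+ 3 + B'%:~R * (u / p%:R) + C'%:~R =
      (u ^+ 3 + B'%:~R * p%:R ^+ 2 * u + C'%:~R * p%:R ^+ 3) / p%:R ^+ 3 by field.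
  by rewrite eq mul0r.
exists w, B, C; split=> //.
- apply: ramified_generator; rewrite ?d3 //.
    have -> : w = (6%:R : rat) *: z by rewrite /w mulr_natl scaler_nat.
    by rewrite trace_ratZ tz mulr0.
  apply/eqP => ew; move: w2 w3; rewrite ew !rmorph0 !mulr0 !addr0 => /esym/eqP.
  rewrite intr_eq0 => /eqP B0 /esym/eqP; rewrite oppr_eq0 intr_eq0 => /eqP C0.
  by move: npq; rewrite B0 C0 !dvdz0 => /(_ isT).
- by apply/dvdzP; exists (- 18%:Z * m2); rewrite /B mulrAC.
- by apply/dvdzP; exists (- 72%:Z * m3); rewrite /C mulrAC.
Qed.

Lemma padic_abs_sum_zero (a B C : algC) : V B <= V C -> V C < 1 ->
  a ^+ 3 + B * a + C = 0 -> C != 0 -> V a ^+ 3 = V C.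
Proof.
move=> BC C1 e C0; have ea : a ^+ 3 = - (B * a + C) by apply/eqP; rewrite -addr_eq0 addrA e.
have a1 : V a < 1.
  rewrite ltNge; apply/negP => h; have : V a ^+ 3 <= V C * V a.
    rewrite -(absX va) ea absN //; apply: (le_trans (vu _ _)); rewrite ge_max (absM va).
    by rewrite ler_wpM2r ?(abs_ge0 va) // ler_peMr ?(abs_ge0 va).
  rewrite exprSr ler_pM2r ?(lt_le_trans ltr01 h) // leNgt.
  by rewrite (lt_le_trans C1) // exprn_ege1.
rewrite -(absX va) ea absN // (ultra_lt va vu) // (absM va).
apply: (@le_lt_trans _ _ (V C * V a)); first by rewrite ler_wpM2r ?(abs_ge0 va).
by rewrite gtr_pMr // (abs_gt0 va).
Qed.

Lemma disc3 (a b c B C : algC) : a + b + c = 0 -> a * b + a * c + b * c = B ->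
  a * b * c = - C -> ((a - b) * (a - c) * (b - c)) ^+ 2 = - (4%:R * B ^+ 3 + 27%:R * C ^+ 2).
Proof.
move=> h <- h3; have -> : C = - (a * b * c) by rewrite h3 opprK.
by have -> : c = - a - b; [rewrite -[LHS]subr0 -h; ring|ring].
Qed.

Lemma padic_abs_4 : V 4%:R = 1.
Proof. by rewrite (_ : 4%:R = 2%:R * 2%:R :> algC) ?(absM va) ?padic_abs_small ?mulr1 // -natrM. Qed.

Lemma padic_abs_27 : V 27%:R = 1.
Proof. by rewrite (_ : 27%:R = 3%:R ^+ 3 :> algC) ?(absX va) ?padic_abs_small ?expr1n // -natrX. Qed.

Lemma padic_abs_dvd_exact (k : nat) (m : int) : V (p%:Z ^+ k * m)%:~R = p%:R ^- k * V m%:~R.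
Proof.
have -> : (p%:Z ^+ k * m)%:~R = p%:R ^+ k * m%:~R :> algC.
  by elim: k => [|k IH]; rewrite ?mul1r // !exprS -!mulrA intrM IH -pmulrn.
by rewrite (absM va) (absX va) padic_abs_p // exprVn.
Qed.

(** As [B] is no larger than [C], the term [27 C ^ 2] dominates the discriminant, so its square root
    has the integral power [p ^ (- k)] as value although the roots may not. *)
Lemma cubic_pure_values (a b c : algC) (B C : int) (k : nat) : (0 < k)%N -> a + b + c = 0 ->
  a * b + a * c + b * c = B%:~R -> a * b * c = - C%:~R ->
  V B%:~R <= p%:R ^- k -> V C%:~R = p%:R ^- k ->
  V a ^+ 3 = p%:R ^- k /\ V ((a - b) * (a - c) * (b - c)) = p%:R ^- k.
Proof.
move=> k0 h0 h2 h3 VB VC; have pR1 : 1 < p%:R :> R by rewrite ltr1n prime_gt1.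
have q0 : 0 < p%:R ^- k :> R by rewrite invr_gt0 exprn_gt0 // (lt_trans ltr01).
have q1 : p%:R ^- k < 1 :> R by rewrite invf_lt1 ?exprn_egt1 ?exprn_gt0 ?(lt_trans ltr01) // -lt0n.
have C0 : C%:~R != 0 :> algC by rewrite -(abs_gt0 va) VC.
split.
  rewrite -VC; apply: (@padic_abs_sum_zero _ B%:~R C%:~R) => //; rewrite ?VC //.
  exact: cubic_root3 h3.
have s2 : V ((a - b) * (a - c) * (b - c)) ^+ 2 = (p%:R ^- k) ^+ 2.
  rewrite -(absX va) (disc3 h0 h2 h3) absN // (ultra_lt va vu).
    by rewrite (absM va) padic_abs_27 mul1r (absX va) VC.
  rewrite (absM va 4%:R) padic_abs_4 (absM va 27%:R) padic_abs_27 !mul1r !(absX va) VC.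
  apply: (@le_lt_trans _ _ ((p%:R ^- k) ^+ 3)); first by rewrite lerXn2r ?nnegrE ?(abs_ge0 va) ?(ltW q0).
  by rewrite exprS gtr_pMl ?exprn_gt0.
by apply/eqP; rewrite -(@eqrXn2 _ 2) ?(abs_ge0 va) ?(ltW q0) // s2.
Qed.

(** The discriminant is [- (3 a ^ 2 + B) ^ 2 (3 a ^ 2 + 4 B)], and the terms in [B] dominate both
    factors. *)
Lemma cubic_small_root (a b c : algC) (B C : int) : a + b + c = 0 ->
  a * b + a * c + b * c = B%:~R -> a * b * c = - C%:~R ->
  V B%:~R = p%:R^-1 -> V C%:~R <= p%:R ^- 2 ->
  V a <= p%:R^-1 -> V ((a - b) * (a - c) * (b - c)) ^+ 2 = p%:R ^- 3.
Proof.
move=> h0 h2 h3 VB VC Va; have pR1 : 1 < p%:R :> R by rewrite ltr1n prime_gt1.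
have pR0 : 0 < p%:R :> R by apply: lt_trans pR1.
have q0 : 0 < p%:R ^-1 :> R by rewrite invr_gt0.
have a2 : V (a ^+ 2) < p%:R^-1.
  rewrite (absX va); apply: (@le_lt_trans _ _ (p%:R^-1 ^+ 2)).
    by rewrite lerXn2r ?nnegrE ?(abs_ge0 va) ?(ltW q0).
  by rewrite expr2 gtr_pMl // invf_lt1.
have e1 : V ((a - b) * (a - c)) = p%:R^-1.
  have -> : (a - b) * (a - c) = 3%:R * a ^+ 2 + B%:~R.
    by rewrite -h2 (_ : c = - a - b); [ring|rewrite -[LHS]subr0 -h0; ring].
  by rewrite (ultra_lt va vu) ?VB // (absM va) padic_abs_small // mul1r.
have e2 : V (b - c) ^+ 2 = p%:R^-1.
  have -> : V (b - c) ^+ 2 = V (- (3%:R * a ^+ 2) + - (4%:R * B%:~R)).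
    by rewrite -(absX va) -h2; congr V; rewrite (_ : c = - a - b); [ring|rewrite -[LHS]subr0 -h0; ring].
  have e4 : V (- (4%:R * B%:~R)) = p%:R^-1 by rewrite absN // (absM va) padic_abs_4 mul1r.
  by rewrite (ultra_lt va vu) e4 // absN // (absM va) padic_abs_small // mul1r.
by rewrite (absM va) e1 exprMn e2 -exprSr exprVn.
Qed.

(** A root of value above [1/p] has value [p ^ (-1/2)]; three of them would have a product of value
    [p ^ (-3/2)], too large for [C]. *)
Lemma cubic_has_small_root (a b c : algC) (B C : int) : a + b + c = 0 ->
  a * b + a * c + b * c = B%:~R -> a * b * c = - C%:~R ->
  V B%:~R = p%:R^-1 -> V C%:~R <= p%:R ^- 2 ->
  [\/ V a <= p%:R^-1, V b <= p%:R^-1 | V c <= p%:R^-1].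
Proof.
move=> h0 h2 h3 VB VC; have pR1 : 1 < p%:R :> R by rewrite ltr1n prime_gt1.
have pR0 : 0 < p%:R :> R by apply: lt_trans pR1.
have q0 : 0 < p%:R ^-1 :> R by rewrite invr_gt0.
have q1 : p%:R^-1 < 1 :> R by rewrite invf_lt1.
have big x : x ^+ 3 + B%:~R * x + C%:~R = 0 -> p%:R^-1 < V x -> V x ^+ 2 = p%:R^-1.
  move=> e hx; have x0 : V x != 0 by rewrite gt_eqF // (lt_trans q0).
  apply: (mulIf x0); rewrite -exprSr -(absX va).
  have -> : x ^+ 3 = - (C%:~R + B%:~R * x) by apply/eqP; rewrite -addr_eq0 addrA addrAC e.
  rewrite absN // (ultra_lt va vu) (absM va) VB //.
  by apply: (le_lt_trans VC); rewrite -exprVn expr2 ltr_pM2l.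
have r1 := cubic_root3 h0 h2 h3.
have r2 : b ^+ 3 + B%:~R * b + C%:~R = 0.
  by apply: (@cubic_root3 b a c); rewrite -?h0 -?h2 -?h3; ring.
have r3 : c ^+ 3 + B%:~R * c + C%:~R = 0.
  by apply: (@cubic_root3 c a b); rewrite -?h0 -?h2 -?h3; ring.
have [ha|/(big _ r1) ha] := leP (V a) p%:R^-1; first exact: Or31.
have [hb|/(big _ r2) hb] := leP (V b) p%:R^-1; first exact: Or32.
have [hc|/(big _ r3) hc] := leP (V c) p%:R^-1; first exact: Or33.
have : V (a * b * c) ^+ 2 <= (p%:R ^- 2) ^+ 2.
  by rewrite h3 absN // lerXn2r ?nnegrE ?(abs_ge0 va) ?invr_ge0 ?exprn_ge0 ?(ltW pR0).
rewrite !(absM va) !exprMn ha hb hc -exprVn -exprM leNgt.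
have -> : p%:R^-1 / p%:R / p%:R = p%:R^-1 ^+ 3 :> R by rewrite !exprSr expr0 mul1r.
by rewrite [_ ^+ (2 * 2)]exprSr gtr_pMr ?exprn_gt0 ?q1.
Qed.

(** These are the two possible Newton polygons: a single slope with denominator 3, or one root of
    value at most [1/p] beside two of value [p ^ (-1/2)]. *)
Lemma ramified_cubic_values : d = 3%N -> exists (w : K) (B C : int),
  [/\ <<1; w>>%VS = fullv,
    forall a b c : {rmorphism K -> algC}, (forall x, ratr (trace_rat x) = a x + b x + c x) ->
     [/\ a w + b w + c w = 0, a w * b w + a w * c w + b w * c w = B%:~R
       & a w * b w * c w = - C%:~R]
    & (exists k : nat, [/\ coprimez k%:Z 3%:Z, (0 < k)%N, V B%:~R <= p%:R ^- k & V C%:~R = p%:R ^- k]) \/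
      (V B%:~R = p%:R^-1 /\ V C%:~R <= p%:R ^- 2)].
Proof.
move=> d3; have [w [B [C [gw /dvdzP [B' eB] /dvdzP [C' eC] npq rel]]]] := ramified_cubic d3.
exists w, B, C; split=> //.
have pR1 : 1 < p%:R :> R by rewrite ltr1n prime_gt1.
have pR0 : 0 < p%:R :> R by apply: lt_trans pR1.
have VB : V B%:~R = p%:R^-1 * V B'%:~R by rewrite eB mulrC -[X in X * B']expr1 padic_abs_dvd_exact.
have VC : V C%:~R = p%:R^-1 * V C'%:~R by rewrite eC mulrC -[X in X * C']expr1 padic_abs_dvd_exact.
have [pC|pC] := boolP (p%:Z %| C')%Z; last first.
  left; exists 1%N; split=> //; last by rewrite VC padic_abs_coprime // mulr1.
  by rewrite VB ler_piMr ?invr_ge0 ?(ltW pR0) // ultra_int.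
have {pC} [C2 eC2] := dvdzP pC.
have VC2 : V C%:~R = p%:R ^- 2 * V C2%:~R.
  by rewrite -padic_abs_dvd_exact eC eC2 -mulrA mulrC.
have [pB|pB] := boolP (p%:Z %| B')%Z; last first.
  right; split; first by rewrite VB padic_abs_coprime // mulr1.
  by rewrite VC2 ler_piMr ?invr_ge0 ?exprn_ge0 ?(ltW pR0) // ultra_int.
have {pB} [B2 eB2] := dvdzP pB.
have pC2 : ~~ (p%:Z %| C2)%Z.
  apply/negP => /dvdzP [C3 eC3]; apply: npq; first by apply/dvdzP; exists B2; rewrite eB eB2 -mulrA.
  by apply/dvdzP; exists C3; rewrite eC eC2 eC3 -!mulrA.
left; exists 2%N; split=> //; last by rewrite VC2 padic_abs_coprime // mulr1.
have -> : B = p%:Z ^+ 2 * B2 by rewrite eB eB2 -mulrA mulrC.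
by rewrite padic_abs_dvd_exact ler_piMr ?invr_ge0 ?exprn_ge0 ?(ltW pR0) // ultra_int.
Qed.

End RamifiedSmall.

(** * Congruent conjugates *)

Section TameExtensions.
Variables (N : splittingFieldType rat) (R : realType) (W : N -> R) (p : nat).
Hypotheses (Wa : is_abs W) (Wu : ultrametric W) (p1 : (1 < p)%N).

Let pR1 : 1 < p%:R :> R. Proof. by rewrite ltr1n. Qed.
Let pR0 : 0 < p%:R :> R. Proof. exact: lt_trans ltr01 pR1. Qed.

Local Notation max1 x := (Num.max 1 (W x)).

Lemma adjoin_degree_le (K : {subfield N}) (q : {poly N}) z : q \is a polyOver K -> q != 0 ->
  root q z -> (adjoin_degree K z <= (size q).-1)%N.
Proof.
move=> qK q0 qz; have := dvdp_leq q0 (minPoly_dvdp qK qz); rewrite size_minPoly.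
by case: (size q).
Qed.

Lemma adjoin_degree_sqrt (K : {subfield N}) s : s ^+ 2 \in K -> (adjoin_degree K s <= 2)%N.
Proof.
move=> sK; have -> : 2%N = (size ('X^2 - (s ^+ 2)%:P)).-1 by rewrite size_XnsubC.
apply: adjoin_degree_le; last by rewrite /root !hornerE subrr.
  by rewrite rpredB ?rpredX ?polyOverX // polyOverC.
by rewrite -size_poly_gt0 size_XnsubC.
Qed.

Lemma adjoin_degree_mem (K : {subfield N}) s x : x \in <<K; s>>%VS ->
  (adjoin_degree K x <= adjoin_degree K s)%N.
Proof.
move=> xs; rewrite -(leq_pmul2r (adim_gt0 K)) -!dim_Fadjoin dimvS //.
by apply/FadjoinP; split=> //; apply: subv_adjoin.
Qed.

Lemma gal_adjoin_eq (K : {subfield N}) g h z x :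
  g \in 'Gal({:N} / K)%g -> h \in 'Gal({:N} / K)%g -> g z = h z -> x \in <<K; z>>%VS -> g x = h x.
Proof.
move=> gG hG e /Fadjoin_polyP [q qK ->].
rewrite -!horner_map /= e; congr (_.[_]); apply/polyP => i; rewrite !coef_map /=.
by rewrite (gal_fix gG) ?(gal_fix hG) // (polyOverP qK).
Qed.

Lemma tame_extension (K : {subfield N}) z e k x :
  (forall a, a \in K -> a != 0 -> integral_value W p a) -> (0 < e)%N ->
  (adjoin_degree K z <= e)%N -> W z ^+ e = p%:R ^ k -> coprimez k e ->
  (forall g, g \in 'Gal({:N} / K)%g -> W (g z) = W z) ->
  x \in <<K; z>>%VS -> x \notin K ->
  exists2 g, g \in 'Gal({:N} / K)%g &
    g x != x /\ W (g x - x) ^+ e * p%:R <= (max1 x * max1 (g x)) ^+ e.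
Proof.
move=> Kv e0 de We cop Wg xz xK; have [g gG gx] := gal_moves xK; exists g => //; split=> //.
set q := Fadjoin_poly K z x; have sq : (size q <= e)%N.
  exact: leq_trans (size_Fadjoin_poly _ _ _) de.
have qK i : q`_i \in K by apply/polyOverP/Fadjoin_polyOver.
have ex : x = \sum_(i < e) q`_i * z ^+ i.
  by rewrite -(horner_coef_wide z sq) Fadjoin_poly_eq.
apply: (tame_difference Wa Wu p1 (a := fun i : 'I_e => q`_i) e0 _ (Wg g gG) We cop ex) => [i|].
  exact: Kv.
rewrite [in LHS]ex rmorph_sum; apply: eq_bigr => i _.
by rewrite rmorphM rmorphXn /= (gal_fix gG (qK i)).
Qed.

(** The exponent 3 covers ramification index 2 as well, by [close_square]. The preliminary [h] is
    there because in the mixed case perhaps only another conjugate of [x] lies outside [K(z1)]. *)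
Definition close_conjugates (K : {subfield N}) (x : N) :=
  exists h g, [/\ h \in 'Gal({:N} / K)%g, g \in 'Gal({:N} / K)%g, g (h x) != h x
    & W (g (h x) - h x) ^+ 3 * p%:R <= (max1 (h x) * max1 (g (h x))) ^+ 3].

Lemma close_square (x y : N) : W (y - x) ^+ 2 * p%:R <= (max1 x * max1 y) ^+ 2 ->
  W (y - x) ^+ 3 * p%:R <= (max1 x * max1 y) ^+ 3.
Proof.
move=> h; have W0 z := abs_ge0 Wa z.
have m1 z : 1 <= max1 z by rewrite le_max lexx.
have le : W (y - x) <= max1 x * max1 y.
  apply: (le_trans (ultraB Wa _ _ Wu)); rewrite ge_max; apply/andP; split.
    by apply: (@le_trans _ _ (max1 y)); rewrite ?le_max ?lexx ?orbT // ler_peMl // (le_trans ler01).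
  by apply: (@le_trans _ _ (max1 x)); rewrite ?le_max ?lexx ?orbT // ler_peMr // (le_trans ler01).
by rewrite exprS -mulrA [_ ^+ 3]exprS ler_pM // mulr_ge0 ?exprn_ge0 // ltW.
Qed.

Lemma close_quadratic (K : {subfield N}) s k x :
  (forall a, a \in K -> a != 0 -> integral_value W p a) ->
  s ^+ 2 \in K -> W s ^+ 2 = p%:R ^ k -> coprimez k 2 -> x \in <<K; s>>%VS -> x \notin K ->
  exists2 g, g \in 'Gal({:N} / K)%g &
    g x != x /\ W (g x - x) ^+ 3 * p%:R <= (max1 x * max1 (g x)) ^+ 3.
Proof.
move=> Kv sK Ws k2 xs xK.
have ds := adjoin_degree_sqrt sK.
have Wg g : g \in 'Gal({:N} / K)%g -> W (g s) = W s.
  move=> gG; apply/eqP; rewrite -(@eqrXn2 _ 2) ?(abs_ge0 Wa) // -!(absX Wa) -rmorphXn /=.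
  by rewrite (gal_fix gG).
have [g gG [gx h]] := tame_extension Kv (ltn0Sn 1) ds Ws k2 Wg xs xK.
by exists g => //; split=> //; apply: close_square.
Qed.

(** The value of a polynomial at [z] does not change when [z] is replaced by a close enough element
    of [K]; adjoining a limit of elements of [K] leaves the group of values alone. *)
Lemma approx_integral_value (K : {subfield N}) z :
  (forall a, a \in K -> a != 0 -> integral_value W p a) -> W z <= 1 ->
  (forall e, 0 < e -> exists2 a, a \in K & W (a - z) < e) ->
  forall x, x \in <<K; z>>%VS -> x != 0 -> integral_value W p x.
Proof.
move=> Kv z1 za x /Fadjoin_polyP [q qK ->] x0.
have [C C0 hC] : exists2 C : R, 0 < C & forall i, W q`_i <= C.
  exists (1 + \sum_(i < size q) W q`_i).
    by rewrite ltr_pwDl // sumr_ge0 // => i _; apply: (abs_ge0 Wa).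
  move=> i; have [h|h] := ltnP i (size q); last first.
    by rewrite nth_default // (abs0 Wa) addr_ge0 // sumr_ge0 // => j _; apply: (abs_ge0 Wa).
  rewrite (bigD1 (Ordinal h)) //= addrCA lerDl addr_ge0 // sumr_ge0 // => j _.
  exact: (abs_ge0 Wa).
have W0 y := abs_ge0 Wa y.
have [a aK ha] : exists2 a, a \in K & W (a - z) < Num.min 1 (W q.[z] / C).
  by apply: za; rewrite lt_min ltr01 divr_gt0 // (abs_gt0 Wa).
move: ha; rewrite lt_min => /andP[az1 az].
have a1 : W a <= 1.
  by rewrite -(subrK z a); apply: (le_trans (Wu _ _)); rewrite ge_max (ltW az1).
have lt : W (q.[a] - q.[z]) < W q.[z].
  apply: (@le_lt_trans _ _ (C * W (a - z))); last by rewrite mulrC -ltr_pdivlMr.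
  rewrite !horner_coef -sumrB; apply: (ultra_sum Wa) => // [|i _].
    by rewrite mulr_ge0 // ltW.
  rewrite -mulrBr (absM Wa) ler_pM // subrXX (absM Wa) -[leRHS]mulr1 ler_pM //.
  apply: (ultra_sum Wa) => // j _; rewrite (absM Wa) !(absX Wa).
  by rewrite mulr_ile1 ?exprn_ge0 // exprn_ile1.
have : W q.[a] = W q.[z] by rewrite -(subrK q.[z] q.[a]) (ultra_lt Wa Wu).
have qaK : q.[a] \in K by apply: rpred_horner.
move=> e; rewrite /integral_value -e; apply: Kv => //.
by rewrite -(abs_gt0 Wa) e (abs_gt0 Wa).
Qed.

Lemma gal_cubic_root (K : {subfield N}) (z1 z2 z3 B C : N) g : B \in K -> C \in K ->
  z1 + z2 + z3 = 0 -> z1 * z2 + z1 * z3 + z2 * z3 = B -> z1 * z2 * z3 = - C -> g \in 'Gal({:N} / K)%g -> [\/ g z1 = z1, g z1 = z2 | g z1 = z3].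
Proof.
move=> BK CK h0 h2 h3 gG; have gB := gal_fix gG BK; have gC := gal_fix gG CK.
have r1 : z1 ^+ 3 + B * z1 + C = 0.
  by rewrite -h2 -[C]opprK -h3 (_ : z3 = - z1 - z2); [ring|rewrite -[LHS]subr0 -h0; ring].
have /eqP : (g z1 - z1) * (g z1 - z2) * (g z1 - z3) = 0.
  have := congr1 g r1; rewrite !rmorphD rmorphXn rmorphM /= gB gC rmorph0 => e.
  rewrite -e -h2 -[C]opprK -h3 (_ : z3 = - z1 - z2); [ring|rewrite -[LHS]subr0 -h0; ring].
rewrite !mulf_eq0 !subr_eq0 => /orP[/orP[]|] /eqP ->; by [apply: Or31|apply: Or32|apply: Or33].
Qed.

Section CubicResolvent.
Variables (K : {subfield N}) (z1 z2 z3 B C : N).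
Hypotheses (BK : B \in K) (CK : C \in K) (h0 : z1 + z2 + z3 = 0)
  (h2 : z1 * z2 + z1 * z3 + z2 * z3 = B) (h3 : z1 * z2 * z3 = - C)
  (d12 : z1 != z2) (d13 : z1 != z3) (d23 : z2 != z3).
Hypothesis Kv : forall a, a \in K -> a != 0 -> integral_value W p a.

Local Notation s := ((z1 - z2) * (z1 - z3) * (z2 - z3)).

Let cubic_conjugate g (gG : g \in 'Gal({:N} / K)%g) := gal_cubic_root BK CK h0 h2 h3 gG.

Lemma cubic_adjoin_degree : (adjoin_degree K z1 <= 3)%N.
Proof.
have sz : size ('X^3 + (B *: 'X + C%:P)) = 4%N.
  rewrite size_polyDl size_polyXn // ltnS (leq_trans (size_polyD _ _)) // geq_max.
  by rewrite (leq_trans (size_scale_leq _ _)) ?size_polyX // (leq_trans (size_polyC_leq1 _)).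
have -> : 3%N = (size ('X^3 + (B *: 'X + C%:P))).-1 by rewrite sz.
apply: adjoin_degree_le.
- rewrite !rpredD ?rpredX ?polyOverX ?polyOverC //.
  by rewrite -mul_polyC rpredM ?polyOverX ?polyOverC.
- by rewrite -size_poly_gt0 sz.
have r1 : z1 ^+ 3 + (B * z1 + C) = 0.
  by rewrite -h2 -[C]opprK -h3 (_ : z3 = - z1 - z2); [ring|rewrite -[LHS]subr0 -h0; ring].
by rewrite /root -r1 !hornerD hornerXn hornerZ hornerX hornerC.
Qed.

(** [z2 - z3] is [s] divided by the derivative of the cubic at [z1], and [z2 + z3 = - z1]. *)
Lemma cubic_roots_mem (M : {subfield N}) : (K <= M)%VS -> z1 \in M -> s \in M ->
  z2 \in M /\ z3 \in M.
Proof.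
move=> KM zM sM; have BM := subvP KM _ BK.
have e1 : (z1 - z2) * (z1 - z3) = 3%:R * z1 ^+ 2 + B.
  by rewrite -h2 (_ : z3 = - z1 - z2); [ring|rewrite -[LHS]subr0 -h0; ring].
have nM (k : nat) : k%:R \in M by rewrite rpred_nat.
have n2 : 2%:R != 0 :> N by rewrite -(rmorph_nat (in_alg N)) fmorph_eq0.
have dM : z2 - z3 \in M.
  have -> : z2 - z3 = s / (3%:R * z1 ^+ 2 + B).
    by rewrite -e1 mulrAC mulfV ?mul1r // mulf_neq0 // subr_eq0.
  by rewrite rpred_div // rpredD // rpredM // rpredX.
have e3 : z3 = - z1 - z2 by rewrite -[LHS]subr0 -h0; ring.
have z2M : z2 \in M.
  have -> : z2 = (z2 - z3 - z1) / 2%:R by rewrite e3; field.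
  by rewrite rpred_div // rpredB.
by split=> //; rewrite e3 rpredB // rpredN.
Qed.

Lemma cubic_degree_le x : s ^+ 2 \in K ->
  (forall M : {subfield N}, (K <= M)%VS -> z1 \in M -> z2 \in M -> z3 \in M -> x \in M) ->
  (adjoin_degree K x <= 6)%N.
Proof.
move=> sK xM; rewrite -(leq_pmul2r (adim_gt0 K)) -dim_Fadjoin.
pose M := <<<<K; z1>>; s>>%AS.
have KM : (K <= M)%VS by apply: subv_trans (subv_adjoin _ _); apply: subv_adjoin.
have z1M : z1 \in M by apply: (subvP (subv_adjoin _ _)); apply: memv_adjoin.
have [z2M z3M] := cubic_roots_mem KM z1M (memv_adjoin _ _).
apply: (@leq_trans (\dim M)); first by apply: dimvS; apply/FadjoinP; split=> //; exact: xM.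
rewrite !dim_Fadjoin mulnA leq_pmul2r ?adim_gt0 // -[6%N]/(2 * 3)%N leq_mul ?cubic_adjoin_degree //.
exact/adjoin_degree_sqrt/(subvP (subv_adjoin _ _)).
Qed.

(** With [s] in [K] all roots lie in [K(z1)], whose generator has a value with denominator 3, so
    [tame_extension] applies to [x] directly. *)
Lemma close_pure_cubic k x : coprimez k 3 -> W z1 ^+ 3 = p%:R ^ k -> W z2 = W z1 -> W z3 = W z1 ->
  s \in K -> x \notin K ->
  (forall M : {subfield N}, (K <= M)%VS -> z1 \in M -> z2 \in M -> z3 \in M -> x \in M) ->
  close_conjugates K x.
Proof.
move=> k3 Wz W2 W3 sK xK xM.
have [z2M z3M] := cubic_roots_mem (subv_adjoin _ _) (memv_adjoin _ z1) (subvP (subv_adjoin _ _) _ sK).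
have xz : x \in <<K; z1>>%VS.
  by apply: (xM <<K; z1>>%AS) => //; [exact: subv_adjoin|exact: memv_adjoin].
have Wg g : g \in 'Gal({:N} / K)%g -> W (g z1) = W z1 by case/cubic_conjugate => ->.
have [g gG [gx h]] := tame_extension Kv (ltn0Sn 2) cubic_adjoin_degree Wz k3 Wg xz xK.
by exists 1%g, g; split=> //; rewrite ?fingroup.group1 ?gal_id.
Qed.

(* If all conjugates of [x] lay in [K(z1)], each of them would be fixed by the
   automorphism exchanging [z2] and [z3] and hence by its conjugates, and
   composing these gives every permutation of the roots. *)
Lemma cubic_conjugate_escapes x : s \notin <<K; z1>>%VS -> x \in <<K; z1>>%VS -> x \notin K ->
  exists2 h, h \in 'Gal({:N} / K)%g & h x \notin <<K; z1>>%VS.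
Proof.
move=> sK1 xK1 xK; apply: contrapT => none.
have all h : h \in 'Gal({:N} / K)%g -> h x \in <<K; z1>>%VS.
  by move=> hG; apply: contrapT => /negP hx; apply: none; exists h.
have [g gG gs] := gal_moves (K := <<K; z1>>%AS) sK1.
have gGK : g \in 'Gal({:N} / K)%g by apply: gal_fixP => y yK; apply: (gal_fix gG); apply: (subvP (subv_adjoin K z1)).
have gz1 : g z1 = z1 := gal_fix gG (memv_adjoin K z1).
have gB := gal_fix gGK BK; have gC := gal_fix gGK CK.
have g0 := congr1 g h0; rewrite !rmorphD rmorph0 /= gz1 in g0.
have ginj (a b : N) : g a = g b -> a = b by apply: fmorph_inj.
have [g2 g3] : g z2 = z3 /\ g z3 = z2.
  have h0' : z2 + z1 + z3 = 0 by rewrite [z2 + _]addrC.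
  have h2' : z2 * z1 + z2 * z3 + z1 * z3 = B by rewrite -h2; ring.
  have h3' : z2 * z1 * z3 = - C by rewrite [z2 * _]mulrC.
  have e3 : g z3 = - z1 - g z2 by rewrite -[LHS]subr0 -g0; ring.
  have z3E : z3 = - z1 - z2 by rewrite -[LHS]subr0 -h0; ring.
  have := gal_cubic_root BK CK h0' h2' h3' gGK; case=> e.
  - by case/eqP: gs; rewrite !rmorphM !rmorphB /= e3 e gz1 [in RHS]z3E.
  - by move: d12; rewrite -(ginj z2 z1) ?eqxx // e gz1.
  - by split=> //; rewrite e3 e z3E; ring.
(* The conjugate [t] of [g] by [h] fixes [zj], and it fixes [x] because [h^-1 x] lies in [K(z1)].
   Then [t * g] fixes [x] and sends [z1] to [zk] and on to [zj], so it agrees with [h] on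
   [K(z1)]. *)
have fix_x h zj zk : h \in 'Gal({:N} / K)%g -> h z1 = zj -> g zj = zk -> g zk = zj ->
    zj != z1 -> zk != zj -> (forall y, [\/ y = z1, y = z2 | y = z3] -> [\/ y = z1, y = zj | y = zk]) ->
    h x = x.
  move=> hG hz gj gk j1 kj three.
  pose t := (h^-1 * g * h)%g; have tE y : t y = h (g (h^-1%g y)) by rewrite !galM_all.
  have hVG : h^-1%g \in 'Gal({:N} / K)%g by rewrite fingroup.groupV.
  have tG : t \in 'Gal({:N} / K)%g by rewrite !fingroup.groupM.
  have gfix y : y \in <<K; z1>>%VS -> g y = y by apply: (gal_fix gG).
  have tx : t x = x by rewrite tE gfix ?galKV //; apply: all.
  have tj : t zj = zj by rewrite tE -{1}hz galVK gz1.
  have tk : t z1 = zk.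
    have := cubic_conjugate tG => /three [] // e; last first.
      by move: j1; rewrite -(fmorph_inj t (etrans e (esym tj))) eqxx.
    have {}e : g (h^-1%g z1) = h^-1%g z1 by rewrite -[in RHS]e tE galVK.
    have := cubic_conjugate hVG; case=> e'.
    - by move: j1; rewrite -hz -[in h _]e' galKV eqxx.
    - by move: d23; rewrite -e' -e e' g2 eqxx.
    - by move: d23; rewrite -e' -{1}e e' g3 eqxx.
  rewrite -(@gal_adjoin_eq K (t * g)%g h z1) ?fingroup.groupM //; first by rewrite galM_all tx gfix.
  by rewrite galM_all tk gk hz.
case/negP: xK; apply: contrapT => /negP /gal_moves [h hG /eqP]; apply.
have := cubic_conjugate hG; case=> hz.
- by rewrite (@gal_adjoin_eq K h 1%g z1) ?fingroup.group1 ?gal_id.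
- by apply: (fix_x h z2 z3) => //; [rewrite eq_sym|rewrite eq_sym].
- apply: (fix_x h z3 z2) => //; first by rewrite eq_sym.
  by move=> y [] ->; [apply: Or31|apply: Or33|apply: Or32].
Qed.

(** [z1] is a limit of elements of [K], so the values of [K(z1)] are still integral powers of [p]
    and [s] cannot lie there. A conjugate of [x] outside [K(z1)] lies in the quadratic extension of
    [K(z1)] by [s]. *)
Lemma close_mixed_cubic k x : coprimez k 2 -> s ^+ 2 \in K -> W s ^+ 2 = p%:R ^ k -> W z1 <= 1 ->
  (forall e, 0 < e -> exists2 a, a \in K & W (a - z1) < e) -> x \notin K ->
  (forall M : {subfield N}, (K <= M)%VS -> z1 \in M -> z2 \in M -> z3 \in M -> x \in M) ->
  close_conjugates K x.
Proof.
move=> k2 sK Ws Wz1 za xK xM.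
have K1v := approx_integral_value Kv Wz1 za.
have sK1 : s \notin <<K; z1>>%VS.
  apply/negP => sK1; have s0 : s != 0.
    apply/eqP => s0; move: Ws; rewrite s0 (abs0 Wa) expr0n => /esym/eqP.
    by rewrite expfz_eq0 (gt_eqF pR0) andbF.
  have [m hm] := K1v s sK1 s0; move: Ws; rewrite hm exprnP exprz_exp => /(exprz_inj p1) e.
  by move: k2; rewrite -e coprimezMl andbC.
have [h [hG hx]] : exists h : gal_of {:N}, h \in 'Gal({:N} / K)%g /\ h x \notin <<K; z1>>%VS.
  have [xK1|xK1] := boolP (x \in <<K; z1>>%VS); last by exists 1%g; rewrite fingroup.group1 gal_id.
  by have [h hG hx] := cubic_conjugate_escapes sK1 xK1 xK; exists h.
pose M := <<<<K; z1>>; s>>%AS.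
have KM : (K <= M)%VS by apply: subv_trans (subv_adjoin _ _); apply: subv_adjoin.
have z1M : z1 \in M by apply: (subvP (subv_adjoin _ _)); apply: memv_adjoin.
have [z2M z3M] := cubic_roots_mem KM z1M (memv_adjoin _ _).
have perm_h z : [\/ z = z1, z = z2 | z = z3] -> h z \in M.
  move=> hz; have [->|->|->] // : [\/ h z = z1, h z = z2 | h z = z3].
  case: hz => ->; first exact: cubic_conjugate.
  - have h0' : z2 + z1 + z3 = 0 by rewrite [z2 + _]addrC.
    have h2' : z2 * z1 + z2 * z3 + z1 * z3 = B by rewrite -h2; ring.
    have h3' : z2 * z1 * z3 = - C by rewrite [z2 * _]mulrC.
    have := gal_cubic_root BK CK h0' h2' h3' hG.
    by case=> ->; [apply: Or32|apply: Or31|apply: Or33].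
  have h0' : z3 + z1 + z2 = 0 by rewrite -h0; ring.
  have h2' : z3 * z1 + z3 * z2 + z1 * z2 = B by rewrite -h2; ring.
  have h3' : z3 * z1 * z2 = - C by rewrite -h3; ring.
  have := gal_cubic_root BK CK h0' h2' h3' hG.
  by case=> ->; [apply: Or33|apply: Or31|apply: Or32].
have hxM : h x \in <<<<K; z1>>; s>>%VS.
  (* The hypothesis [xM] speaks of [x] itself, so the field is pulled back along [h]. *)
  have [M' hM'] : exists M' : {subfield N}, forall y, y \in M' <-> h y \in M.
    apply: (subfield_of_set (P := fun y => h y \in M)) => [|a b ha hb|a b ha hb|q a ha].
    - by rewrite rmorph1 rpred1.
    - by rewrite rmorphB rpredB.
    - by rewrite rmorphM rpredM.
    - by rewrite linearZ rpredZ.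
  apply/hM'/xM; try by apply/hM'; apply: perm_h; [apply: Or31|apply: Or32|apply: Or33].
    by apply/subvP => y yK; apply/hM'; rewrite (gal_fix hG yK) (subvP KM).
  - by apply/hM'/perm_h/Or31.
  - by apply/hM'/perm_h/Or32.
  - by apply/hM'/perm_h/Or33.
have sK1' : s ^+ 2 \in <<K; z1>>%AS by apply: (subvP (subv_adjoin _ _)).
have [g gG [gx ineq]] := close_quadratic (K := <<K; z1>>%AS) K1v sK1' Ws k2 hxM hx.
exists h, g; split=> //.
by apply: gal_fixP => y yK; apply: (gal_fix gG); apply: (subvP (subv_adjoin K z1)).
Qed.

End CubicResolvent.

End TameExtensions.

(** * The four conditions on cubic fields *)

(** The hypotheses on the leading coefficients preserve the size of the Sylvester matrix. *)
Lemma resultant_map (aR rR : nzRingType) (f : {rmorphism aR -> rR}) (q r : {poly aR}) :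
  f (lead_coef q) != 0 -> f (lead_coef r) != 0 ->
  f (resultant q r) = resultant (map_poly f q) (map_poly f r).
Proof.
move=> fq fr; rewrite /resultant /Sylvester_mx !size_map_poly_id0 // -det_map_mx map_col_mx.
congr (\det (col_mx _ _)).
  by apply: map_lin1_mx => v; rewrite map_poly_rV rmorphM /= map_rVpoly.
by apply: map_lin1_mx => v; rewrite map_poly_rV rmorphM /= map_rVpoly.
Qed.

(** * The resultant of a cubic and its derivative *)

Section CubicResultant.
Variable T : comNzRingType.

Lemma det_dim m n (A : 'M[T]_m) (f : nat -> nat -> T) : m = n -> (forall i j, A i j = f i j) ->
  \det A = \det (\matrix_(i < n, j < n) f i j).
Proof. by move=> e; case: _ / e => h; congr (\det _); apply/matrixP => i j; rewrite mxE h. Qed.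

(* Unlike [bump], this index shift reduces on numerals, which lets the 5 x 5
   Sylvester determinant be expanded by computation. *)
Fixpoint skip (j k : nat) : nat :=
  if j is j'.+1 then if k is k'.+1 then (skip j' k').+1 else 0 else k.+1.

Lemma skipE j k : skip j k = bump j k.
Proof. by elim: j k => [|j IH] [|k] //=; rewrite IH /bump ltnS addnS. Qed.

Fixpoint laplace_det n (f : nat -> nat -> T) : T :=
  if n is m.+1 then
    foldr (fun j s => (-1) ^+ j * f 0 j * laplace_det m (fun i k => f i.+1 (skip j k)) + s)
      0 (iota 0 m.+1)
  else 1.

Lemma laplace_detE n (f : nat -> nat -> T) :
  \det (\matrix_(i < n, j < n) f i j) = laplace_det n f.
Proof.
elim: n f => [|n IH] f; first by rewrite det_mx00.
rewrite (expand_det_row _ ord0).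
pose t j := (-1) ^+ j * f 0%N j * laplace_det n (fun i k => f i.+1 (skip j k)).
have gen s : foldr (fun j x => t j + x) 0 s = \sum_(j <- s) t j.
  by elim: s => [|j s IHs]; rewrite ?big_nil // big_cons /= IHs.
have -> : laplace_det n.+1 f = \sum_(j <- iota 0 n.+1) t j by rewrite -gen.
rewrite -[iota _ _]/(index_iota 0 n.+1) big_mkord; apply: eq_bigr => j _.
rewrite mxE /cofactor /t -IH mulrCA mulrA add0n; congr (_ * \det _).
by apply/matrixP => i k; rewrite !mxE /= skipE.
Qed.

Lemma resultant_cubic (q r : {poly T}) : size q = 4%N -> size r = 3%N ->
  resultant q r = laplace_det 5 (fun i j => nth 0 (nth [::]
    [:: [:: q`_0; q`_1; q`_2; q`_3; 0]; [:: 0; q`_0; q`_1; q`_2; q`_3];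
        [:: r`_0; r`_1; r`_2; 0; 0]; [:: 0; r`_0; r`_1; r`_2; 0]; [:: 0; 0; r`_0; r`_1; r`_2]] i) j).
Proof.
set F := (fun i j : nat => _) => sq sr; rewrite -laplace_detE.
apply: (@det_dim _ _ _ F) => [|i j]; first by rewrite sq sr.
have q4 k : q`_k.+4 = 0 by rewrite nth_default ?sq.
have r3 k : r`_k.+3 = 0 by rewrite nth_default ?sr.
have j5 : (j < 5)%N by rewrite -[5%N]/(2 + 3)%N -[2%N]/(3.-1) -{1}sr -[3%N]/(4.-1) -sq.
rewrite Sylvester_mxE /=; case: splitP => k ->.
  have : (k < 2)%N by have := ltn_ord k; rewrite [X in (_ < X)%N -> _](_ : _ = 2) ?sr.
  case: (nat_of_ord k) => [|[|//]] _; move: (nat_of_ord j) j5.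
    by case=> [|[|[|[|[|//]]]]] _; rewrite /F /= ?mulr1n ?mulr0n ?q4.
  by case=> [|[|[|[|[|//]]]]] _; rewrite /F /= ?mulr1n ?mulr0n ?q4.
have : (k < 3)%N by have := ltn_ord k; rewrite [X in (_ < X)%N -> _](_ : _ = 3) ?sq.
rewrite [X in F (X + _)%N](_ : _ = 2%N) ?sr //; case: (nat_of_ord k) => [|[|[|//]]] _; move: (nat_of_ord j) j5.
- by case=> [|[|[|[|[|//]]]]] _; rewrite /F /= ?mulr1n ?mulr0n ?r3.
- by case=> [|[|[|[|[|//]]]]] _; rewrite /F /= ?mulr1n ?mulr0n ?r3.
by case=> [|[|[|[|[|//]]]]] _; rewrite /F /= ?mulr1n ?mulr0n ?r3.
Qed.

Lemma resultant_deriv_cubic (a b c : T) : 3%:R != 0 :> T ->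
  let q := ('X - a%:P) * ('X - b%:P) * ('X - c%:P) in
  resultant q q^`() = - ((a - b) * (a - c) * (b - c)) ^+ 2.
Proof.
move=> n3 q; pose e1 := a + b + c; pose e2 := a * b + a * c + b * c; pose e3 := a * b * c.
have qE : q = 'X^3 + (- e1 *: 'X^2 + (e2 *: 'X + (- e3)%:P)).
  rewrite /q -!mul_polyC !polyCN !polyCD !polyCM; ring.
have sq : size q = 4%N.
  rewrite qE size_polyDl size_polyXn // ltnS (leq_trans (size_polyD _ _)) // geq_max.
  rewrite (leq_trans (size_scale_leq _ _)) ?size_polyXn // (leq_trans (size_polyD _ _)) // geq_max.
  by rewrite (leq_trans (size_scale_leq _ _)) ?size_polyX // (leq_trans (size_polyC_leq1 _)).
have [q0 q1 q2 q3] : [/\ q`_0 = - e3, q`_1 = e2, q`_2 = - e1 & q`_3 = 1].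
  by rewrite qE !coefE /= !mulr0 !mulr1 !addr0 !add0r.
have q4 : q`_4 = 0 by rewrite nth_default ?sq.
have sr : size q^`() = 3%N.
  apply/eqP; rewrite eqn_leq; apply/andP; split.
    by rewrite -ltnS -sq lt_size_deriv // -size_poly_eq0 sq.
  by rewrite ltnNge; apply/negP => h; move: n3; rewrite -q3 -coef_deriv nth_default ?eqxx.
rewrite resultant_cubic //.
rewrite !coef_deriv q0 q1 q2 q3 /= /e1 /e2 /e3; ring.
Qed.

End CubicResultant.

Lemma rmorph_ratA (K : fieldExtType rat) (phi : {rmorphism K -> algC}) (a : rat) :
  phi a%:A = ratr a.
Proof. by rewrite -[_%:A]/(in_alg K a) -[LHS]/((phi \o in_alg K) a) fmorph_eq_rat. Qed.

Lemma padic_abs_int (R : realType) (p : nat) (m : int) : prime p -> m != 0 ->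
  algC_abs R (Some p) m%:~R = p%:R ^ (- (logn p `|m|%N)%:Z).
Proof.
move=> pp m0; rewrite -[m%:~R](ratr_int algC) algC_abs_rat //= /padic_abs intr_eq0 (negPf m0).
by rewrite denq_int numq_int logn1 sub0r.
Qed.

(** * The conditions at a totally ramified prime *)

Section PureCubicCase.
Variables (K : fieldExtType rat) (p : nat) (R : realType).
Hypotheses (pp : prime p) (p3 : (3 < p)%N) (d3 : \dim {:K} = 3%N).
Local Notation V := (algC_abs R (Some p)).
Let va : is_abs V. Proof. exact: (@algC_absP R (Some p) pp). Qed.
Let vu : ultrametric V. Proof. exact: algC_abs_ultra. Qed.
Variables (e1 e2 e3 : {rmorphism K -> algC}) (w : K) (B C : int) (k : nat).
Hypotheses
  (all_e : forall phi : {rmorphism K -> algC}, [\/ phi =1 e1, phi =1 e2 | phi =1 e3])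
  (inj_e : forall x, <<1; x>>%VS = fullv -> [/\ e1 x != e2 x, e1 x != e3 x & e2 x != e3 x])
  (norm_e : forall x, exists q, ratr q = e1 x * e2 x * e3 x)
  (ratio_e : forall x y, <<1; x>>%VS = fullv -> exists q : rat,
        (e1 y - e2 y) * (e1 y - e3 y) * (e2 y - e3 y) =
        ratr q * ((e1 x - e2 x) * (e1 x - e3 x) * (e2 x - e3 x))).
Hypotheses (gw : <<1; w>>%VS = fullv) (h0 : e1 w + e2 w + e3 w = 0)
  (h2 : e1 w * e2 w + e1 w * e3 w + e2 w * e3 w = B%:~R) (h3 : e1 w * e2 w * e3 w = - C%:~R)
  (k0 : (0 < k)%N) (k3 : coprimez k%:Z 3%:Z) (VB : V B%:~R <= p%:R ^- k) (VC : V C%:~R = p%:R ^- k).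

Local Notation delta x := ((e1 x - e2 x) * (e1 x - e3 x) * (e2 x - e3 x)).

Let pR0 : 0 < p%:R :> R. Proof. by rewrite ltr0n prime_gt0. Qed.

Lemma delta_w_neq0 : delta w != 0.
Proof. by have [h12 h13 h23] := inj_e gw; rewrite !mulf_neq0 ?subr_eq0. Qed.

(** The conjugates of [w] lie in the image of [iota], so [delta w] comes from some [u] in [K] whose
    square is the rational discriminant. The norm of [u] is rational and equals [delta w ^+ 3] up to
    sign; dividing by the square leaves [delta w]. *)
Lemma delta_w_galois (iota : {rmorphism K -> algC}) :
  galois_over_rat (range iota) -> exists q : rat, delta w = ratr q.
Proof.
move=> [_ gal]; have conj_in (phi : {rmorphism K -> algC}) : exists u, iota u = phi w.
  have [_ /(_ (phi w))] := gal (iota w) (ex_intro2 _ _ w I erefl); case; last by move=> u _ <-; exists u.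
  have [q [eq _] _] := minCpolyP (iota w).
  have : root (minCpoly (iota w)) (iota w) := root_minCpoly _.
  by rewrite eq /root -!rmorph_horner_alg !fmorph_eq0.
have [u1 h1] := conj_in e1; have [u2 hu2] := conj_in e2; have [u3 hu3] := conj_in e3.
pose u := (u1 - u2) * (u1 - u3) * (u2 - u3).
have eu : iota u = delta w by rewrite !rmorphM !rmorphB h1 hu2 hu3.
pose D : rat := - (4%:R * B%:~R ^+ 3 + 27%:R * C%:~R ^+ 2).
have u2E : u ^+ 2 = D%:A.
  apply: (fmorph_inj iota); rewrite rmorph_ratA.
  rewrite rmorphXn /= eu (disc3 h0 h2 h3) /D rmorphN rmorphD (rmorphM _ 4%:R) (rmorphM _ 27%:R) /=.
  by rewrite !rmorphXn /= !ratr_nat !ratr_int.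
have e_u (phi : {rmorphism K -> algC}) : phi u = delta w \/ phi u = - delta w.
  by apply/pred2P; rewrite -eqf_sqr -rmorphXn /= u2E -eu -rmorphXn /= u2E !rmorph_ratA.
have [q hq] := norm_e u; have dD : delta w ^+ 2 = ratr D.
  by rewrite -eu -rmorphXn /= u2E rmorph_ratA.
have [e ee] : exists e : rat, ratr q = ratr e * delta w ^+ 3 /\ e != 0.
  have sgn (phi : {rmorphism K -> algC}) : exists2 e : rat, phi u = ratr e * delta w & e != 0.
    case: (e_u phi) => ->; first by exists 1; rewrite ?rmorph1 ?mul1r.
    by exists (- 1); rewrite ?oppr_eq0 ?oner_eq0 // rmorphN1 mulN1r.
  have [a1 ha1 n1] := sgn e1; have [a2 ha2 n2] := sgn e2; have [a3 ha3 n3] := sgn e3.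
  exists (a1 * a2 * a3); split; last by rewrite !mulf_neq0.
  rewrite hq ha1 ha2 ha3 !rmorphM /=; ring.
have [ee0 en0] := ee; exists (q / (e * D)).
have D0 : ratr D != 0 :> algC by rewrite -dD expf_neq0 // delta_w_neq0.
have en0' : ratr e != 0 :> algC by rewrite fmorph_eq0.
rewrite fmorph_div rmorphM /= ee0 exprS dD.
by move: (delta w) (ratr e) (ratr D) en0' D0 => dl re rD re0 rD0; field; rewrite rD0.
Qed.

(** For [x ^+ 3 = r] the discriminant is [- 27 r ^ 2], with square root [3 r] times a square root of
    -3; [ratio_e] transfers this to [w]. *)
Lemma delta_w_pure : pure_cubic_generator K -> exists (q : rat) (t : algC),
  t ^+ 2 = - 3%:R /\ delta w = ratr q * t.
Proof.
case=> x gx /vlineP [r hr]; have [q hq] := ratio_e w gx.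
have cube (phi : {rmorphism K -> algC}) : phi x ^+ 3 = ratr r.
  by rewrite -rmorphXn /= hr rmorph_ratA.
have [n12 n13 n23] := inj_e gx.
have quad a b : a != b -> a ^+ 3 = ratr r -> b ^+ 3 = ratr r :> algC -> a ^+ 2 + a * b + b ^+ 2 = 0.
  move=> ab ha hb; apply: (@mulfI _ (a - b)); first by rewrite subr_eq0.
  transitivity (a ^+ 3 - b ^+ 3); first by ring.
  by rewrite ha hb subrr mulr0.
have q12 := quad _ _ n12 (cube e1) (cube e2); have q13 := quad _ _ n13 (cube e1) (cube e3).
have s0 : e3 x = - e1 x - e2 x.
  apply: (@mulfI _ (e2 x - e3 x)); first by rewrite subr_eq0.
  apply/eqP; rewrite -subr_eq0; apply/eqP.
  transitivity (e1 x ^+ 2 + e1 x * e2 x + e2 x ^+ 2 - (e1 x ^+ 2 + e1 x * e3 x + e3 x ^+ 2)).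
    by ring.
  by rewrite q12 q13 subrr.
have x0 : e1 x != 0.
  apply/eqP => x0; have := cube e2; rewrite -(cube e1) x0 expr0n => /eqP.
  by rewrite expf_eq0 /= => /eqP h; move: n12; rewrite x0 h eqxx.
have dx : delta x ^+ 2 = - 27%:R * (e1 x ^+ 3) ^+ 2.
  transitivity ((e1 x ^+ 2 + e1 x * e2 x + e2 x ^+ 2 - 3%:R * e1 x * e2 x) *
      (2%:R * (e1 x ^+ 2 + e1 x * e2 x + e2 x ^+ 2) + 3%:R * e1 x * e2 x) ^+ 2).
    by rewrite s0; ring.
  have c12 : e1 x ^+ 3 = e2 x ^+ 3 by rewrite !cube.
  by rewrite q12 [in RHS]expr2 {2}c12; ring.
exists (q * (3%:R * r)), (delta x / (3%:R * ratr r)); split.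
  have r0 : ratr r != 0 :> algC by rewrite -(cube e1) expf_neq0.
  by rewrite expr_div_n dx cube; field.
rewrite hq !rmorphM /= ratr_nat.
have r0 : ratr r != 0 :> algC by rewrite -(cube e1) expf_neq0.
by move: (delta x) => dl; field.
Qed.

(** [delta x] is a rational multiple of [delta w]; consequently the discriminant of every generator
    has an even exponent of [p]. *)
Lemma pure_value_even (x : K) : <<1; x>>%VS = fullv -> exists m : int, V (delta x) = p%:R ^ m.
Proof.
move=> gx; have [q hq] := ratio_e x gw; have [n12 n13 n23] := inj_e gx.
have dx0 : delta x != 0 by rewrite !mulf_neq0 ?subr_eq0.
have q0 : q != 0 by apply: contraNneq dx0 => q0; rewrite hq q0 rmorph0 mul0r.
have [m hm] := padic_abs_rat_value R pp q0; exists (m - k%:Z).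
have [_ Vd] := cubic_pure_values pp p3 k0 h0 h2 h3 VB VC.
by rewrite hq (absM va) hm Vd expfzDr ?gt_eqF // -exprnN.
Qed.

(** Up to sign the discriminant of [D] is the square of [delta x], whose value is an integral power
    of [p]. *)
Lemma odd_disc_impossible : ~ odd_disc_generator K p.
Proof.
case=> x [D [gx xi eD odd]].
have [m hm] := pure_value_even gx.
have inj0 (i : int) : (i%:~R == 0 :> K) = (i == 0).
  by rewrite -(rmorph_int (in_alg K)) fmorph_eq0 intr_eq0.
have D0' : (lead_coef D)%:~R != 0 :> K.
  rewrite inj0 lead_coef_eq0; apply/eqP => D0; have := monic_minPoly 1 x.
  by rewrite -eD D0 rmorph0 monicE lead_coef0 eq_sym oner_eq0.
have sD : size D = 4%N.
  by rewrite -(size_map_poly_id0 D0') eD size_minPoly adjoin_degreeE gx d3 dimv1.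
have lD : lead_coef D = 1.
  apply/eqP; rewrite -subr_eq0 -inj0 rmorphB /= -lead_coef_map_id0 ?rmorph0 // eD.
  by rewrite (monicP (monic_minPoly _ _)) rmorph1 subrr.
have eq : map_poly intr D = ('X - (e1 x)%:P) * ('X - (e2 x)%:P) * ('X - (e3 x)%:P) :> {poly algC}.
  have rt (phi : {rmorphism K -> algC}) : root (map_poly intr D) (phi x).
    have := root_minPoly 1 x; rewrite -eD => /(rmorph_root phi).
    by rewrite -map_poly_comp (eq_map_poly (g := intr)) // => i /=; rewrite rmorph_int.
  have [n12 n13 n23] := inj_e gx.
  have sD' : size (map_poly intr D : {poly algC}) = 4%N.
    by rewrite size_map_poly_id0 ?sD // lD rmorph1 oner_eq0.
  have hu : uniq_roots [:: e1 x; e2 x; e3 x] by rewrite uniq_rootsE /= !inE !negb_or n12 n13 n23.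
  have ha : all (root (map_poly intr D)) [:: e1 x; e2 x; e3 x] by rewrite /= !rt.
  rewrite (all_roots_prod_XsubC (rs := [:: e1 x; e2 x; e3 x]) sD' ha hu) lead_coef_map_id0 ?lD ?rmorph1 ?oner_eq0 // scale1r !big_cons big_nil mulr1 mulrA //.
have hdisc : V (poly_disc D)%:~R = V (delta x) ^+ 2.
  have eD' : map_poly (intr : int -> algC) D^`() = (map_poly intr D)^`() by rewrite deriv_map.
  have n3 : 3%:R != 0 :> algC by rewrite pnatr_eq0.
  rewrite /poly_disc intrM (absM va) rmorphXn /= (absX va) rmorphN1 absN // (abs1 va) expr1n mul1r.
  have -> : (resultant D D^`())%:~R = - delta x ^+ 2 :> algC.
    rewrite -(resultant_deriv_cubic _ _ _ n3) -eq -eD'.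
    apply: (resultant_map (f := intr)); rewrite ?lD ?rmorph1 ?oner_eq0 //.
    rewrite intr_eq0 lead_coef_eq0; apply/eqP => h; have := coef_deriv D 2.
    have -> : D`_3 = 1 by rewrite -lD lead_coefE sD.
    by rewrite h coef0.
  by rewrite absN // (absX va).
have D0 : poly_disc D != 0.
  have [n12 n13 n23] := inj_e gx.
  apply/eqP => D0; move/eqP: hdisc; rewrite D0 (abs0 va) eq_sym expf_eq0 /= (abs_eq0 va) !mulf_eq0 !subr_eq0.
  by rewrite (negPf n12) (negPf n13) (negPf n23).
case/negP: odd; move: hdisc; rewrite hm padic_abs_int // exprnP exprz_exp => /(exprz_inj (prime_gt1 pp)).
move: (logn _ _) => L e; apply/dvdnP; exists `|m|%N; lia.
Qed.

Lemma pure_value_all (phi : {rmorphism K -> algC}) : V (phi w) ^+ 3 = p%:R ^ (- k%:Z).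
Proof.
rewrite -exprnN; case: (all_e phi) => ->.
- by have [] := cubic_pure_values pp p3 k0 h0 h2 h3 VB VC.
- have [|||//] := @cubic_pure_values p R pp p3 (e2 w) (e1 w) (e3 w) B C k k0 _ _ _ VB VC.
  + by rewrite -h0; ring.
  + by rewrite -h2; ring.
  + by rewrite -h3; ring.
- have [|||//] := @cubic_pure_values p R pp p3 (e3 w) (e1 w) (e2 w) B C k k0 _ _ _ VB VC.
  + by rewrite -h0; ring.
  + by rewrite -h2; ring.
  + by rewrite -h3; ring.
Qed.

(** With rational coefficients, [tame_difference] bounds the difference of two conjugates of an
    integral [y] by [p ^ (-1/3)]. *)
Lemma pure_congruent (phi psi : {rmorphism K -> algC}) y : V (phi y) <= 1 -> V (psi y) <= 1 ->
  V (phi y - psi y) < 1.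
Proof.
move=> V1 V2; have : y \in <<1; w>>%VS by rewrite gw memvf.
move=> yw; have ey := Fadjoin_poly_eq yw; set q := Fadjoin_poly _ _ _ in ey.
have /polyOver1P [g eg] : q \is a polyOver 1%VS by apply: Fadjoin_polyOver.
have sg : (size g <= 3)%N.
  rewrite -(size_map_poly (in_alg K)) -eg (leq_trans (size_Fadjoin_poly _ _ _)) //.
  by rewrite adjoin_degreeE gw d3 dimv1.
have exp (f : {rmorphism K -> algC}) : f y = \sum_(i < 3) ratr g`_i * f w ^+ i.
  rewrite -ey eg rmorph_horner_alg (horner_coef_wide (n := 3)) ?size_map_poly //.
  by apply: eq_bigr => i _; rewrite coef_map.
have cop : coprimez (- k%:Z) 3%N by rewrite /coprimez gcdNz.
have Vw : V (phi w) = V (psi w).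
  by apply/eqP; rewrite -(@eqrXn2 _ 3) ?(abs_ge0 va) // !pure_value_all.
have ai (i : 'I_3) : ratr g`_i != 0 :> algC -> integral_value V p (ratr g`_i).
  by move=> g0; apply: padic_abs_rat_value => //; apply: contraNneq g0 => ->; rewrite rmorph0.
have := tame_difference va vu (prime_gt1 pp) (ltn0Sn 2) ai Vw (pure_value_all psi) cop (exp psi) (exp phi).
rewrite !max_l // mulr1 expr1n => le; rewrite ltNge; apply/negP => h.
have : 1 < V (phi y - psi y) ^+ 3 * p%:R.
  by apply: (@lt_le_trans _ _ p%:R); rewrite ?ltr1n ?prime_gt1 // ler_peMl ?(ltW pR0) // exprn_ege1.
by rewrite ltNge le.
Qed.

(* Both [x / c] and [b0 * c / x] are roots of a trinomial [y ^+ 3 + A * y + b0];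
   the conjugates of an integer are congruent modulo the primes over [p], so
   that [p] divides [A] and [b0]. *)
Lemma special_impossible : ~ special_cubic_generator K.
Proof.
case=> x [l [a0 [b0 [c [gx hl cop rx]]]]].
have [u [A [gu eu hA]]] : exists (u : K) (A : int), [/\ <<1; u>>%VS = fullv,
    u ^+ 3 + A%:~R * u + b0%:~R = 0 & A = a0 * c \/ A = a0 * c ^+ 2].
  have ex : x ^+ 3 + (a0 * c ^+ 3)%:~R * x ^+ l + (b0 ^+ l * c ^+ 3)%:~R = 0.
    move: rx => /eqP; rewrite !rmorphD /= map_polyXn map_polyZ map_polyXn map_polyC /=.
    by rewrite !hornerD hornerZ !hornerXn hornerC.
  have inj0 (i : int) : (i%:~R == 0 :> K) = (i == 0).
    by rewrite -(rmorph_int (in_alg K)) fmorph_eq0 intr_eq0.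
  have c0 : c%:~R != 0 :> K.
    rewrite inj0; apply: contraTneq cop => ->; rewrite mulr0 /coprimez gcd0z abszM.
    by rewrite eqz_nat muln_eq1.
  have b00 : b0%:~R != 0 :> K.
    rewrite inj0; apply: contraTneq cop => ->; rewrite mulr0 /coprimez gcdz0 !abszM.
    by rewrite eqz_nat !muln_eq1.
  have intm (M : {subfield K}) (i : int) : i%:~R \in M by rewrite rpred_int.
  have gen u : x \in <<1; u>>%VS -> <<1; u>>%VS = fullv.
    move=> xu; apply/eqP; rewrite eqEsubv subvf /= -gx.
    by apply/FadjoinP; split=> //; apply: sub1v.
  case: hl ex => -> ex.
    exists (x / c%:~R), (a0 * c); split; last by left.
      apply: gen; rewrite -{1}[x](divfK c0) rpredM ?memv_adjoin //; exact: (intm <<1; _>>%AS).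
    move: ex; rewrite !intrM !expr1 => ex.
    have : x ^+ 3 + a0%:~R * c%:~R ^+ 3 * x + b0%:~R * c%:~R ^+ 3 = 0 by rewrite -[RHS]ex.
    move=> {}ex.
    transitivity ((x ^+ 3 + a0%:~R * c%:~R ^+ 3 * x + b0%:~R * c%:~R ^+ 3) / c%:~R ^+ 3); first by field.
    by rewrite ex mul0r.
  have x0 : x != 0.
    apply/eqP => x0; move: ex; rewrite x0 !expr0n mulr0 !add0r => /eqP.
    by rewrite inj0 mulf_eq0 !expf_eq0 /= -!inj0 (negPf c0) (negPf b00).
  exists (b0%:~R * c%:~R / x), (a0 * c ^+ 2); split; last by right.
    apply: gen; have {1}-> : x = b0%:~R * c%:~R / (b0%:~R * c%:~R / x) by field; rewrite x0 b00 c0.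
    by rewrite rpred_div ?memv_adjoin // rpredM //; exact: (intm <<1; _>>%AS).
  have {}ex : x ^+ 3 + a0%:~R * c%:~R ^+ 3 * x ^+ 2 + b0%:~R ^+ 2 * c%:~R ^+ 3 = 0.
    by rewrite -[RHS]ex !intrM.
  transitivity (b0%:~R * (x ^+ 3 + a0%:~R * c%:~R ^+ 3 * x ^+ 2 + b0%:~R ^+ 2 * c%:~R ^+ 3) / x ^+ 3).
    by rewrite !intrM; field.
  by rewrite ex mulr0 mul0r.
have eq (phi : {rmorphism K -> algC}) : phi u ^+ 3 + A%:~R * phi u + b0%:~R = 0.
  by have := congr1 phi eu; rewrite !rmorphD rmorphXn rmorphM /= !rmorph_int rmorph0.
have V1 (phi : {rmorphism K -> algC}) : V (phi u) <= 1.
  by apply: abs_Aint_le1 => //; apply: cubic_Aint (eq phi).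
have [n12 n13 n23] := inj_e gu.
have quad a b : a != b -> a ^+ 3 + A%:~R * a + b0%:~R = 0 -> b ^+ 3 + A%:~R * b + b0%:~R = 0 ->
    a ^+ 2 + a * b + b ^+ 2 + A%:~R = 0 :> algC.
  move=> ab ha hb; apply: (@mulfI _ (a - b)); first by rewrite subr_eq0.
  transitivity ((a ^+ 3 + A%:~R * a + b0%:~R) - (b ^+ 3 + A%:~R * b + b0%:~R)); first by ring.
  by rewrite ha hb subrr mulr0.
have q12 := quad _ _ n12 (eq e1) (eq e2); have q13 := quad _ _ n13 (eq e1) (eq e3).
have s0 : e3 u = - e1 u - e2 u.
  apply: (@mulfI _ (e2 u - e3 u)); first by rewrite subr_eq0.
  apply/eqP; rewrite -subr_eq0; apply/eqP.
  transitivity (e1 u ^+ 2 + e1 u * e2 u + e2 u ^+ 2 + A%:~R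
     - (e1 u ^+ 2 + e1 u * e3 u + e3 u ^+ 2 + A%:~R)); first by ring.
  by rewrite q12 q13 subrr.
have c12 := pure_congruent (V1 e1) (V1 e2); have c13 := pure_congruent (V1 e1) (V1 e3).
(* The conjugates of [u] sum to 0, so [3 * e1 u] is the sum of two small differences. *)
have u1 : V (e1 u) < 1.
  have -> : V (e1 u) = V (3%:R * e1 u) by rewrite (absM va) (padic_abs_small R pp p3 (k := 3) isT) mul1r.
  have -> : 3%:R * e1 u = (e1 u - e2 u) + (e1 u - e3 u) by rewrite s0; ring.
  by apply: (le_lt_trans (vu _ _)); rewrite gt_max c12.
have u2 : V (e2 u) < 1.
  have -> : e2 u = e1 u + - (e1 u - e2 u) by ring.
  by apply: (le_lt_trans (vu _ _)); rewrite gt_max u1 absN.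
have sq_lt1 (y z : algC) : V y < 1 -> V z < 1 -> V (y * z) < 1.
  by move=> hy hz; rewrite (absM va) mulr_ilt1 ?(abs_ge0 va).
have pA : (p%:Z %| A)%Z.
  apply: (padic_abs_int_dvd pp (R := R)).
  have -> : A%:~R = - (e1 u * e1 u) + - (e1 u * e2 u) + - (e2 u * e2 u).
    by apply/eqP; rewrite -subr_eq0 -q12; apply/eqP; ring.
  by apply: (le_lt_trans (vu _ _)); rewrite gt_max !absN // sq_lt1 // andbT;
    apply: (le_lt_trans (vu _ _)); rewrite gt_max !absN // !sq_lt1.
have pb : (p%:Z %| b0)%Z.
  apply: (padic_abs_int_dvd pp (R := R)).
  have -> : b0%:~R = - (e1 u * (e1 u * e1 u + A%:~R)).
    by apply/eqP; rewrite -subr_eq0 -(eq e1); apply/eqP; ring.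
  rewrite absN // (absM va); apply: (le_lt_trans _ u1); rewrite ler_piMr ?(abs_ge0 va) //.
  by apply: (le_trans (vu _ _)); rewrite ge_max ultra_int // ltW // sq_lt1.
(* Either form of [A] makes [p] divide [a0 * c], against the coprimality in the condition. *)
have pac : (p%:Z %| 2 * a0 * c)%Z.
  rewrite -mulrA dvdz_mull //; case: hA => eA; first by rewrite -eA.
  move: pA; rewrite eA !dvdzE /= !abszM !Euclid_dvdM //.
  by case/orP=> [->//|/orP[] ->]; rewrite orbT.
have p3b : (p%:Z %| 3 * b0)%Z by rewrite dvdz_mull.
have : (p%:Z %| gcdz (2 * a0 * c) (3 * b0))%Z by rewrite dvdz_gcd pac.
by rewrite (eqP cop) dvdzE /= Euclid_dvd1.
Qed.

End PureCubicCase.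

(** * One step of the tower *)

Section RationalApproximation.
Variables (p : nat) (R : realType).
Hypotheses (pp : prime p).
Local Notation V := (algC_abs R (Some p)).
Let va : is_abs V. Proof. exact: (@algC_absP R (Some p) pp). Qed.
Let vu : ultrametric V. Proof. exact: algC_abs_ultra. Qed.

(* The small root is the fixed point of the contraction [q |-> - (C + q ^+ 3) / B]. *)
Lemma cubic_rational_approx (B C : int) (z : algC) : z ^+ 3 + B%:~R * z + C%:~R = 0 ->
  V B%:~R = p%:R^-1 -> V z <= p%:R^-1 ->
  forall e, 0 < e -> exists q : rat, V (ratr q - z) < e.
Proof.
move=> ez VB Vz e e0.
have pR1 : 1 < p%:R :> R by rewrite ltr1n prime_gt1.
have pR0 : 0 < p%:R :> R by apply: lt_trans pR1.
have B0 : B%:~R != 0 :> algC by rewrite -(abs_gt0 va) VB invr_gt0.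
pose q n : rat := iter n (fun q => - (C%:~R + q ^+ 3) / B%:~R) 0.
have Vq n : V (ratr (q n) - z) <= p%:R^-1 ^+ n.+1.
  elim: n => [|n IH]; first by rewrite rmorph0 sub0r absN.
  have step : ratr (q n.+1) - z = - ((ratr (q n) - z) *
      (ratr (q n) ^+ 2 + ratr (q n) * z + z ^+ 2)) / B%:~R.
    rewrite /= fmorph_div rmorphN rmorphD rmorphXn /= !ratr_int.
    apply: (mulIf B0); rewrite mulrBl !divfK //.
    have -> : z * B%:~R = - (C%:~R + z ^+ 3) by apply/eqP; rewrite -subr_eq0 -ez; apply/eqP; ring.
    by ring.
  have Vqn : V (ratr (q n)) <= p%:R^-1.
    rewrite -(subrK z (ratr _)); apply: (le_trans (vu _ _)); rewrite ge_max Vz andbT.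
    apply: (le_trans IH); rewrite exprS ler_piMr ?invr_ge0 ?(ltW pR0) // exprn_ile1 ?invr_ge0 ?(ltW pR0) //.
    by rewrite invf_le1 // ltW.
  have Vs (a b : algC) : V a <= p%:R^-1 -> V b <= p%:R^-1 -> V (a * b) <= p%:R^-1 ^+ 2.
    by move=> ha hb; rewrite (absM va) expr2 ler_pM ?(abs_ge0 va).
  rewrite step (absM va) (absV va) VB invrK absN // (absM va).
  have -> : p%:R^-1 ^+ n.+2 = p%:R^-1 ^+ n.+1 * p%:R^-1 ^+ 2 * p%:R :> R.
    by rewrite exprSr expr2 -!mulrA mulVf ?gt_eqF // mulr1.
  rewrite ler_wpM2r ?(ltW pR0) // ler_pM ?(abs_ge0 va) //.
  by apply: (le_trans (vu _ _)); rewrite ge_max Vs // andbT;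
    apply: (le_trans (vu _ _)); rewrite ge_max !Vs.
have [|n hn] := geometric_small (t := p%:R^-1) _ e0.
  by rewrite invr_ge0 (ltW pR0) invf_lt1.
by exists (q n); apply: (le_lt_trans (Vq n)); apply: hn.
Qed.

End RationalApproximation.

Section TowerStep.
Variables (R : realType) (F : nat -> fieldExtType rat) (p n : nat).
Hypotheses (pp : prime p) (p3 : (3 < p)%N) (hdeg : (\dim {: F n} <= 3)%N)
  (punr : forall j, (j < n)%N -> ~~ (p%:Z %| discr (F j))%Z)
  (D0 : discr (F n) != 0) (pD : (p%:Z %| discr (F n))%Z)
  (cond : [\/ (exists iota : {rmorphism F n -> algC}, galois_over_rat (range iota)),
           pure_cubic_generator (F n), odd_disc_generator (F n) p
         | special_cubic_generator (F n)]).
Variables (N : splittingFieldType rat) (phi : {rmorphism N -> algC}) (K : {subfield N}).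
Hypotheses (hN : forall x, tower F n.+1 x -> exists y, phi y = x)
  (hK : forall x, x \in K <-> tower F n (phi x)).
Local Notation V := (algC_abs R (Some p)).
Let va : is_abs V. Proof. exact: (@algC_absP R (Some p) pp). Qed.
Let vu : ultrametric V. Proof. exact: algC_abs_ultra. Qed.
Let W : N -> R := fun x => V (phi x).

Let Wa : is_abs W.
Proof.
split=> [x|x|x y|x y]; first exact: (abs_ge0 va).
- split=> [/eqP|->]; last by rewrite /W rmorph0 (abs0 va).
  by rewrite /W (abs_eq0 va) fmorph_eq0 => /eqP.
- by rewrite /W rmorphM (absM va).
- by rewrite /W rmorphD; apply: (absD va).
Qed.

Let Wu : ultrametric W. Proof. by move=> x y; rewrite /W rmorphD; apply: vu. Qed.

Let Kv a : a \in K -> a != 0 -> integral_value W p a.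
Proof. by move=> /hK ta a0; apply: tower_value ta _ => //; rewrite fmorph_eq0. Qed.

(** Over [tower F n] the next level is generated by the conjugates of a single generator of
    [F n]. *)
Lemma tower_in_subfield (M : {subfield N}) (w : F n) : (K <= M)%VS -> <<1; w>>%VS = fullv ->
  (forall f : {rmorphism F n -> algC}, exists2 m, m \in M & phi m = f w) ->
  forall x, tower F n.+1 (phi x) -> x \in M.
Proof.
move=> KM gw hw.
suff le : tower F n.+1 `<=` [set y | exists2 m, m \in M & phi m = y].
  by move=> x /le [m mM /fmorph_inj <-].
apply: smallest_sub.
  split; first by exists 1; rewrite ?rpred1 ?rmorph1.
    by move=> _ _ [a aM <-] [b bM <-]; exists (a - b); rewrite ?rpredB ?rmorphB.
  by move=> _ _ [a aM <-] [b bM <-]; exists (a / b); rewrite ?rpred_div ?fmorph_div.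
have inK y : tower F n y -> exists2 m, m \in M & phi m = y.
  move=> ty; have [m em] := hN (towerS (leqnSn n) ty).
  by exists m => //; apply: (subvP KM); apply/hK; rewrite em.
move=> x [h|[j [k [y [jn ->]]]]]; first by apply: inK; apply: tower_mem; left.
have [jn'|] := ltnP j n; first by apply: inK; apply: tower_mem; right; exists j, k, y.
rewrite leq_eqVlt ltnNge -ltnS jn orbF => /eqP ej; case: _ / ej in k y jn *.
have [m mM em] := hw (emb k).
have : y \in <<1; w>>%VS by rewrite gw memvf.
move=> /Fadjoin_polyP [q /polyOver1P [g ->] ->].
exists (map_poly (in_alg N) g).[m]; last by rewrite !rmorph_horner_alg em.
apply: rpred_horner => //; apply/polyOverP => i; rewrite coef_map /=.
by rewrite rpredZ ?rpred1.
Qed.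

Let emb_in_N (f : {rmorphism F n -> algC}) y : exists m, phi m = f y.
Proof.
have [k hk] := emb_all f; apply: hN; apply: tower_mem; right.
by exists n, k, y; rewrite hk.
Qed.

Let rat_in_K (q : rat) m : phi m = ratr q -> m \in K.
Proof. by move=> h; apply/hK; rewrite h; apply: sfield_rat; apply: tower_subfield. Qed.

Lemma tower_close_quadratic x : \dim {: F n} = 2%N -> tower F n.+1 (phi x) -> x \notin K ->
  close_conjugates W p K x /\ (adjoin_degree K x <= 6)%N.
Proof.
move=> d2 tx xK; have [z [gz /vlineP [a ea] Vz]] := ramified_quadratic R pp p3 D0 pD d2.
have [e1 [e2 _]] := conjugates2 d2; have [s es] := emb_in_N e1 z.
have sq (f : {rmorphism F n -> algC}) : f z ^+ 2 = ratr a by rewrite -rmorphXn /= ea rmorph_ratA.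
have sK : s ^+ 2 \in K by apply: (rat_in_K (q := a)); rewrite rmorphXn /= es sq.
have Ws : W s ^+ 2 = p%:R ^ (- 1) by rewrite /W es Vz.
have xs : x \in <<K; s>>%VS.
  apply: (@tower_in_subfield <<K; s>>%AS z) => // [|f]; first exact: subv_adjoin.
  have /pred2P [fz|fz] : (f z == e1 z) || (f z == - e1 z) by rewrite -eqf_sqr !sq.
    by exists s; rewrite ?memv_adjoin // fz.
  by exists (- s); rewrite ?rpredN ?memv_adjoin // rmorphN es fz.
split.
  have [g gG [gx h]] := close_quadratic Wa Wu (prime_gt1 pp) Kv sK Ws isT xs xK.
  by exists 1%g, g; split=> //; rewrite ?fingroup.group1 ?gal_id.
by apply: (leq_trans (adjoin_degree_mem xs)); apply: (leq_trans (adjoin_degree_sqrt sK)).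
Qed.

Lemma tower_close_cubic x : \dim {: F n} = 3%N -> tower F n.+1 (phi x) -> x \notin K ->
  close_conjugates W p K x /\ (adjoin_degree K x <= 6)%N.
Proof.
move=> d3 tx xK; have [w [B [C [gw rel cases]]]] := ramified_cubic_values R pp p3 D0 pD d3.
have [e1 [e2 [e3 [te all_e inj_e norm_e ratio_e]]]] := conjugates3 d3.
have [h0 h2 h3] := rel _ _ _ te; have [n12 n13 n23] := inj_e w gw.
have [z1 ez1] := emb_in_N e1 w; have [z2 ez2] := emb_in_N e2 w; have [z3 ez3] := emb_in_N e3 w.
have z0 : z1 + z2 + z3 = 0.
  by apply: (fmorph_inj phi); rewrite !rmorphD ez1 ez2 ez3 rmorph0.
have zB : z1 * z2 + z1 * z3 + z2 * z3 = B%:~R.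
  by apply: (fmorph_inj phi); rewrite !rmorphD !rmorphM ez1 ez2 ez3 rmorph_int.
have zC : z1 * z2 * z3 = - C%:~R.
  by apply: (fmorph_inj phi); rewrite !rmorphM ez1 ez2 ez3 rmorphN rmorph_int.
have d12 : z1 != z2 by rewrite -(inj_eq (fmorph_inj phi)) ez1 ez2.
have d13 : z1 != z3 by rewrite -(inj_eq (fmorph_inj phi)) ez1 ez3.
have d23 : z2 != z3 by rewrite -(inj_eq (fmorph_inj phi)) ez2 ez3.
have BK : B%:~R \in K by rewrite rpred_int.
have CK : C%:~R \in K by rewrite rpred_int.
have xM (M : {subfield N}) : (K <= M)%VS -> z1 \in M -> z2 \in M -> z3 \in M -> x \in M.
  move=> KM m1 m2 m3; apply: (tower_in_subfield KM gw) => // f.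
  by case: (all_e f) => ->; [exists z1|exists z2|exists z3].
have discK a b c : a + b + c = 0 -> a * b + a * c + b * c = B%:~R -> a * b * c = - C%:~R :> N ->
    ((a - b) * (a - c) * (b - c)) ^+ 2 \in K.
  move=> s0 s2 s3; apply: (rat_in_K (q := - (4%:R * B%:~R ^+ 3 + 27%:R * C%:~R ^+ 2))).
  rewrite rmorphXn !rmorphM !rmorphB /= (@disc3 _ _ _ B%:~R C%:~R).
  - rewrite rmorphN rmorphD (rmorphM _ 4%:R) (rmorphM _ 27%:R) /=.
    by rewrite !rmorphXn /= !ratr_nat !ratr_int.
  - by rewrite -!rmorphD s0 rmorph0.
  - by rewrite -!rmorphM -!rmorphD s2 rmorph_int.
  - by rewrite -!rmorphM s3 rmorphN rmorph_int.
have p1 := prime_gt1 pp.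
case: cases => [[k [k3 k0 VB VC]]|[VB VC]].
  split; last exact: (cubic_degree_le BK CK z0 zB zC d12 d13 (discK _ _ _ z0 zB zC) xM).
  have Vall := pure_value_all pp p3 all_e h0 h2 h3 k0 VB VC.
  have Weq (f g : {rmorphism F n -> algC}) : V (f w) = V (g w).
    by apply/eqP; rewrite -(@eqrXn2 _ 3) ?(abs_ge0 va) // !Vall.
  apply: (close_pure_cubic Wa Wu p1 BK CK z0 zB zC d12 d13 Kv (k := - k%:Z)) => //.
  - by rewrite /coprimez gcdNz.
  - by rewrite /W ez1 Vall.
  - by rewrite /W ez2 ez1 (Weq e2 e1).
  - by rewrite /W ez3 ez1 (Weq e3 e1).
  (* It remains to place [delta w] in [tower F n]: it is rational in the Galois case and a rational
     multiple of a square root of -3 in the pure case, while the other two conditions exclude this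
     kind of ramification. *)
  apply/hK; rewrite !rmorphM !rmorphB ez1 ez2 ez3.
  case: cond => [[iota gal]|pure|odd|special].
  - have [q ->] := delta_w_galois inj_e norm_e gw h0 h2 h3 gal.
    by apply: sfield_rat; apply: tower_subfield.
  - have [q [t [t2 ->]]] := delta_w_pure w inj_e ratio_e pure.
    apply: (sfieldM (tower_subfield F n)); first exact: (sfield_rat (tower_subfield F n)).
    by apply: tower_mem; left.
  - by case: (odd_disc_impossible (R := R) pp p3 d3 inj_e ratio_e gw h0 h2 h3 k0 k3 VB VC).
  - by case: (special_impossible (R := R) pp p3 d3 all_e inj_e gw h0 h2 h3 k0 k3 VB VC).
(* Stated for any ordering of the roots, since the small one can be any of the three. *)
have mixed a b c : a + b + c = 0 -> a * b + a * c + b * c = B%:~R -> a * b * c = - C%:~R :> N ->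
    a != b -> a != c -> b != c -> W a <= p%:R^-1 ->
    (forall M : {subfield N}, (K <= M)%VS -> a \in M -> b \in M -> c \in M -> x \in M) ->
    close_conjugates W p K x /\ (adjoin_degree K x <= 6)%N.
  move=> s0 s2 s3 ab ac bc Wx xM'; have sK := discK _ _ _ s0 s2 s3.
  split; last exact: (cubic_degree_le BK CK s0 s2 s3 ab ac sK xM').
  have q0 : phi a + phi b + phi c = 0 by rewrite -!rmorphD s0 rmorph0.
  have q2 : phi a * phi b + phi a * phi c + phi b * phi c = B%:~R.
    by rewrite -!rmorphM -!rmorphD s2 rmorph_int.
  have q3 : phi a * phi b * phi c = - C%:~R by rewrite -!rmorphM s3 rmorphN rmorph_int.
  apply: (close_mixed_cubic Wa Wu p1 BK CK s0 s2 s3 ab ac bc Kv (k := - 3%:Z)) => //.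
  - have := cubic_small_root pp p3 q0 q2 q3 VB VC Wx.
    by rewrite /W !rmorphM !rmorphB.
  - by apply: (le_trans Wx); rewrite invf_le1 ?ler1n ?ltr0n ?prime_gt0.
  move=> e e0; have [q hq] := cubic_rational_approx pp (cubic_root3 q0 q2 q3) VB Wx e0.
  exists q%:A; first by rewrite rpredZ ?rpred1.
  by rewrite /W rmorphB rmorph_ratA.
case: (cubic_has_small_root pp h0 h2 h3 VB VC) => small.
- by apply: (mixed z1 z2 z3) => //; rewrite /W ez1.
- apply: (mixed z2 z1 z3); rewrite ?[z2 == z1]eq_sym //; last by move=> M KM m2 m1 m3; apply: xM.
  + by rewrite -z0; ring.
  + by rewrite -zB; ring.
  + by rewrite -zC; ring.
  + by rewrite /W ez2.
apply: (mixed z3 z1 z2); rewrite ?[z3 == _]eq_sym //; last by move=> M KM m3 m1 m2; apply: xM.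
- by rewrite -z0; ring.
- by rewrite -zB; ring.
- by rewrite -zC; ring.
by rewrite /W ez3.
Qed.

Lemma tower_close x : tower F n.+1 (phi x) -> x \notin K ->
  close_conjugates W p K x /\ (adjoin_degree K x <= 6)%N.
Proof.
case: (ltngtP (\dim {: F n}) 2) => [d1|d3|]; last exact: tower_close_quadratic.
  case: (ramified_dim pp D0 pD); apply/eqP; rewrite eqn_leq -ltnS d1 /=; exact: adim_gt0.
by apply: tower_close_cubic; apply/eqP; rewrite eqn_leq hdeg.
Qed.

End TowerStep.

(** * A lower bound for heights *)

Section GaloisOrbits.
Variables (N : splittingFieldType rat) (iota : {rmorphism N -> algC}) (y : N).
Variables (K : fieldExtType rat) (f0 : {rmorphism K -> algC}) (x : K).
Hypotheses (gx : <<1; x>>%VS = fullv) (xy : f0 x = iota y).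
Local Notation G := 'Gal({:N} / 1%AS)%g.

Lemma gal_rat_all (g : gal_of {:N}) : g \in G.
Proof. by apply: gal_fixP => z; apply: gal_fix_rat. Qed.

Lemma gal_emb (g : gal_of {:N}) : exists k, iota (g y) = emb k x.
Proof.
have [tau h] := gal_extends iota g; have [k hk] := emb_all (tau \o f0).
by exists k; rewrite h -xy -hk.
Qed.

Lemma emb_gal (k : 'I_(\dim {:K})) : exists g : gal_of {:N}, iota (g y) = emb k x.
Proof.
have [tau htau] : exists tau : {rmorphism algC -> algC}, tau (f0 x) = emb k x.
  apply: conjugate_aut; have [q [eq _] _] := minCpolyP (f0 x).
  have : root (minCpoly (f0 x)) (f0 x) := root_minCpoly _.
  by rewrite eq /root -!rmorph_horner_alg !fmorph_eq0.
have [nu hnu] := restrict_aut_to_normal_num_field iota tau.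
have : root (minPoly 1 y) (nu y).
  have /polyOver1P [m em] := minPolyOver 1 y; have := root_minPoly 1 y; rewrite em.
  rewrite -(fmorph_root nu) -map_poly_comp (eq_map_poly (g := in_alg N)) // => a /=.
  by rewrite rmorph_alg.
move=> /(normalField_root_minPoly (sub1v _) (normalFieldf _) (memvf y)) [g _ gy].
by exists g; rewrite gy hnu -xy htau.
Qed.

(** Sending [g] to the embedding it induces on the copy [K] of the field of [y] has the cosets of
    the stabiliser of [y] as fibres, all of the same size [s]. *)
Lemma gal_orbit_prod : exists2 s, (s * \dim {:K})%N = #|G| &
  forall (R : comNzRingType) (f : algC -> R),
    \prod_(g in G) f (iota (g y)) = (\prod_k f (emb k x)) ^+ s.
Proof.
pose kof g := sval (cid (gal_emb g)); have kofE (g : gal_of {:N}) : iota (g y) = emb (kof g) x := svalP (cid (gal_emb g)).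
pose gk k := sval (cid (emb_gal k)); have gkE k : iota (gk k y) = emb k x := svalP (cid (emb_gal k)).
pose S := [set g in G | g y == y].
have fiber k : #|[set g in G | kof g == k]| = #|S|.
  rewrite -(card_imset S (mulIg (gk k))); apply: eq_card => g; rewrite inE gal_rat_all /=.
  apply/eqP/imsetP => [gk'|[h]].
    exists (g * (gk k)^-1)%g; last by rewrite mulgVK.
    rewrite inE gal_rat_all /= galM_all; apply/eqP.
    have -> : g y = gk k y by apply: (fmorph_inj iota); rewrite gkE kofE gk'.
    by rewrite galVK.
  rewrite inE => /andP[_ /eqP hy] ->; apply: (emb_generator_inj gx).
  by rewrite -kofE galM_all hy gkE.
exists #|S|.
  rewrite -[RHS]sum1_card [RHS](partition_big kof xpredT) //=.
  rewrite [RHS](eq_bigr (fun=> #|S|)); first by rewrite sum_nat_const card_ord mulnC.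
  move=> k _.
  by rewrite -(fiber k) -sum1_card; apply: eq_bigl => g; rewrite inE.
move=> R f; rewrite (partition_big kof xpredT) //= -prodrXl; apply: eq_bigr => k _.
rewrite -(fiber k) -prodr_const; apply: eq_big => [g|g /andP[_ /eqP <-]]; first by rewrite inE.
by rewrite kofE.
Qed.

End GaloisOrbits.

Section WeilHeight.
Variable R : realType.

Lemma weil_heightE (a : algC) : exists (K : fieldExtType rat) (f0 : {rmorphism K -> algC}) (x : K),
  [/\ f0 x = a, <<1; x>>%VS = fullv & weil_height R a = height_in R x].
Proof.
rewrite /weil_height; case: (num_field_exists [:: a]) => K [f0 [s es gs]].
case: s es gs => [|x [|]] //= [<-] gs; exists K, f0, x; split=> //.
by rewrite -gs adjoin_seq1.
Qed.

Lemma weil_height_ge0 (a : algC) : 0 <= weil_height R a.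
Proof.
have [K [f0 [x [_ _ ->]]]] := weil_heightE a; rewrite /height_in.
by elim/big_ind: _ => // [a1 a2 h1 h2|v _]; rewrite ?mulr_ge0 ?powR_ge0.
Qed.

(** The height is computed in an abstract copy of the field of [iota y]; [gal_orbit_prod] moves the
    bound to any larger normal [N], with the order of its group as exponent. *)
Lemma weil_height_ge (N : splittingFieldType rat) (iota : {rmorphism N -> algC}) (y : N)
    (L : seq (option nat)) : uniq L -> (forall l, l \in L -> rat_place l) ->
  \prod_(l <- L) \prod_(g in 'Gal({:N} / 1%AS)%g) Num.max 1 (algC_abs R l (iota (g y))) <=
  weil_height R (iota y) ^+ #|'Gal({:N} / 1%AS)%g|.
Proof.
move=> uL Lp; have [K [f0 [x [fx gx hH]]]] := weil_heightE (iota y).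
have [s <- hs] := gal_orbit_prod gx fx; rewrite hH mulnC exprM.
under eq_bigr do rewrite (hs _ (fun a => Num.max 1 (algC_abs R _ a))).
rewrite prodrXl; apply: lerXn2r; last exact: height_in_ge.
  by rewrite nnegrE; apply: prodr_ge0 => l _; apply: prodr_ge0 => k _; rewrite le_max ler01.
by rewrite nnegrE exprn_ge0 // -hH weil_height_ge0.
Qed.

End WeilHeight.

(** * The product formula over the rationals, restricted to a finite set of primes *)

Section ProductFormula.
Variables (R : realType) (M : seq nat).
Hypotheses (uM : uniq M) (pM : forall q, q \in M -> prime q).

Lemma prod_logn n : (0 < n)%N -> {subset primes n <= M} -> n = (\prod_(q <- M) q ^ logn q n)%N.
Proof.
move=> n0 sub; rewrite {1}(prod_prime_decomp n0) prime_decompE big_map /=.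
rewrite [RHS](bigID (mem (primes n))) /= [X in (_ * X)%N]big1_seq ?muln1; last first.
  by move=> q /andP[qn qM]; rewrite -logn_gt0 -leqNgt leqn0 in qn; rewrite (eqP qn).
rewrite -[RHS]big_filter; apply: perm_big; apply: uniq_perm; rewrite ?primes_uniq ?filter_uniq //.
by move=> q; rewrite mem_filter; case: (boolP (q \in primes n)) => //= /sub ->.
Qed.

Lemma product_formula (q : rat) : q != 0 -> {subset primes `|numq q| <= M} ->
  {subset primes `|denq q| <= M} -> \prod_(l <- None :: map Some M) rat_abs R l q = 1.
Proof.
move=> q0 sn sd; rewrite big_cons big_map /=.
have n0 : (0 < `|numq q|)%N by rewrite absz_gt0 numq_eq0.
have d0 : (0 < `|denq q|)%N by rewrite absz_gt0 denq_neq0.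
have -> : \prod_(l <- M) padic_abs R l q = `|denq q|%:R / `|numq q|%:R.
  rewrite {1}(prod_logn d0 sd) {1}(prod_logn n0 sn) !natr_prod -prodf_div.
  rewrite !big_seq; apply: eq_bigr => l lM; rewrite /padic_abs (negPf q0).
  by rewrite expfzDr ?pnatr_eq0 -?lt0n ?prime_gt0 ?pM // -exprnP -exprnN !natrX.
rewrite -[q in ratr q]divq_num_den fmorph_div /= !ratr_int normrM normfV.
rewrite -!intr_norm -!abszE -!pmulrn; field.
by rewrite !pnatr_eq0 -!lt0n n0 d0.
Qed.

Lemma denq_le_prod (q : rat) : {subset primes `|denq q| <= M} ->
  `|denq q|%:R <= \prod_(l <- M) Num.max 1 (padic_abs R l q).
Proof.
move=> sd; have d0 : (0 < `|denq q|)%N by rewrite absz_gt0 denq_neq0.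
rewrite {1}(prod_logn d0 sd) natr_prod !big_seq; apply: ler_prod => l lM.
have pl := pM lM; rewrite ler0n /=; have [ld|] := boolP (l \in primes `|denq q|); last first.
  by rewrite -logn_gt0 -leqNgt leqn0 => /eqP ->; rewrite le_max lexx.
rewrite le_max; apply/orP; right.
have q0 : q != 0 by apply: contraTneq ld => ->.
rewrite /padic_abs (negPf q0); have -> : logn l `|numq q| = 0%N.
  apply/eqP; rewrite -leqn0 leqNgt logn_gt0; apply/negP => ln.
  have : (l %| gcdn `|numq q| `|denq q|)%N.
    by move: ln ld; rewrite dvdn_gcd !mem_primes => /and3P[_ _ ->] /and3P[].
  by rewrite (eqP (coprime_num_den q)) Euclid_dvd1.
by rewrite subr0 -exprnP natrX.
Qed.

End ProductFormula.

Section OrbitBound.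
Variables (R : realType) (p : nat) (N : splittingFieldType rat) (iota : {rmorphism N -> algC}).
Variables (K : {subfield N}) (y : N).
Hypotheses (pp : prime p) (dy : (adjoin_degree K y <= 6)%N)
  (close : forall g : gal_of {:N},
     close_conjugates (fun x => algC_abs R (Some p) (iota (g x))) p K y).
Local Notation G := 'Gal({:N} / 1%AS)%g.
Local Notation V l := (algC_abs R l).

Let X := undup (map (fun h : gal_of {:N} => h y) (enum 'Gal({:N} / K)%g)).
Let m := size X.
Let PP := [seq u <- [seq (a, b) | a <- X, b <- X] | u.1 != u.2].
(** As [g] runs through the Galois group, [V l (iota (g x))] runs through the places of [N] above
    [l], possibly with repetitions. *)
Let mx l (g : gal_of {:N}) x : R := Num.max 1 (V l (iota (g x))).
Let T l g := \prod_(x <- X) mx l g x.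
Let E l (g : gal_of {:N}) := \prod_(u <- PP) V l (iota (g u.2) - iota (g u.1)).

Lemma orbit_mem h : h \in 'Gal({:N} / K)%g -> h y \in X.
Proof. by move=> hG; rewrite mem_undup; apply/mapP; exists h; rewrite ?mem_enum. Qed.

Lemma orbit_size : (m <= 6)%N.
Proof.
have := @max_poly_roots _ (minPoly K y) X _ _ (undup_uniq _).
rewrite size_minPoly ltnS -size_poly_gt0 size_minPoly => le; apply: leq_trans dy; apply: le => //.
apply/allP => _ /[!mem_undup] /mapP [h /[!mem_enum] hG ->].
exact: root_minPoly_gal (subvf K) hG (memvf y).
Qed.

Lemma max_value_ge1 l g x : 1 <= mx l g x. Proof. by rewrite le_max lexx. Qed.
Lemma max_value_ge0 l g x : 0 <= mx l g x. Proof. exact: le_trans ler01 (max_value_ge1 l g x). Qed.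

#[local] Hint Resolve max_value_ge0 max_value_ge1 : core.

Lemma prod_ge1 I (r : seq I) (P : pred I) (f : I -> R) : (forall i, 1 <= f i) ->
  1 <= \prod_(i <- r | P i) f i.
Proof.
move=> h; elim/big_ind: _ => // a b a1 b1.
by rewrite -[1]mulr1 ler_pM ?ler01.
Qed.

(** Once the diagonal pairs are added, each element of the orbit occurs [m] times in either
    position. *)
Lemma orbit_pairs_bound l g : \prod_(u <- PP) (mx l g u.1 * mx l g u.2) <= T l g ^+ (2 * m).
Proof.
rewrite big_filter; apply: (@le_trans _ _ (\prod_(u <- [seq (a, b) | a <- X, b <- X]) (mx l g u.1 * mx l g u.2))).
  rewrite [leRHS](bigID (fun u => u.1 != u.2)) /= ler_peMr //.
    by apply: prodr_ge0 => u _; rewrite mulr_ge0.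
  by apply: prod_ge1 => u; rewrite -[1]mulr1 ler_pM.
rewrite big_allpairs_dep /= (eq_bigr (fun a => mx l g a ^+ m * T l g)); last first.
  by move=> a _; rewrite big_split /= -/(T l g) big_const_seq count_predT iter_mulr_1.
rewrite big_split /= prodrXl -/(T l g) big_const_seq count_predT iter_mulr_1.
by rewrite -exprD addnn mul2n.
Qed.

Lemma orbit_pairs_uniq : uniq PP.
Proof. by apply: filter_uniq; apply: allpairs_uniq => //; rewrite ?undup_uniq // => -[a b] [c d]. Qed.

Lemma orbit_pairs_size : (size PP <= m * m)%N.
Proof. by rewrite size_filter (leq_trans (count_size _ _)) // size_allpairs. Qed.

(** [gain] records the one close pair at [p]; [loss] is the cube of the constant 2 needed to bound a
    sum by a product of maxima, for at most [m ^ 2] pairs. *)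
Let gain l : R := if l is Some q then if q == p then p%:R else 1 else 1.
Let loss (l : option nat) : R := if l is None then 8%:R ^+ (m * m) else 1.

(** All differences get the trivial bound by two maxima, except one close pair at [p]. The exponent
    [6 * m] is 3 times the [2 * m] of [orbit_pairs_bound]. *)
Lemma orbit_local_bound l g : rat_place l -> E l g ^+ 3 * gain l <= loss l * T l g ^+ (6 * m).
Proof.
move=> lp; have va := algC_absP R lp.
have E0 : 0 <= E l g by apply: prodr_ge0 => u _; apply: (abs_ge0 va).
have mV x : V l (iota (g x)) <= mx l g x by rewrite le_max lexx orbT.
have cube (a b : R) : 0 <= a -> a <= b -> a ^+ 3 <= b ^+ 3.
  by move=> a0 ab; apply: lerXn2r => //; rewrite nnegrE (le_trans a0).
case: l lp va E0 mV => [q|] lp va E0 mV; last first.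
  rewrite /gain /loss mulr1.
  have -> : 8%:R ^+ (m * m) * T None g ^+ (6 * m) = (2%:R ^+ (m * m) * T None g ^+ (2 * m)) ^+ 3.
    have -> : 8%:R = 2%:R ^+ 3 :> R by rewrite -natrX.
    by rewrite [RHS]exprMn -!exprM; congr (_ ^+ _ * T _ _ ^+ _); lia.
  apply: cube => //; apply: (@le_trans _ _ (\prod_(u <- PP) (2%:R * (mx None g u.1 * mx None g u.2)))).
    apply: ler_prod => u _; rewrite (abs_ge0 va) /=;
    have tri a b : V None (a - b) <= V None a + V None b.
      by rewrite -(absN va b); apply: (absD va).
    apply: (le_trans (tri _ _)).
    have h a b : 1 <= a -> 1 <= b -> b + a <= 2%:R * (a * b) :> R by move=> *; nra.
    by apply: (le_trans (lerD (mV _) (mV _))); apply: h.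
  rewrite big_split /= big_const_seq count_predT iter_mulr_1; apply: ler_pM.
  - by rewrite exprn_ge0.
  - by apply: prodr_ge0 => u _; rewrite mulr_ge0.
  - by apply: ler_weXn2l; [rewrite ler1n|exact: orbit_pairs_size].
  exact: orbit_pairs_bound.
have vu := algC_abs_ultra R lp.
have pair u : V (Some q) (iota (g u.2) - iota (g u.1)) <= mx (Some q) g u.1 * mx (Some q) g u.2.
  apply: (le_trans (ultraB va _ _ vu)); rewrite ge_max; apply/andP; split.
    by apply: (le_trans (mV _)); rewrite ler_peMl.
  by apply: (le_trans (mV _)); rewrite ler_peMr.
have pw : (\prod_(u <- PP) (mx (Some q) g u.1 * mx (Some q) g u.2)) ^+ 3 <= T (Some q) g ^+ (6 * m).
  rewrite (_ : (6 * m = 2 * m * 3)%N) ?(exprM _ (2 * m)%N 3); last by lia.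
  by apply: cube; rewrite ?orbit_pairs_bound //; apply: prodr_ge0 => u _; rewrite mulr_ge0.
rewrite /loss mul1r; apply: le_trans pw; rewrite /gain; case: eqP => [eqp|_]; last first.
  rewrite mulr1; apply: cube => //; apply: ler_prod => u _.
  by rewrite (abs_ge0 va) pair.
subst q; have [h [g' [hG gG' ne le]]] := close g.
pose u0 := (h y, g' (h y)).
have u0P : u0 \in PP.
  rewrite mem_filter /= eq_sym ne; apply: allpairs_f; first exact: orbit_mem.
  by rewrite -galM_all orbit_mem // fingroup.groupM.
rewrite /E !(bigD1_seq u0 u0P orbit_pairs_uniq) /= exprMn [leRHS]exprMn mulrAC ler_pM //.
- by rewrite mulr_ge0 ?exprn_ge0 ?(abs_ge0 va).
- by apply: exprn_ge0; apply: prodr_ge0 => u _; apply: (abs_ge0 va).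
- by rewrite -!rmorphB.
apply: cube; first by apply: prodr_ge0 => u _; apply: (abs_ge0 va).
by apply: ler_prod => u _; rewrite (abs_ge0 va) pair.
Qed.

Let Y l := \prod_(g in G) mx l g y.

(** Translation in the group shows that all elements of the orbit contribute the same product. *)
Lemma prod_orbit_value l : \prod_(g in G) T l g = Y l ^+ m.
Proof.
rewrite exchange_big /= -[m]count_predT -iter_mulr_1 -big_const_seq big_seq [RHS]big_seq.
apply: eq_bigr => _ /[!mem_undup] /mapP [h /[!mem_enum] hG ->].
rewrite /Y [RHS](reindex_inj (mulgI h)) /=; apply: eq_big => [g|g _]; first by rewrite !gal_rat_all.
by rewrite /mx galM_all.
Qed.

(* Product formula for the product of all differences of conjugates of [y] over
   [K]: at each place over [p] one difference is smaller than trivially expected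
   by the factor [p ^ (- 1 / 3)]. *)
Lemma orbit_bound : p%:R <= (8%:R * weil_height R (iota y) ^+ 6) ^+ 36.
Proof.
pose beta := \prod_(u <- PP) (u.2 - u.1).
have b0 : beta != 0.
  rewrite prodf_seq_neq0; apply/allP => u; rewrite mem_filter => /andP[ne _] /=.
  by rewrite subr_eq0 eq_sym.
(* The norm of the product of differences is a rational number, so the product formula is needed
   over the rationals only. *)
have /vlineP [q hq] : galNorm 1%VS {:N} beta \in 1%VS.
  have /galois_fixedField h := number_field_galois (1%AS : {subfield N}).
  by move: (galNorm_fixedField 1%AS (memvf beta)); rewrite [fixedField _]h.
have q0 : q != 0.
  apply: contraNneq b0 => q0; move/eqP: hq; rewrite q0 scale0r /galNorm prodf_seq_eq0.
  by case/hasP => g _ /andP[_]; rewrite fmorph_eq0.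
pose M := undup (p :: primes `|numq q| ++ primes `|denq q|).
have uM : uniq M by apply: undup_uniq.
have pM l : l \in M -> prime l.
  by rewrite mem_undup inE mem_cat => /or3P[/eqP -> //||]; rewrite mem_primes => /andP[].
pose L := None :: map Some M.
have Lp l : l \in L -> rat_place l.
  by rewrite inE => /orP[/eqP -> //|/mapP [k kM ->]]; apply: pM.
have uL : uniq L.
  by rewrite /= map_inj_uniq ?uM ?andbT => [|a b [->]] //; apply/mapP => -[].
have PF : \prod_(l <- L) \prod_(g in G) E l g = 1.
  have sn : {subset primes `|numq q| <= M} by move=> l h; rewrite mem_undup inE mem_cat h orbT.
  have sd : {subset primes `|denq q| <= M} by move=> l h; rewrite mem_undup inE mem_cat h !orbT.
  rewrite -[RHS](product_formula R uM pM q0 sn sd) [LHS]big_seq [RHS]big_seq; apply: eq_bigr => l /Lp lp; have va := algC_absP R lp.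
  rewrite -algC_abs_rat // -(rmorph_ratA iota) -hq rmorph_prod (abs_prod va).
  apply: eq_bigr => g _; rewrite rmorph_prod rmorph_prod (abs_prod va).
  by apply: eq_bigr => u _; rewrite !rmorphB.
pose Q := \prod_(l <- L) Y l; pose H := weil_height R (iota y).
have QH : Q <= H ^+ #|G| by apply: weil_height_ge.
have Q1 : 1 <= Q by apply: prod_ge1 => l; apply: prod_ge1.
have H0 : 0 <= H by apply: weil_height_ge0.
have G0 : (0 < #|G|)%N by apply/card_gt0P; exists 1%g; apply: gal_rat_all.
have lhs : \prod_(l <- L) \prod_(g in G) (E l g ^+ 3 * gain l) = p%:R ^+ #|G|.
  under eq_bigr do rewrite big_split /= prodrXl prodr_const.
  rewrite big_split /= !prodrXl PF expr1n mul1r /L big_cons mul1r big_map; congr (_ ^+ _).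
  rewrite (bigD1_seq p) ?mem_undup ?mem_head //= eqxx big1 ?mulr1 // => l.
  by move=> /negPf ->.
have rhs : \prod_(l <- L) \prod_(g in G) (loss l * T l g ^+ (6 * m)) =
    (8%:R ^+ #|G| * Q ^+ 6) ^+ (m * m).
  under eq_bigr do rewrite big_split /= prodrXl prodr_const prod_orbit_value.
  have hl : \prod_(l <- L) loss l = 8%:R ^+ (m * m) by rewrite /L big_cons big_map big1 ?mulr1.
  rewrite big_split /= !prodrXl hl -/Q [RHS]exprMn -!exprM; congr (_ ^+ _ * _ ^+ _); [exact: mulnC|lia].
(* The exponent [m * m] is replaced by 36 because the base is at least 1 and the orbit has at most 6
   elements; afterwards [Q] is replaced by [H ^+ #|G|]. *)
have : p%:R ^+ #|G| <= ((8%:R * H ^+ 6) ^+ 36) ^+ #|G|.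
  rewrite -lhs; apply: (@le_trans _ _ ((8%:R ^+ #|G| * Q ^+ 6) ^+ (m * m))).
    rewrite -rhs !big_seq; apply: ler_prod => l lL; have va := algC_absP R (Lp l lL).
    apply/andP; split.
      apply: prodr_ge0 => g _; rewrite mulr_ge0 ?exprn_ge0 //.
        by apply: prodr_ge0 => u _; apply: (abs_ge0 va).
      by rewrite /gain; case: (l) => // k; case: eqP.
    apply: ler_prod => g _; rewrite orbit_local_bound ?Lp // andbT mulr_ge0 ?exprn_ge0 //.
      by apply: prodr_ge0 => u _; apply: (abs_ge0 va).
    by rewrite /gain; case: (l) => // k; case: eqP.
  apply: (@le_trans _ _ ((8%:R ^+ #|G| * Q ^+ 6) ^+ 36)).
    apply: ler_weXn2l; last exact: (leq_mul orbit_size orbit_size).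
    by apply: mulr_ege1; apply: exprn_ege1; rewrite ?ler1n.
  rewrite -exprM [(36 * _)%N]mulnC exprM;
  have nn : 0 <= 8%:R * H ^+ 6 by rewrite mulr_ge0 ?exprn_ge0.
  have nn' : 0 <= 8%:R ^+ #|G| * Q ^+ 6 by rewrite mulr_ge0 ?exprn_ge0 ?(le_trans ler01 Q1).
  apply: lerXn2r; [exact: nn'|by rewrite nnegrE exprn_ge0|].
  rewrite exprMn ler_wpM2l ?exprn_ge0 // -exprM mulnC exprM; apply: lerXn2r => //.
    by rewrite nnegrE (le_trans ler01).
  by rewrite nnegrE exprn_ge0.
by rewrite ler_pXn2r ?nnegrE ?exprn_ge0 ?mulr_ge0 ?exprn_ge0.
Qed.

End OrbitBound.

(** * Finiteness *)

Lemma tower_splitting (F : nat -> fieldExtType rat) n :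
  exists (N : splittingFieldType rat) (iota : {rmorphism N -> algC}),
    forall x, tower F n x -> exists y, iota y = x.
Proof.
pose t j := sval (cid (primitive_element_exists (F j))).
have tE j : <<1; t j>>%VS = fullv := svalP (cid (primitive_element_exists (F j))).
pose s := sqrtC (- 3%:R) :: flatten [seq [seq emb k (t j) | k <- enum 'I_(\dim {: F j})] | j <- iota 0 n].
have [N [f hf]] := splitting_number_field s; exists N, f.
apply: smallest_sub.
  split; first by exists 1; rewrite rmorph1.
    by move=> _ _ [a <-] [b <-]; exists (a - b); rewrite rmorphB.
  by move=> _ _ [a <-] [b <-]; exists (a / b); rewrite fmorph_div.
have [r er] := hf _ (mem_head _ _).
move=> x [h|[j [k [y [jn ->]]]]].
  have /pred2P [->|->] : (x == sqrtC (- 3%:R)) || (x == - sqrtC (- 3%:R)).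
  - by rewrite -eqf_sqr sqrtCK h.
  - by exists r.
  - by exists (- r); rewrite rmorphN er.
have [m em] : exists m, f m = emb k (t j).
  apply: hf; rewrite inE; apply/orP; right; apply/flattenP.
  exists [seq emb k (t j) | k <- enum 'I_(\dim {: F j})]; last by apply: map_f; rewrite mem_enum.
  by apply/mapP; exists j; rewrite ?mem_iota.
have : y \in <<1; t j>>%VS by rewrite tE memvf.
move=> /Fadjoin_polyP [q /polyOver1P [g ->] ->].
by exists (map_poly (in_alg N) g).[m]; rewrite !rmorph_horner_alg em.
Qed.

(** Composing [f] with an automorphism of [N] gives the same [K], because the tower is normal. So
    [tower_close] applies at every place of [N] above [p], as [orbit_bound] requires. *)
Lemma tower_prime_le (R : realType) (F : nat -> fieldExtType rat) (p n : nat) (a : algC) :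
  prime p -> (3 < p)%N -> (\dim {: F n} <= 3)%N ->
  (forall j, (j < n)%N -> ~~ (p%:Z %| discr (F j))%Z) ->
  discr (F n) != 0 -> (p%:Z %| discr (F n))%Z ->
  [\/ (exists iota : {rmorphism F n -> algC}, galois_over_rat (range iota)),
      pure_cubic_generator (F n), odd_disc_generator (F n) p | special_cubic_generator (F n)] ->
  tower F n.+1 a -> ~ tower F n a -> p%:R <= (8%:R * weil_height R a ^+ 6) ^+ 36.
Proof.
move=> pp p3 hdeg punr D0 pD cond ta nta.
have [N [f hf]] := tower_splitting F n.+1; have tf := tower_subfield F n.
have [K hK] : exists K : {subfield N}, forall x, x \in K <-> tower F n (f x).
  have [t1 tB tD] := subfield_preimage f tf.
  apply: (subfield_of_set (P := fun x => tower F n (f x))) => // [x y hx hy|q x hx].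
    by rewrite rmorphM; apply: (sfieldM tf).
  rewrite -mulr_algl rmorphM; apply: (sfieldM tf) => //.
  by rewrite rmorph_ratA; apply: sfield_rat.
have [y ey] := hf _ ta; rewrite -ey.
have yK : y \notin K by apply/negP => /hK; rewrite ey.
have close (g : gal_of {:N}) :
    close_conjugates (fun x => algC_abs R (Some p) (f (g x))) p K y /\ (adjoin_degree K y <= 6)%N.
  have [tau htau] := gal_extends f g; have [tau' htau'] := gal_extends f (g^-1)%g.
  apply: (@tower_close R F p n pp p3 hdeg punr D0 pD cond N (f \o g) K) => //=.
  - by move=> x /hf [z <-]; exists (g^-1%g z); rewrite galKV.
  - move=> x; split=> [/hK h|h]; first by rewrite htau; apply: tower_aut.
    by apply/hK; rewrite -[x](galVK g) htau'; apply: tower_aut.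
  by rewrite htau ey; apply: tower_aut.
apply: (orbit_bound (K := K)) => //; first by have [] := close 1%g.
by move=> g; have [] := close g.
Qed.

(** * Northcott's theorem inside one number field *)

Section BoundedDegree.
Variable R : realType.

(** The constant [c] is 1 for an ultrametric absolute value and 2 for the usual one, so that one
    induction serves both. *)
Lemma abs_coef_bound (v : algC -> R) (c : R) (s : seq algC) i : is_abs v -> 1 <= c ->
  (forall a b, v (a - b) <= c * Num.max (v a) (v b)) ->
  v (\prod_(x <- s) ('X - x%:P))`_i <= c ^+ size s * \prod_(x <- s) Num.max 1 (v x).
Proof.
move=> va c1 hc; have c0 : 0 <= c by apply: le_trans c1.
have m0 x : 0 <= Num.max 1 (v x) by rewrite le_max ler01.
elim: s i => [|x s IH] i.
  rewrite !big_nil coef1 mulr1; case: eqP => _; first by rewrite (abs1 va).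
  by rewrite (abs0 va).
set B := c ^+ size s * _ in IH.
have B0 : 0 <= B by rewrite mulr_ge0 ?exprn_ge0 // prodr_ge0.
rewrite !big_cons mulrBl coefB coefXM mul_polyC coefZ /= exprS -mulrA.
apply: (le_trans (hc _ _)); rewrite ler_wpM2l // [leRHS](_ : _ = Num.max 1 (v x) * B); last first.
  by rewrite /B mulrCA.
rewrite ge_max; apply/andP; split.
  apply: (@le_trans _ _ B); last by rewrite ler_peMl // le_max lexx.
  by case: ifP => _; rewrite ?(abs0 va).
by rewrite (absM va) ler_pM ?(abs_ge0 va) // le_max lexx orbT.
Qed.

Lemma char_poly_rat (N : splittingFieldType rat) (f : {rmorphism N -> algC}) (y : N) :
  exists P : {poly rat}, map_poly ratr P = \prod_(g in 'Gal({:N} / 1%AS)%g) ('X - (f (g y))%:P).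
Proof.
pose Q := \prod_(g in 'Gal({:N} / 1%AS)%g) ('X - (g y)%:P).
have Q1 : Q \is a polyOver 1%VS.
  have h : fixedField 'Gal({:N} / 1%AS)%g = 1%VS := galois_fixedField (number_field_galois (1%AS : {subfield N})).
  apply/polyOverP => i; rewrite -h; apply/fixedFieldP => [|g _]; first exact: memvf.
  have gQ : map_poly g Q = Q.
    rewrite rmorph_prod /Q [RHS](reindex_inj (mulIg g)) /=.
    apply: eq_big => [k|k _]; first by rewrite !gal_rat_all.
    by rewrite rmorphB /= map_polyX map_polyC /= galM_all.
  by rewrite -[in RHS]gQ coef_map.
have /polyOver1P [P eP] := Q1; exists P.
have -> : map_poly ratr P = map_poly f (map_poly (in_alg N) P).
  by rewrite -map_poly_comp; apply: eq_map_poly => q /=; rewrite rmorph_ratA.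
rewrite -eP rmorph_prod; apply: eq_bigr => g _.
by rewrite rmorphB /= map_polyX map_polyC.
Qed.

Definition rat_box (B : nat) : seq rat :=
  [seq a%:~R / b%:R | a <- [seq (i%:Z - B%:Z) | i <- iota 0 (2 * B).+1], b <- iota 0 B.+1].

Lemma rat_boxP (B : nat) (q : rat) : (`|numq q| <= B)%N -> (`|denq q| <= B)%N -> q \in rat_box B.
Proof.
move=> nB dB; have h1 : numq q \in [seq (i%:Z - B%:Z) | i <- iota 0 (2 * B).+1].
  apply/mapP; exists (absz (numq q + B%:Z)); last by lia.
  by rewrite mem_iota /=; lia.
have h2 : `|denq q|%N \in iota 0 B.+1 by rewrite mem_iota.
rewrite -[q in q \in _]divq_num_den; apply/allpairsP; exists (numq q, `|denq q|%N); split=> //.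
by rewrite /= pmulrn absz_denq.
Qed.

(** The product runs over the whole group, so the degree depends on [N] alone. Numerator and
    denominator of a coefficient are at most the product of its values above 1, which
    [weil_height_ge] controls. *)
Lemma char_poly_coef_box (N : splittingFieldType rat) (f : {rmorphism N -> algC}) (y : N)
    (X : R) (P : {poly rat}) (B : nat) i : 1 <= X -> weil_height R (f y) <= X ->
  (2%:R * X) ^+ #|'Gal({:N} / 1%AS)%g| <= B%:R ->
  map_poly ratr P = \prod_(g in 'Gal({:N} / 1%AS)%g) ('X - (f (g y))%:P) -> P`_i \in rat_box B.
Proof.
move=> X1 hX hB eP; set G := 'Gal({:N} / 1%AS)%g in hB eP *; set q := P`_i.
(* Only at primes in the denominator of the coefficient can its value exceed 1. *)
pose M := primes `|denq q|; have uM : uniq M by apply: primes_uniq.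
have pM l : l \in M -> prime l by rewrite mem_primes => /andP[].
pose L := None :: map Some M.
have Lp l : l \in L -> rat_place l.
  by rewrite inE => /orP[/eqP -> //|/mapP [k kM ->]]; apply: pM.
have uL : uniq L.
  by rewrite /= map_inj_uniq ?uM ?andbT => [|a b [->]] //; apply/mapP => -[].
have H0 := weil_height_ge0 R (f y).
pose Y l := \prod_(g in G) Num.max 1 (algC_abs R l (f (g y))).
have Y0 l : 1 <= Y l.
  rewrite /Y; elim/big_ind: _ => // [a b|g _]; first exact: mulr_ege1.
  by rewrite le_max lexx.
have QY : \prod_(l <- L) Y l <= X ^+ #|G|.
  apply: (le_trans (@weil_height_ge R N f y L uL Lp)); apply: lerXn2r => //.
  by rewrite nnegrE (le_trans ler01).
pose s := map (fun g : gal_of {:N} => f (g y)) (enum G).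
have sE (T : Type) (idx : T) (op : Monoid.com_law idx) (h : algC -> T) :
    \big[op/idx]_(x <- s) h x = \big[op/idx]_(g in G) h (f (g y)).
  by rewrite big_map big_enum.
have ss : size s = #|G| by rewrite size_map -cardE.
have qE : ratr q = (\prod_(x <- s) ('X - x%:P))`_i by rewrite sE -eP coef_map.
have eY l : \prod_(x <- s) Num.max 1 (algC_abs R l x) = Y l by rewrite sE.
have cp l : l \in L -> Num.max 1 (rat_abs R l q) <= (if l is None then 2%:R ^+ #|G| else 1) * Y l.
  move=> /Lp lp; have va := algC_absP R lp; rewrite -algC_abs_rat // qE.
  rewrite ge_max; apply/andP; split.
    by apply: mulr_ege1 => //; case: (l) => // ; apply: exprn_ege1; rewrite ler1n.
  case: l lp va => [l|] lp va.
    have h1 := @abs_coef_bound _ 1 s i va (lexx 1); rewrite expr1n in h1.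
    rewrite -eY; apply: h1 => a b.
    by rewrite mul1r; apply: (ultraB va); apply: algC_abs_ultra.
  rewrite -eY -ss; apply: abs_coef_bound => // [|a b]; first by rewrite ler1n.
  have tri : algC_abs R None (a - b) <= algC_abs R None a + algC_abs R None b.
    by rewrite -(absN va b); apply: (absD va).
  apply: (le_trans tri); rewrite mulr_natl mulr2n.
  by apply: lerD; rewrite le_max lexx ?orbT.
have total : \prod_(l <- L) Num.max 1 (rat_abs R l q) <= B%:R.
  apply: le_trans hB; rewrite exprMn.
  apply: (@le_trans _ _ (\prod_(l <- L) ((if l is None then 2%:R ^+ #|G| else 1) * Y l))).
    rewrite !big_seq; apply: ler_prod => l lL; rewrite cp // andbT.
    by rewrite le_max ler01.
  rewrite big_split /=; apply: ler_pM => //; last 1 first.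
  - by rewrite big_cons big_map big1 ?mulr1.
  - by rewrite prodr_ge0 // => -[].
  - by rewrite prodr_ge0 // => l _; apply: le_trans (Y0 l).
have dle : `|denq q|%:R <= \prod_(l <- M) Num.max 1 (padic_abs R l q) by apply: denq_le_prod.
have d0 : 0 < `|denq q|%:R :> R by rewrite ltr0n absz_gt0 denq_neq0.
move: total; rewrite big_cons big_map /= => total.
apply: rat_boxP; rewrite -(ler_nat R); apply: le_trans total.
  apply: (@le_trans _ _ (`|ratr q| * `|denq q|%:R)).
    rewrite -{2}[q]divq_num_den fmorph_div /= !ratr_int normrM normfV -!intr_norm -!abszE -!pmulrn.
    by rewrite divfK ?gt_eqF.
  by apply: ler_pM => //; rewrite ?(ltW d0) // le_max lexx orbT.
apply: (le_trans dle); rewrite ler_peMl ?le_max ?lexx //.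
by rewrite prodr_ge0 // => l _; rewrite le_max ler01.
Qed.

Lemma northcott_image (N : splittingFieldType rat) (f : {rmorphism N -> algC}) (X : R) :
  1 <= X -> finite_set [set a | range f a /\ weil_height R a <= X].
Proof.
move=> X1; set G := 'Gal({:N} / 1%AS)%g.
have [B hB] : exists B : nat, (2%:R * X) ^+ #|G| <= B%:R.
  by exists (Num.bound ((2%:R * X) ^+ #|G|)); apply/ltW/archi_boundP; rewrite exprn_ge0 // mulr_ge0 // (le_trans ler01).
pose S := seq_sub (rat_box B).
pose P (h : {ffun 'I_#|G|.+1 -> S}) : {poly algC} := \poly_(i < #|G|.+1) ratr (val (h (inord i))).
pose D := [set h : {ffun 'I_#|G|.+1 -> S} | P h != 0].
apply: (@sub_finite_set _ _ (\bigcup_(h in D) [set x | root (P h) x])); last first.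
  apply: bigcup_finite => [|h Ph]; first exact: finite_finset.
  have [r er] := closed_field_poly_normal (P h).
  apply: (@sub_finite_set _ _ [set` r]) => [x|]; last exact: finite_seq.
  by rewrite /= er rootZ ?lead_coef_eq0 // root_prod_XsubC.
move=> _ [[y _ <-] hy]; have [Q eQ] := char_poly_rat f y.
have box i : Q`_i \in rat_box B by apply: (char_poly_coef_box i X1 hy hB eQ).
have sQ : (size Q <= #|G|.+1)%N.
  by rewrite -(size_map_poly (@ratr algC)) eQ -big_enum size_prod_XsubC -cardE.
pose h := [ffun i : 'I_#|G|.+1 => SeqSub (box i)].
have Ph : P h = map_poly ratr Q.
  apply/polyP => i; rewrite coef_poly coef_map /=; case: ltnP => [lt|ge].
    by rewrite ffunE /= inordK.
  by rewrite nth_default ?rmorph0 // (leq_trans sQ).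
exists h; rewrite /D /= Ph eQ; first by apply/prodf_neq0 => g _; rewrite polyXsubC_eq0.
by rewrite (bigD1 (1%g : gal_of {:N})) ?gal_rat_all //= rootM gal_id root_XsubC eqxx.
Qed.

End BoundedDegree.

Lemma northcott_tower (R : realType) (F : nat -> fieldExtType rat) n (X : R) :
  finite_set [set a | tower F n a /\ weil_height R a <= X].
Proof.
have [N [f hf]] := tower_splitting F n.
apply: sub_finite_set (northcott_image f (X := Num.max 1 X) _); last by rewrite le_max lexx.
move=> a [/hf [y <-] ha]; split; first by exists y.
by rewrite le_max ha orbT.
Qed.

(** Each value is taken by at most one positive index, so it is passed for good; nothing is assumed
    about [p 0]. *)
Lemma injective_eventually_gt (p : nat -> nat) :
  (forall i j, (0 < i)%N -> (i < j)%N -> p i <> p j) -> forall c, exists n, forall m, (n < m)%N -> (c < p m)%N.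
Proof.
move=> inj c; suff [n hn] : exists n, forall m, (n < m)%N -> (c <= p m)%N /\ c <> p m.
  by exists n => m /hn [le /eqP ne]; rewrite ltn_neqAle ne.
elim: c => [|c [n hn]].
  have [[i [i0 pi]]|none] := pselect (exists i, (0 < i)%N /\ p i = 0%N).
    by exists i => m im; split=> // e; apply: (inj i m) => //; rewrite pi.
  by exists 0%N => m m0; split=> // e; apply: none; exists m.
have [[i [i0 [ni pi]]]|none] := pselect (exists i, (0 < i)%N /\ (n < i)%N /\ p i = c.+1).
  exists i => m im; have [le ne] := hn m (ltn_trans ni im).
  split=> [|e]; first by rewrite ltn_neqAle le andbT; apply/eqP.
  by apply: (inj i m) => //; rewrite pi.
exists n => m nm; have [le ne] := hn m nm; split; first by rewrite ltn_neqAle le andbT; apply/eqP.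
by move=> e; apply: none; exists m; split=> //; apply: leq_ltn_trans nm.
Qed.

(** The sequence is indexed from 0, so [0 < i] is the condition [i > 1] of a sequence counted from
    1. The fields are abstract, and [iota] fixes their places in [algC]. *)
Theorem corollary5 (R : realType)
    (F : nat -> fieldExtType rat) (iota : forall i, {rmorphism F i -> algC})
    (p : nat -> nat)
    (hdeg : forall i, (\dim {: F i} <= 3)%N)
    (hp : forall i, (0 < i)%N ->
       [/\ prime (p i), ((p i)%:Z %| discr (F i))%Z
         & forall j, (j < i)%N -> ~~ ((p i)%:Z %| discr (F j))%Z])
    (hcond : forall i, (0 < i)%N ->
       [\/ galois_over_rat (range (iota i)),
           pure_cubic_generator (F i),
           odd_disc_generator (F i) (p i)
         | special_cubic_generator (F i)]) :
  northcott R (compositum (fun i => galois_closure (range (iota i)))).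
Proof.
move=> X X0; pose C := (8%:R * X ^+ 6) ^+ 36.
have pinj i j : (0 < i)%N -> (i < j)%N -> p i <> p j.
  move=> i0 ij e; have [_ pi _] := hp i i0; have [_ _ /(_ i ij)] := hp j (ltn_trans i0 ij).
  by rewrite -e pi.
(* Beyond [n] the primes exceed 3 and the bound imposed by [tower_prime_le] on elements of height at
   most [X], so no level above [n.+1] contributes anything new. *)
have [n hn] := injective_eventually_gt pinj (maxn 3 (Num.bound C)).
apply: sub_finite_set (northcott_tower F n.+1 X) => a [/(compositum_tower (iota := iota)) [m _ tm] ha].
split=> //; have [le|lt] := leqP m n.+1; first exact: towerS tm.
move: tm; rewrite -(subnK (ltnW lt)); elim: (m - n.+1)%N => [//|d IH].
rewrite addSn => td; have [/IH //|nt] := pselect (tower F (d + n.+1) a).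
set k := (d + n.+1)%N in td nt; have k0 : (0 < k)%N by rewrite /k addnS.
have nk : (n < k)%N by rewrite /k addnS ltnS leq_addl.
have [pk pD punr] := hp k k0; have := hn k nk; rewrite gtn_max => /andP[p3 pC].
(* The prime of the next index does not divide [discr (F k)], whereas it divides 0. *)
have D0 : discr (F k) != 0.
  by apply/eqP => D0; have [_ _ /(_ k (ltnSn k))] := hp k.+1 isT; rewrite D0 dvdz0.
have cond : [\/ (exists f : {rmorphism F k -> algC}, galois_over_rat (range f)),
    pure_cubic_generator (F k), odd_disc_generator (F k) (p k) | special_cubic_generator (F k)].
  by case: (hcond k k0) => h; [apply: Or41; exists (iota k)|apply: Or42|apply: Or43|apply: Or44].
have le := tower_prime_le R pk p3 (hdeg k) punr D0 pD cond td nt.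
have H0 := weil_height_ge0 R a; have X0' := ltW X0.
have : (p k)%:R <= C.
  apply: (le_trans le); apply: lerXn2r; rewrite ?nnegrE ?mulr_ge0 ?exprn_ge0 //.
  by rewrite ler_wpM2l //; apply: lerXn2r.
rewrite leNgt => /negP; case; apply: (@lt_trans _ _ (Num.bound C)%:R); last by rewrite ltr_nat.
by apply: archi_boundP; rewrite exprn_ge0 // mulr_ge0 ?exprn_ge0.
Qed.
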